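(* Let $n=n_1+n_2+\cdots+n_s\ge2$, where $s\ge1$ and $n_1\ge n_2\ge\cdots\ge n_s\ge1$ are integers. All polynomial tau-functions of the $(n_1,n_2,\ldots,n_s)$-KdV hierarchy are, up to a shift over the lattice, of the form $$\tau(q,t)=\sum_{\substack{m_1,\ldots,m_s\ge0\\ m_1+\cdots+m_s=r+k_1+\cdots+k_r}}\tau^{(m_1,m_2,\ldots,m_s)}(t)\,q_1^{m_1}q_2^{m_2}\cdots q_s^{m_s},$$ where $r$ is an integer with $1\le r<n$ and $\tau^{(m_1,m_2,\ldots,m_s)}(t)$ is the following determinant of size $m=r+k_1+\cdots+k_r$. Let $(H_1,\ldots,H_m)$ be the list of functions $$h_1,\ Dh_1,\ \ldots,\ D^{k_1}h_1,\ h_2,\ Dh_2,\ \ldots,\ D^{k_2}h_2,\ h_3,\ \ldots,\ D^{k_r}h_r$$ in this order. Then $\tau^{(m_1,\ldots,m_s)}(t)$ is the determinant of the $m\times m$ matrix whose entry in row $m_1+\cdots+m_{a-1}+i$ (with $1\le a\le s$, $1\le i\le m_a$) and column $\ell$ ($1\le\ell\le m$) is $$\frac{\partial^{\,m_a-i+1}H_\ell(t)}{\partial(t_1^{(a)})^{m_a-i+1}}.$$ Here $$D=\sum_{a=1}^s\frac{\partial}{\partial t^{(a)}_{n_a}},\qquad h_j(t)=\sum_{a=1}^s b^{(a)}_{j}\,s_{M_j^{(a)}}(t^{(a)}+c_j^{(a)}),\quad j=1,\ldots,r,$$ where $M_j^{(a)}$ are arbitrary positive integers, $c_j^{(a)}=(c_{1j}^{(a)},c_{2j}^{(a)},c_{3j}^{(a)},\ldots)$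 and $b^{(a)}_{j}$, for $1\le j\le r$ and $1\le a\le s$, are arbitrary complex constants, and $k_j$ are the non-negative integers $$k_j=\max\left\{\left\lceil\frac{M_j^{(a)}}{n_a}\right\rceil-1\ \Big|\ 1\le a\le s\right\},\qquad j=1,\ldots,r.$$ That is, every polynomial tau-function of the $(n_1,\ldots,n_s)$-KdV hierarchy is a shift over the lattice of such a $\tau(q,t)$ for some choice of these data, and conversely, for every choice of the data, every lattice shift of $\tau(q,t)$, if nonzero, is a polynomial tau-function of the $(n_1,\ldots,n_s)$-KdV hierarchy.
   Context: Variables: $t=(t_k^{(a)})_{1\le a\le s,\ k\ge1}$, with $t^{(a)}=(t_1^{(a)},t_2^{(a)},\ldots)$, a second copy $y=(y_k^{(a)})$, and $q_1^{\pm1},\ldots,q_s^{\pm1}$; all commute. The elementary Schur polynomials in one set of variables $u=(u_1,u_2,\ldots)$ are defined by $\exp\left(\sum_{i\ge1}u_iz^i\right)=\sum_{j\ge0}s_j(u)z^j$. Write ${\rm Res}\,dz\sum_i f_iz^i=f_{-1}$; $\lceil x\rceil$ is the smallest integer $\ge x$. A polynomial tau-function of the $(n_1,\ldots,n_s)$-KdV hierarchy is, for some $k\in\mathbb{Z}$, a nonzero element $$\tau(q,t)=\sum_{\substack{(m_1,\ldots,m_s)\in\mathbb{Z}^s\\ m_1+\cdots+m_s=k}}\tau^{(m_1,\ldots,m_s)}(t)\,q_1^{m_1}\cdots q_s^{m_s}$$ of $\mathbb{C}[q_a^{\pm1};1\le a\le s]\otimes\mathbb{C}[t_1^{(a)},t_2^{(a)},\ldots;1\le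 a\le s]$ (so only finitely many $\tau^{(m_1,\ldots,m_s)}$ are nonzero and each is a polynomial) such that for all $j=0,1,2,\ldots$ and all $(m_1,\ldots,m_s),(p_1,\ldots,p_s)\in\mathbb{Z}^s$ with $\sum_a m_a=k+1$ and $\sum_a p_a=k-1$ one has, identically in $t$ and $y$ (as formal power series in $t,y$ after expanding the exponential), $$\begin{aligned}{\rm Res}\,dz\sum_{a=1}^s&(-1)^{m_1+\cdots+m_{a-1}+p_1+\cdots+p_{a-1}}z^{m_a-p_a+jn_a-2}\exp\left(\sum_{i=1}^\infty(t_i^{(a)}-y_i^{(a)})z^i\right)\\ &\times\exp\left(\sum_{i=1}^\infty\frac{\frac{\partial}{\partial y_i^{(a)}}-\frac{\partial}{\partial t_i^{(a)}}}{i}z^{-i}\right)\tau^{(m_1,\ldots,m_a-1,\ldots,m_s)}(t)\,\tau^{(p_1,\ldots,p_a+1,\ldots,p_s)}(y)=0.\end{aligned}$$ A shift over the lattice by $(d_1,\ldots,d_s)\in\mathbb{Z}^s$ means relabeling $(m_1,\ldots,m_s)\mapsto(m_1+d_1,\ldots,m_s+d_s)$ of the components, i.e. multiplying $\tau(q,t)$ by $q_1^{d_1}\cdots q_s^{d_s}$. *)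

(* Defs.v *)
From HB Require Import structures.
From mathcomp Require Import all_boot all_order all_algebra.
From mathcomp Require Import finmap.
From mathcomp.multinomials Require Import monalg.
From mathcomp Require Import reals.
From mathcomp Require Import complex.

Set Implicit Arguments.
Unset Strict Implicit.
Unset Printing Implicit Defensive.

Import Order.TTheory GRing.Theory Num.Theory.
Local Open Scope ring_scope.

(* The base field K is meant to have characteristic 0, as factorials are inverted. *)
Section Polynomials.
Variable K : fieldType.

(* K[x_v ; v \in V], where V may be infinite. *)
Definition polyring (V : choiceType) := {malg K[{cmonom V}]}.

Definition var (V : choiceType) (v : V) : polyring V := << ucm v >>.

Definition pderiv (V : choiceType) (v : V) (p : polyring V) : polyring V :=
  \sum_(m <- msupp p) << p@_m *+ m v *g divcm m (ucm v) >>.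

(* Substitution x_v := x v. *)
Definition subst (V : choiceType) (A : comAlgType K) (x : V -> A)
    (p : polyring V) : A :=
  \sum_(m <- msupp p) p@_m *: \prod_(v <- finsupp m) x v ^+ m v.

(* A power series in z with coefficients in A is the sequence of its
   coefficients, and mulz L is the operator \sum_(i >= 1) L_i z^i acting on
   such series; L 0 is not used.  The k-th iterate of mulz L raises the order
   in z by at least k, so the coefficient of z^l in the exponential only
   involves the iterates k <= l. *)
Definition mulz (A : zmodType) (L : nat -> A -> A) (f : nat -> A) : nat -> A :=
  fun l => \sum_(1 <= i < l.+1) L i (f (l - i)%N).

Definition expz (A : lmodType K) (L : nat -> A -> A) (f : nat -> A) : nat -> A :=
  fun l => \sum_(k < l.+1) (k`!%:R^-1 : K) *: iter k (mulz L) f l.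

Definition constz (A : zmodType) (x : A) : nat -> A :=
  fun l => if l == 0%N then x else 0.

(* s_j(u_1, u_2, ...); u 0 is not used. *)
Definition schur (A : comAlgType K) (j : nat) (u : nat -> A) : A :=
  expz (fun i x => u i * x) (constz 1) j.

(* The residue at z = 0 of z^N (\sum_j S_j z^j) (\sum_(l < L) P_l z^(-l)). *)
Definition res_trunc (A : pzRingType) (L : nat) (N : int) (S P : nat -> A) : A :=
  \sum_(l < L) (if l%:Z - N - 1 is Posz j then S j * P l else 0).

End Polynomials.

Definition lattice (s : nat) := {ffun 'I_s -> int}.

Definition unitv (s : nat) (a : 'I_s) : lattice s := [ffun b => (b == a)%:R].

Definition tvars (s : nat) : choiceType := ('I_s * nat)%type.

(* The variable t_k^(a), for k >= 1, has index (a, k - 1). *)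
Definition tidx (s : nat) (a : 'I_s) (k : nat) : tvars s := (a, k.-1).

(* \sum_m tau^(m)(t) q^m, with finitely many nonzero terms, has the coefficients
   tau@_m : an element of K[q_a^(+-1)] \otimes K[t]. *)
Definition tau_space (K : fieldType) (s : nat) :=
  {malg (polyring K (tvars s))[lattice s]}.

(* Multiplication by q^d. *)
Definition lattice_shift (K : fieldType) (s : nat) (d : lattice s)
    (tau : tau_space K s) : tau_space K s :=
  \sum_(m <- msupp tau) << tau@_m *g m + d >>.

Section TauFunctions.
Variables (K : fieldType) (s : nat) (n : 'I_s -> nat).
Local Notation A := (polyring K (tvars s)).
(* K[t, y]: the t variables are on the left, the y variables on the right. *)
Local Notation B := (polyring K (tvars s + tvars s)%type).

Definition tvar (a : 'I_s) (k : nat) : B := var K (inl (tidx a k)).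
Definition yvar (a : 'I_s) (k : nat) : B := var K (inr (tidx a k)).
Definition in_t (p : A) : B := subst (fun v => var K (inl v)) p.
Definition in_y (p : A) : B := subst (fun v => var K (inr v)) p.

(* exp(\sum_i (t_i^(a) - y_i^(a)) z^i), by powers of z. *)
Definition exp_mult (a : 'I_s) : nat -> B :=
  expz (fun i x => (tvar a i - yvar a i) * x) (constz 1).

(* exp(\sum_i (d/dy_i^(a) - d/dt_i^(a)) / i z^(-i)) Q, by powers of z^(-1). *)
Definition exp_diff (a : 'I_s) (Q : B) : nat -> B :=
  expz (fun i x => (i%:R^-1 : K) *:
          (pderiv (inr (tidx a i)) x - pderiv (inl (tidx a i)) x))
       (constz Q).

(* As Q is a polynomial, exp_diff a Q has finitely many nonzero coefficients,
   so the residue is the eventual value of its truncations at z^(-L). *)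
Definition bilinear_identity (tau : tau_space K s) (j : nat) (m p : lattice s) : Prop :=
  exists L0 : nat, forall L : nat, (L0 <= L)%N ->
    \sum_(a < s) ((-1) ^ (\sum_(b < s | (b < a)%N) (m b + p b)) : K) *:
      res_trunc L (m a - p a + (j * n a)%:Z - 2)
        (exp_mult a)
        (exp_diff a (in_t tau@_(m - unitv a) * in_y tau@_(p + unitv a))) = 0.

Definition polynomial_tau (tau : tau_space K s) : Prop :=
  tau != 0 /\
  exists k : int,
    (forall m : lattice s, tau@_m != 0 -> \sum_a m a = k) /\
    (forall (j : nat) (m p : lattice s),
        \sum_a m a = k + 1 -> \sum_a p a = k - 1 ->
        bilinear_identity tau j m p).

Definition opD (p : A) : A := \sum_(a < s) pderiv (tidx a (n a)) p.

Variables (r : nat) (M : 'I_r -> 'I_s -> nat) (b : 'I_r -> 'I_s -> K)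
  (c : 'I_r -> 'I_s -> nat -> K).

(* c j a i is the i-th component, i >= 1, of c_j^(a); c j a 0 is not used. *)
Definition hfun (j : 'I_r) : A :=
  \sum_(a < s) b j a *:
    schur (M j a) (fun i => var K (tidx a i) + (c j a i)%:A).

Definition kexp (j : 'I_r) : nat :=
  (\max_(a < s) (`|Num.ceil ((M j a)%:R / (n a)%:R : rat)|%N).-1)%N.

Definition tau_size : nat := (r + \sum_(j < r) kexp j)%N.

Definition Hlist : seq A :=
  flatten [seq [seq iter e opD (hfun j) | e <- iota 0 (kexp j).+1]
          | j <- enum 'I_r].

(* The operators (d/dt_1^(a))^(m_a - i + 1), 1 <= i <= m_a, for a = 1, ..., s. *)
Definition row_ops (m : 'I_s -> nat) : seq (A -> A) :=
  flatten [seq [seq iter (m a - i).+1 (pderiv (tidx a 1)) | i <- iota 1 (m a)]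
          | a <- enum 'I_s].

Definition tau_component (m : 'I_s -> nat) : A :=
  \det (\matrix_(p < tau_size, l < tau_size)
          nth id (row_ops m) p (nth 0 Hlist l)).

Definition kdv_tau : tau_space K s :=
  \sum_(m : {ffun 'I_s -> 'I_tau_size.+1} | (\sum_a m a)%N == tau_size)
    << tau_component (fun a => m a) *g [ffun a => (m a)%:Z] >>.

End TauFunctions.

(* Main.v *)
Require Import Defs.
From HB Require Import structures.
From mathcomp Require Import all_boot all_order all_algebra all_fingroup.
From mathcomp Require Import finmap.
From mathcomp.multinomials Require Import monalg.
From mathcomp Require Import reals.
From mathcomp Require Import complex.
From mathcomp Require Import boolp.
From mathcomp Require Import ring zify.

Set Implicit Arguments.
Unset Strict Implicit.
Unset Printing Implicit Defensive.

Import Order.TTheory GRing.Theory Num.Theory.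
Local Open Scope ring_scope.

(* To finitely many coloured points attach the lattice vector counting them by
   colour and the times t_k^(a) = \sum x^k / k over the points x of colour a.
   There exp(\sum_k t_k^(a) z^k) is a product of factors 1 / (1 - x z), so the
   residue in the bilinear identity is a finite sum over the points, and tau
   multiplied by a coloured Vandermonde product is an alternating function Omega
   satisfying Pluecker relations.  Hence, up to a constant,
   Omega(X) = det (w_l(X_i)) for vectors of polynomials w_l (waves) whose span W
   is stable under D, the operator which divides the component of colour a by
   z^(n_a) and drops the remainder; a bialternant formula turns this into the
   determinants of the statement, D acting as the sum of the d/dt_(n_a)^(a).
   Removing from W the constant vectors, one at a time, amounts to a lattice
   shift, and a Jordan basis of the nilpotent operator D on the remaining space
   yields the functions h_j.  There are fewer than n blocks, because ker D has
   dimension n and contains a constant vector, which is not in the space.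
   Conversely, for a determinant with D-stable span the sum over the points is the
   expansion of a determinant with a repeated column; after a lattice shift which
   makes the numbers of points large, the points determine the polynomials. *)

(** * Polynomials in infinitely many variables *)

(** The identity is exploited for two values of j. At j = 0 it gives the Pluecker relations, which
    make Omega a determinant; at j = 1 the additional factor z^(n_a) turns into [drop_poly (n a)]
    and gives the D-stability of the span. Stability iterates, which covers all j in the converse.

    The obstacle is a circularity. With m_a points only the first m_a times of colour a can be
    prescribed, so values at points determine a component only if m_a is at least the number of
    times involved. A preliminary lattice shift governed by M secures this for tau, but the degrees
    of the waves then grow with M, and so does the number of times in their determinant. The remedy
    is a bound M + E with E independent of M: the same shift puts z^i, i < M, of every colour into
    W, so at least M constants are removed per colour, each lowering the degree in that colour by
    one, and waves of size at most E remain. M is then chosen above E.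

    Algebraic closedness serves two purposes: to realise prescribed times as power sums, and to
    extract a root of the overall constant, which has no place in the statement and is absorbed into
    the coefficients b. *)

Section Substitution.
Variables (K : fieldType) (V : choiceType) (A : comAlgType K) (x : V -> A).

Definition mon_subst (m : {cmonom V}) : A := \prod_(v <- finsupp m) x v ^+ m v.

Lemma mon_substE (d : {fset V}) (m : {cmonom V}) : (finsupp m `<=` d)%fset ->
  mon_subst m = \prod_(v <- d) x v ^+ m v.
Proof.
move=> h; rewrite /mon_subst; apply: big_fset_incl => // v vd vm.
by move: vm; rewrite -cmE_eq0 => /eqP ->; rewrite expr0.
Qed.

Lemma mon_substM (m1 m2 : {cmonom V}) :
  mon_subst (mmul m1 m2) = mon_subst m1 * mon_subst m2.
Proof.
pose d := (finsupp m1 `|` finsupp m2)%fset.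
rewrite (@mon_substE d) ?mdomD // (@mon_substE d m1) ?fsubsetUl //.
rewrite (@mon_substE d m2) ?fsubsetUr // -big_split /=.
by apply: eq_bigr => v _; rewrite cmM exprD.
Qed.

Lemma mon_subst1 : mon_subst mone = 1.
Proof. by rewrite /mon_subst mdom1 big_seq_fset0. Qed.

Lemma mon_substU v : mon_subst (ucm v) = x v.
Proof. by rewrite /mon_subst mdomU big_seq_fset1 cmUU expr1. Qed.

HB.instance Definition _ := @isMultiplicative.Build _ _ mon_subst
  (mon_substM, mon_subst1).

(** Recasts [subst] as the library's [mmap], from which the ring-morphism laws are inherited. *)
Lemma subst_mmap p : subst x p = mmap (in_alg A) mon_subst p.
Proof.
rewrite /subst /mmap; apply: eq_bigr => m _.
by rewrite -[LHS]mulr_algl.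
Qed.

Lemma subst_is_additive : additive (subst x).
Proof. by move=> p q; rewrite !subst_mmap raddfB. Qed.

Lemma subst_is_multiplicative : multiplicative (subst x).
Proof.
split=> [p q|]; rewrite !subst_mmap; last by rewrite mmap1.
exact: rmorphM.
Qed.

Lemma subst_is_scalable : scalable (subst x).
Proof.
move=> c p; rewrite !subst_mmap mmapZ //; first by rewrite /= mulr_algl.
Qed.

End Substitution.

HB.instance Definition _ (K : fieldType) (V : choiceType) (A : comAlgType K)
  (x : V -> A) := GRing.isAdditive.Build (polyring K V) A (subst x)
  (@subst_is_additive K V A x).
HB.instance Definition _ (K : fieldType) (V : choiceType) (A : comAlgType K)
  (x : V -> A) := GRing.isMultiplicative.Build (polyring K V) A (subst x)
  (@subst_is_multiplicative K V A x).
HB.instance Definition _ (K : fieldType) (V : choiceType) (A : comAlgType K)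
  (x : V -> A) := GRing.isScalable.Build K (polyring K V) A *:%R (subst x)
  (@subst_is_scalable K V A x).

Section SubstitutionTheory.
Variables (K : fieldType) (V : choiceType).
Implicit Types (p q : polyring K V) (v : V).

Lemma malgU_scale (m : {cmonom V}) (c : K) :
  << c *g m >> = c *: (<< m >> : polyring K V).
Proof.
apply/malgP => k; rewrite [RHS](mcoeffZ c (<< m >> : polyring K V) k).
by rewrite [LHS]mcoeffU [X in _ = _ * X]mcoeffU [RHS]mulrnAr [c * 1]mulr1.
Qed.

Lemma malgU1M (m1 m2 : {cmonom V}) :
  << m1 >> * << m2 >> = << mmul m1 m2 >> :> polyring K V.
Proof. by rewrite [LHS]malgM_def fgmulUU [1 * 1]mulr1. Qed.

Lemma subst_var (A : comAlgType K) (x : V -> A) v : subst x (var K v) = x v.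
Proof. by rewrite subst_mmap mmapU mon_substU /= scale1r mul1r. Qed.

Lemma substC (A : comAlgType K) (x : V -> A) (c : K) : subst x c%:A = c%:A.
Proof. by rewrite linearZ rmorph1. Qed.

Lemma polyring_lin_ind (P : polyring K V -> Prop) : P 0 ->
  (forall m, P << m >>) -> (forall c p q, P p -> P q -> P (c *: p + q)) ->
  forall p, P p.
Proof.
move=> P0 Pm PD p; rewrite [p]monalgE.
elim: (msupp p : seq _) => [|m d IH]; first by rewrite big_nil.
by rewrite big_cons malgU_scale; apply: PD.
Qed.

(** A monomial is peeled one variable at a time, by induction on its degree. Identities between
    morphisms or derivations are later checked on constants and variables through this principle. *)
Lemma polyring_ind (P : polyring K V -> Prop) :
  (forall c : K, P c%:A) -> (forall v, P (var K v)) ->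
  (forall p q, P p -> P q -> P (p + q)) ->
  (forall p q, P p -> P q -> P (p * q)) -> forall p, P p.
Proof.
move=> Pc Pv PD PM.
have Pm (m : {cmonom V}) : P << m >>.
  have [N] := ubnP (mdeg m); elim: N m => // N IH m mN.
  case: (fset_0Vmem (finsupp m)) => [m0|[v vm]].
    suff -> : m = mone by have := Pc 1; rewrite scale1r.
    by apply/eqP/cmP => v; rewrite cm1; apply/eqP; rewrite cmE_eq0 m0 in_fset0.
  have e : m = mmul (ucm v) (divcm m (ucm v)).
    apply/eqP/cmP => w; rewrite cmM divcmE subnKC // ucmE.
    by case: eqP => // <-; rewrite lt0n cmE_neq0.
  rewrite e -malgU1M; apply: PM; first exact: Pv.
  by apply: IH; move: mN; rewrite [in mdeg m]e mdegM mdegU add1n ltnS.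
apply: polyring_lin_ind => [||c p q Pp Pq]; first 2 last.
- by apply: PD => //; rewrite -mulr_algl; apply: PM.
- by have := Pc 0; rewrite scale0r.
exact: Pm.
Qed.

Lemma subst_ext (A : comAlgType K) (x y : V -> A) : x =1 y -> subst x =1 subst y.
Proof.
move=> xy p; rewrite /subst; apply: eq_bigr => m _; congr (_ *: _).
by apply: eq_bigr => v _; rewrite xy.
Qed.

End SubstitutionTheory.

Section MonomialLeibniz.
Variables (K : fieldType) (V : choiceType) (v : V) (A : comAlgType K).
Variable f : {cmonom V} -> A.
Hypothesis fM : forall m1 m2, f (mmul m1 m2) = f m1 * f m2.

Lemma divcm_mull (m1 m2 : {cmonom V}) : (0 < m1 v)%N ->
  divcm (mmul m1 m2) (ucm v) = mmul (divcm m1 (ucm v)) m2.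
Proof.
move=> m1v; apply/eqP/cmP => w; rewrite !(cmM, divcmE, ucmE).
by case: eqP => [<-|_]; rewrite ?subn0 // addnBAC.
Qed.

(** Where [divcm] truncates, the exponent of [v] is 0 and the coefficient in front kills the
    term. *)
Lemma monomial_leibniz (m1 m2 : {cmonom V}) :
  (mmul m1 m2 v)%:R *: f (divcm (mmul m1 m2) (ucm v)) =
  ((m1 v)%:R *: f (divcm m1 (ucm v))) * f m2 +
  f m1 * ((m2 v)%:R *: f (divcm m2 (ucm v))).
Proof.
rewrite -scalerAl -scalerAr -!fM cmM natrD scalerDl; congr (_ + _).
  case: (posnP (m1 v)) => [->|h]; first by rewrite !scale0r.
  by rewrite divcm_mull.
case: (posnP (m2 v)) => [->|h]; first by rewrite !scale0r.
by rewrite (mulmC m1 m2) divcm_mull // (mulmC m1).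
Qed.

End MonomialLeibniz.

Section LeibnizLinear.
Variables (K : fieldType) (A : comAlgType K) (D : {linear A -> A}) (c : K).

Lemma leibniz_linl (p p' q : A) : D (p * q) = D p * q + p * D q ->
  D (p' * q) = D p' * q + p' * D q ->
  D ((c *: p + p') * q) = D (c *: p + p') * q + (c *: p + p') * D q.
Proof.
move=> IH IH'; rewrite mulrDl -scalerAl !linearP /= IH IH'.
by rewrite !mulrDl scalerDr -!scalerAl addrACA.
Qed.

Lemma leibniz_linr (p q q' : A) : D (p * q) = D p * q + p * D q ->
  D (p * q') = D p * q' + p * D q' ->
  D (p * (c *: q + q')) = D p * (c *: q + q') + p * D (c *: q + q').
Proof.
move=> IH IH'; rewrite mulrC leibniz_linl; first by rewrite addrC ![_ * p]mulrC [_ * D p]mulrC.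
  by rewrite mulrC IH addrC mulrC [D p * _]mulrC.
by rewrite mulrC IH' addrC mulrC [D p * _]mulrC.
Qed.

End LeibnizLinear.

Section Derivation.
Variables (K : fieldType) (V : choiceType) (v : V).
Implicit Types (p q : polyring K V).
Local Notation pderiv := (@pderiv K V v).
Local Notation mon_deriv m := 
  (((m : {cmonom V}) v)%:R *: (<< divcm m (ucm v) >> : polyring K V)).

Lemma pderivEw (d : {fset {cmonom V}}) p : (msupp p `<=` d)%fset ->
  pderiv p = \sum_(m <- d) p@_m *: mon_deriv m.
Proof.
move=> h; rewrite /Defs.pderiv.
rewrite (eq_bigr (fun m => p@_m *: mon_deriv m)) => [|m _]; last first.
  by rewrite [LHS]malgU_scale [RHS]scalerA mulr_natr.
apply: big_fset_incl => // m _ /mcoeff_outdom ->; exact: scale0r.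
Qed.

Lemma pderiv_is_linear : linear pderiv.
Proof.
move=> c p q; pose d := (msupp p `|` msupp q `|` msupp (c *: p + q))%fset.
have hp : (msupp p `<=` d)%fset.
  by apply: fsubset_trans (fsubsetUl _ _); apply: fsubsetUl.
have hq : (msupp q `<=` d)%fset.
  by apply: fsubset_trans (fsubsetUl _ _); apply: fsubsetUr.
have hpq : (msupp (c *: p + q) `<=` d)%fset by apply: fsubsetUr.
rewrite (pderivEw hp) (pderivEw hq) (pderivEw hpq).
rewrite scaler_sumr -big_split /=; apply: eq_bigr => m _.
have -> : (c *: p + q)@_m = c * p@_m + q@_m.
  by rewrite [LHS]mcoeffD; congr (_ + _); apply: mcoeffZ.
by rewrite scalerDl -(scalerA c p@_m).
Qed.

HB.instance Definition _ := GRing.isLinear.Build K (polyring K V)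
  (polyring K V) *:%R pderiv pderiv_is_linear.

Lemma pderivU (m : {cmonom V}) : pderiv << m >> = mon_deriv m.
Proof.
rewrite (@pderivEw [fset m]%fset) ?msuppU_le // big_seq_fset1 mcoeffUU.
exact: scale1r.
Qed.

Lemma mon_derivM (m1 m2 : {cmonom V}) : mon_deriv (mmul m1 m2) =
  mon_deriv m1 * << m2 >> + << m1 >> * mon_deriv m2.
Proof.
by apply: (monomial_leibniz v (f := fun m => << m >>)) => m m'; rewrite malgU1M.
Qed.

Lemma mon_pderivM (m1 m2 : {cmonom V}) :
  pderiv (<< m1 >> * << m2 >>) =
  pderiv << m1 >> * << m2 >> + << m1 >> * pderiv << m2 >>.
Proof.
apply: etrans (congr1 pderiv (malgU1M _ m1 m2)) _.
apply: etrans (pderivU _) _; apply: etrans (mon_derivM m1 m2) _.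
have e1 := pderivU m1; have e2 := pderivU m2.
move: (<< m1 >> : polyring K V) (<< m2 >> : polyring K V) (mon_deriv m1) (mon_deriv m2) e1 e2.
by move=> x y dx dy -> ->.
Qed.

Lemma pderivM p q : pderiv (p * q) = pderiv p * q + p * pderiv q.
Proof.
elim/polyring_lin_ind: p => [|m|c p p' IH IH'].
- by rewrite mul0r !raddf0 !mul0r add0r.
- elim/polyring_lin_ind: q => [|m'|c q q' IH IH'].
  + by rewrite mulr0 !raddf0 !mulr0 add0r.
  + exact: mon_pderivM.
  + exact: (@leibniz_linr K (polyring K V) pderiv c _ q q' IH IH').
- exact: (@leibniz_linl K (polyring K V) pderiv c p p' q IH IH').
Qed.

Lemma pderivC (c : K) : pderiv c%:A = 0.
Proof. by rewrite linearZ /= pderivU cm1 scale0r scaler0. Qed.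

Lemma pderiv_var w : pderiv (var K w) = (w == v)%:R.
Proof.
rewrite /var pderivU ucmE; case: eqP => [->|_]; last first.
  by rewrite scale0r.
rewrite scale1r; suff -> : divcm (ucm v) (ucm v) = mone by [].
by apply/eqP/cmP => i; rewrite divcmE subnn cm1.
Qed.

End Derivation.

Section CommutingDerivations.
Variables (K : fieldType) (A : comAlgType K) (D D' : {linear A -> A}).

Lemma additive_commD p q : D (D' p) = D' (D p) -> D (D' q) = D' (D q) ->
  D (D' (p + q)) = D' (D (p + q)).
Proof. by move=> hp hq; rewrite !raddfD /= hp hq. Qed.

Hypothesis DM : forall p q, D (p * q) = D p * q + p * D q.
Hypothesis D'M : forall p q, D' (p * q) = D' p * q + p * D' q.

Lemma derivations_commM p q : D (D' p) = D' (D p) -> D (D' q) = D' (D q) ->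
  D (D' (p * q)) = D' (D (p * q)).
Proof.
move=> hp hq; rewrite D'M DM !raddfD /= !DM !D'M hp hq; ring.
Qed.

End CommutingDerivations.

(** Both composites vanish on constants and variables, and the elements on which two derivations
    commute are closed under sums and products. *)
Lemma pderiv_comm (K : fieldType) (V : choiceType) (v w : V)
    (p : polyring K V) : pderiv v (pderiv w p) = pderiv w (pderiv v p).
Proof.
have cst x y c : pderiv x (pderiv y c%:A) = 0 :> polyring K V.
  by apply: etrans (congr1 (pderiv x) (pderivC y c)) _; apply: raddf0.
have pvar x y u : pderiv x (pderiv y (var K u)) = 0 :> polyring K V.
  apply: etrans (congr1 (pderiv x) (pderiv_var K y u)) _.
  apply: etrans (congr1 (pderiv x) (esym (@scaler_nat K (polyring K V) (u == y) 1))) _.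
  exact: pderivC.
elim/polyring_ind: p => [c|u|p q IHp IHq|p q IHp IHq].
- exact: etrans (cst _ _ _) (esym (cst _ _ _)).
- exact: etrans (pvar _ _ _) (esym (pvar _ _ _)).
- exact: (@additive_commD K (polyring K V) (pderiv v) (pderiv w) p q IHp IHq).
- exact: (@derivations_commM K (polyring K V) (pderiv v) (pderiv w)
    (pderivM v) (pderivM w) p q IHp IHq).
Qed.

(** * Evaluation at points *)

Section Evaluation.
Variables (K : fieldType) (V : choiceType).
Implicit Types (p q : polyring K V) (t : V -> K).

Definition peval t p : K := subst (t : V -> K^o) p.

Lemma peval_is_additive t : additive (peval t).
Proof. by move=> p q; rewrite /peval raddfB. Qed.

Lemma peval_is_multiplicative t : multiplicative (peval t).
Proof. by split=> [p q|]; rewrite /peval ?rmorphM ?rmorph1. Qed.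

HB.instance Definition _ t := GRing.isAdditive.Build (polyring K V) K (peval t)
  (peval_is_additive t).
HB.instance Definition _ t := GRing.isMultiplicative.Build (polyring K V) K
  (peval t) (peval_is_multiplicative t).

Lemma pevalZ t c p : peval t (c *: p) = c * peval t p.
Proof. by rewrite /peval linearZ. Qed.

Lemma peval_var t v : peval t (var K v) = t v.
Proof. by rewrite /peval subst_var. Qed.

Lemma pevalC t c : peval t c%:A = c.
Proof. by rewrite pevalZ rmorph1 mulr1. Qed.

Lemma peval_ext t t' : t =1 t' -> peval t =1 peval t'.
Proof. by move=> e p; apply: (@subst_ext K V K^o t t' e p). Qed.

Lemma horner_subst (x : V -> {poly K}) p e :
  (subst x p).[e] = peval (fun v => (x v).[e]) p.
Proof.
elim/polyring_ind: p => [c|v|p q IHp IHq|p q IHp IHq].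
- by rewrite substC pevalC hornerZ hornerC mulr1.
- by rewrite subst_var peval_var.
- by rewrite !rmorphD hornerD IHp IHq.
- by rewrite !rmorphM hornerM IHp IHq.
Qed.

Lemma peval_dep p : exists d : {fset V},
  forall t t', {in d, t =1 t'} -> peval t p = peval t' p.
Proof.
elim/polyring_ind: p => [c|v|p q [d IHp] [d' IHq]|p q [d IHp] [d' IHq]].
- by exists fset0 => t t' _; rewrite !pevalC.
- by exists [fset v]%fset => t t' h; rewrite !peval_var h // inE.
- exists (d `|` d')%fset => t t' h; rewrite !rmorphD.
  by congr (_ + _); [apply: IHp|apply: IHq] => v vd; apply: h; rewrite inE vd ?orbT.
- exists (d `|` d')%fset => t t' h; rewrite !rmorphM.
  by congr (_ * _); [apply: IHp|apply: IHq] => v vd; apply: h; rewrite inE vd ?orbT.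
Qed.

(** [C] depends on [p] and on the degree bounds [C0] only, not on the polynomials substituted: the
    residues below need one truncation valid at all points. *)
Lemma size_subst_bound p (C0 : V -> nat) : exists C : nat,
  forall x : V -> {poly K}, (forall v, (size (x v) <= (C0 v).+1)%N) ->
  (size (subst x p) <= C.+1)%N.
Proof.
elim/polyring_ind: p => [c|v|p q [C IHp] [C' IHq]|p q [C IHp] [C' IHq]].
- exists 0%N => x _; rewrite substC; apply: leq_trans (size_scale_leq _ _) _.
  by rewrite size_poly1.
- by exists (C0 v) => x h; rewrite subst_var.
- exists (maxn C C') => x h; rewrite rmorphD.
  apply: leq_trans (size_polyD _ _) _; rewrite geq_max.
  rewrite (leq_trans (IHp x h)) ?(leq_trans (IHq x h)) //.
    by rewrite ltnS leq_maxr.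
  by rewrite ltnS leq_maxl.
- exists (C + C')%N => x h; rewrite rmorphM.
  apply: leq_trans (size_polyMleq _ _) _.
  rewrite -addnS -subn1 leq_subLR add1n -addSn.
  exact: leq_add (IHp x h) (IHq x h).
Qed.

End Evaluation.

Lemma polyring_morph_ext (K : fieldType) (V : choiceType) (A : pzRingType)
    (F G : {rmorphism polyring K V -> A}) :
  (forall c, F c%:A = G c%:A) -> (forall v, F (var K v) = G (var K v)) ->
  F =1 G.
Proof.
move=> FC Fv p; elim/polyring_ind: p => [//|//|p q IHp IHq|p q IHp IHq].
- by rewrite (rmorphD F) (rmorphD G) IHp IHq.
- by rewrite (rmorphM F) (rmorphM G) IHp IHq.
Qed.

Lemma peval_subst (K : fieldType) (V W : choiceType) (x : V -> polyring K W)
    (t : W -> K) (p : polyring K V) :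
  peval t (subst x p) = peval (fun v => peval t (x v)) p.
Proof.
apply: (polyring_morph_ext (F := peval t \o subst x)) => [c|v] /=.
  by rewrite substC (pevalC t) pevalC.
by rewrite subst_var peval_var.
Qed.

Lemma base_expansion_inj (B n : nat) (f g : 'I_n -> nat) :
  (forall i, f i < B)%N -> (forall i, g i < B)%N ->
  (\sum_(i < n) f i * B ^ i = \sum_(i < n) g i * B ^ i)%N -> f =1 g.
Proof.
elim: n f g => [|n IH] f g fB gB; first by move=> _ [].
rewrite !big_ord_recl /= expn0 !muln1.
have shift (h : 'I_n.+1 -> nat) : (\sum_(i < n) h (lift ord0 i) * B ^ bump 0 i =
    (\sum_(i < n) h (lift ord0 i) * B ^ i) * B)%N.
  by rewrite big_distrl /=; apply: eq_bigr => i _; rewrite /bump expnS; lia.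
rewrite !shift => e.
have e0 : f ord0 = g ord0.
  have := congr1 (modn^~ B) e; rewrite !(addnC (_ ord0)) !modnMDl !modn_small //.
move: e; rewrite e0 => /eqP; rewrite eqn_add2l eqn_pmul2r; last first.
  exact: leq_ltn_trans (fB ord0).
move=> /eqP e i; case: (unliftP ord0 i) => [j ->|-> //].
exact: (IH (fun j => f (lift ord0 j)) (fun j => g (lift ord0 j))).
Qed.

(** Kronecker substitution: x_v becomes ['X^(B ^ i)], with [B] above every exponent and i the rank
    of v. Distinct monomials of [p] go to distinct powers of ['X], and the resulting univariate
    polynomial has every natural number as a root. *)
Lemma peval_eq0 (K : numFieldType) (V : choiceType) (p : polyring K V) :
  (forall t, peval t p = 0) -> p = 0.
Proof.
move=> p0; apply/eqP; rewrite -msupp_eq0; apply/eqP/fsetP => m0.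
rewrite in_fset0; apply/negP => m0p.
pose d : {fset V} := (\bigcup_(m <- msupp p) finsupp m)%fset.
have md m : m \in msupp p -> (finsupp m `<=` d)%fset.
  by move=> mp; apply: bigfcup_sup.
pose B := (\max_(m <- msupp p) \max_(v <- d) m v).+1.
have mB m v : m \in msupp p -> (m v < B)%N.
  move=> mp; rewrite ltnS; case: (boolP (v \in d)) => vd; last first.
    have : v \notin finsupp m by apply: contra vd; apply/fsubsetP/md.
    by rewrite -cmE_eq0 => /eqP ->.
  apply: leq_trans (@leq_bigmax_seq _ _ xpredT
    (fun m : {cmonom V} => \max_(v <- d) m v)%N m mp isT).
  exact: (@leq_bigmax_seq _ _ xpredT (fun v => m v) v vd isT).
pose code (m : {cmonom V}) := (\sum_(v <- d) m v * B ^ index v d)%N.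
pose x (v : V) : {poly K} := 'X^(B ^ index v d).
have mon_x m : m \in msupp p -> mon_subst x m = 'X^(code m).
  move=> mp; rewrite (mon_substE _ (md _ mp)) /code.
  rewrite (big_morph (fun k => 'X^k) (@exprD {poly K} 'X) (expr0 'X)).
  by apply: eq_bigr => v _; rewrite /x -exprM mulnC.
have code_inj : {in msupp p &, injective code}.
  move=> m m' mp m'p e; apply/eqP/cmP => v.
  case: (boolP (v \in d)) => vd; last first.
    have h m1 : m1 \in msupp p -> m1 v = 0%N.
      move=> m1p; have : v \notin finsupp m1 by apply: contra vd; apply/fsubsetP/md.
      by rewrite -cmE_eq0 => /eqP ->.
    by rewrite !h.
  have codeE m1 : code m1 = (\sum_(i < size d) m1 (nth v d i) * B ^ i)%N.
    rewrite /code (big_nth v) big_mkord; apply: eq_bigr => i _.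
    by rewrite index_uniq ?fset_uniq.
  have vi : (index v d < size d)%N by rewrite index_mem.
  rewrite !codeE in e; have := base_expansion_inj _ _ e => /(_ _ _ (Ordinal vi)).
  rewrite /= nth_index //; apply=> i; exact: mB.
have q0 : subst x p = 0.
  apply/polyP => i; rewrite coef0.
  apply/eqP; apply: contraT => ci.
  pose q := subst x p; have qn0 : q != 0 by apply: contra ci => /eqP q0; rewrite -/q q0 coef0.
  have := max_poly_roots (rs := [seq j%:R | j <- iota 0 (size q)]) qn0.
  rewrite map_inj_uniq ?iota_uniq; last exact: (@mulrIn K 1 (oner_neq0 _)).
  rewrite size_map size_iota ltnn; apply=> //.
  by apply/allP => _ /mapP[j _ ->]; rewrite rootE /q horner_subst p0.
have : (subst x p)`_(code m0) = p@_m0.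
  have -> : subst x p = \sum_(m <- msupp p) p@_m *: mon_subst x m by [].
  rewrite coef_sum (big_fsetD1 m0) // coefZ mon_x // coefXn eqxx mulr1.
  rewrite big1_seq; first exact: addr0.
  move=> m /andP[_].
  rewrite in_fsetD1 => /andP[mm0 mp]; rewrite coefZ mon_x // coefXn.
  case: eqP => [e|_]; last by rewrite mulr0.
  by move: mm0; rewrite (code_inj _ _ m0p mp e) eqxx.
rewrite q0 coef0 => /esym/eqP; rewrite mcoeff_eq0; exact/negP/negPn.
Qed.

(** * Exponentials of power series of operators *)

Lemma exchange_triangle (A : nmodType) (l : nat) (G : nat -> nat -> A) :
  \sum_(1 <= i < l.+1) \sum_(1 <= j < (l - i).+1) G i j =
  \sum_(1 <= j < l.+1) \sum_(1 <= i < (l - j).+1) G i j.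
Proof.
have widen (F : nat -> nat -> A) :
    \sum_(1 <= i < l.+1) \sum_(1 <= j < (l - i).+1) F i j =
    \sum_(1 <= i < l.+1) \sum_(1 <= j < l.+1 | (i + j <= l)%N) F i j.
  rewrite big_nat_cond [RHS]big_nat_cond; apply: eq_bigr => i /andP[/andP[i1 il] _].
  rewrite (big_nat_widen _ _ l.+1) ?ltnS ?leq_subr //.
  by apply: eq_bigl => j; rewrite /= ltnS; lia.
rewrite widen (widen (fun j i => G i j)).
rewrite (exchange_big_dep_nat xpredT) //=.
by apply: eq_bigr => j _; apply: eq_bigl => i; rewrite /= addnC.
Qed.

Section ExpRecursion.
Variables (K : numFieldType) (A : lmodType K) (L : nat -> A -> A).
Hypothesis L_linear : forall i, linear (L i).
Hypothesis L_comm : forall i j x, L i (L j x) = L j (L i x).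

Lemma L_D i x y : L i (x + y) = L i x + L i y.
Proof. by have := L_linear i 1 x y; rewrite !scale1r. Qed.

Lemma L_0 i : L i 0 = 0.
Proof. by apply: (addIr (L i 0)); rewrite -L_D !add0r. Qed.

Lemma L_Z i c x : L i (c *: x) = c *: L i x.
Proof. by have := L_linear i c x 0; rewrite L_0 !addr0. Qed.

Lemma L_sum (I : Type) i (r : seq I) (P : pred I) F :
  L i (\sum_(j <- r | P j) F j) = \sum_(j <- r | P j) L i (F j).
Proof. by apply: (big_morph _ (L_D i) (L_0 i)). Qed.

(** [eulz] is z d/dz, and [mulz'] is multiplication by z L'(z), where L(z) = \sum_i L_i z^i. *)
Let eulz (f : nat -> A) : nat -> A := fun l => l%:R *: f l.
Let mulz' := mulz (fun i x => i%:R *: L i x).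

Lemma mulz_comm f l : mulz L (mulz' f) l = mulz' (mulz L f) l.
Proof.
rewrite /mulz' /mulz.
under eq_bigr => i _ do rewrite L_sum.
rewrite exchange_triangle; apply: eq_bigr => j _.
rewrite L_sum scaler_sumr; apply: eq_bigr => i _.
by rewrite L_Z L_comm -!subnDA addnC.
Qed.

Lemma eulz_mulz f l : eulz (mulz L f) l = mulz' f l + mulz L (eulz f) l.
Proof.
rewrite /eulz /mulz' /mulz scaler_sumr -big_split /= !big_nat.
apply: eq_bigr => i /andP[_ il].
by rewrite L_Z -scalerDl -natrD subnKC // -ltnS.
Qed.

Lemma eq_mulz (L' : nat -> A -> A) f g l :
  (forall i, (i < l)%N -> f i = g i) -> mulz L' f l = mulz L' g l.
Proof.
move=> fg; rewrite /mulz !big_nat; apply: eq_bigr => i /andP[i1 il].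
by rewrite fg //; lia.
Qed.

Lemma mulz_scale c f l : mulz L (fun i => c *: f i) l = c *: mulz L f l.
Proof. by rewrite /mulz scaler_sumr; apply: eq_bigr => i _; rewrite L_Z. Qed.

Lemma eulz_iter x k l :
  eulz (iter k.+1 (mulz L) (constz x)) l =
  k.+1%:R *: mulz' (iter k (mulz L) (constz x)) l.
Proof.
elim: k l => [|k IH] l; rewrite iterS eulz_mulz.
  rewrite scale1r [X in _ + X]big1_seq ?addr0 // => i _.
  by rewrite /eulz /constz /=; case: (l - i)%N => [|j]; rewrite ?scale0r ?scaler0 L_0.
rewrite (eq_mulz _ (fun i _ => IH i)) mulz_scale mulz_comm -iterS.
by rewrite -[X in X + _]scale1r -scalerDl -[1 + _]mulrS.
Qed.

Lemma iter_mulz_eq0 x k l : (l < k)%N -> iter k (mulz L) (constz x) l = 0.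
Proof.
elim: k l => // k IH l lk; rewrite iterS /mulz big_nat big1 // => i /andP[i1 il].
by rewrite IH ?L_0 //; lia.
Qed.

(** The differential equation z F' = (z L') F of F = exp(L) x. In characteristic 0 it determines F
    from F(0), and it replaces the factorial formula from here on. *)
Lemma expz_rec x l : l%:R *: expz L (constz x) l =
  \sum_(1 <= i < l.+1) i%:R *: L i (expz L (constz x) (l - i)).
Proof.
have expzE m N : (m <= N)%N -> expz L (constz x) m =
    \sum_(k < N.+1) (k`!%:R^-1 : K) *: iter k (mulz L) (constz x) m.
  move=> mN; rewrite /expz (big_ord_widen N.+1
    (fun k => (k`!%:R^-1 : K) *: iter k (mulz L) (constz x) m)) ?ltnS //.
  rewrite [RHS](bigID (fun k : 'I_N.+1 => (k < m.+1)%N)) /=.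
  rewrite [X in _ = _ + X]big1 ?addr0 // => k; rewrite -ltnNge => mk.
  by rewrite iter_mulz_eq0 ?scaler0.
case: l => [|l].
  by rewrite scale0r big_geq.
rewrite (expzE _ l.+1) // big_ord_recl /= [constz x l.+1]/= scaler0 add0r.
transitivity (\sum_(k < l.+1) (k`!%:R^-1 : K) *:
    mulz' (iter k (mulz L) (constz x)) l.+1).
  rewrite scaler_sumr; apply: eq_bigr => k _.
  rewrite scalerA mulrC -scalerA.
  have := eulz_iter x k l.+1; rewrite /eulz => ->.
  rewrite scalerA; congr (_ *: _).
  rewrite /bump leq0n add1n factS natrM invfM mulrAC mulVf ?mul1r //.
  by rewrite pnatr_eq0.
transitivity (\sum_(k < l.+1) \sum_(1 <= i < l.+2) (k`!%:R^-1 : K) *: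
    (i%:R *: L i (iter k (mulz L) (constz x) (l.+1 - i)%N))).
  by apply: eq_bigr => k _; rewrite -scaler_sumr.
rewrite exchange_big /= !big_nat; apply: eq_bigr => i /andP[i1 il].
rewrite (expzE _ l); last by lia.
rewrite L_sum scaler_sumr; apply: eq_bigr => k _.
by rewrite L_Z !scalerA mulrC.
Qed.

Lemma expz0 x : expz L (constz x) 0 = x.
Proof. by rewrite /expz big_ord_recl big_ord0 /= fact0 invr1 scale1r addr0. Qed.

Lemma L_expz j x l : L j (expz L (constz x) l) = expz L (constz (L j x)) l.
Proof.
elim/ltn_ind: l => -[|l] IH; first by rewrite !expz0.
apply: (@scalerI K A l.+1%:R); first by rewrite pnatr_eq0.
rewrite -L_Z expz_rec L_sum expz_rec !big_nat.
apply: eq_bigr => i /andP[i1 il].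
by rewrite L_Z L_comm IH //; lia.
Qed.

End ExpRecursion.

(** * Elementary Schur functions *)

Section SchurRecursion.
Variables (K : numFieldType) (A : comAlgType K).
Implicit Types (u : nat -> A).

Lemma mul_linear (u : nat -> A) i : linear (fun x => u i * x).
Proof. by move=> c x y; rewrite mulrDr scalerAr. Qed.

Lemma schur0 u : schur 0 u = 1.
Proof. exact: expz0. Qed.

Lemma schur_rec u l : l%:R *: schur l u =
  \sum_(1 <= i < l.+1) i%:R *: (u i * schur (l - i) u).
Proof.
by apply: (expz_rec (mul_linear u)) => i j x; rewrite mulrCA.
Qed.

Lemma schur_uniq u (g : nat -> A) : g 0%N = 1 ->
  (forall l, l.+1%:R *: g l.+1 =
     \sum_(1 <= i < l.+2) i%:R *: (u i * g (l.+1 - i)%N)) ->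
  forall l, g l = schur l u.
Proof.
move=> g0 gS l; elim/ltn_ind: l => -[|l] IH; first by rewrite g0 schur0.
apply: (@scalerI _ _ l.+1%:R); first by rewrite pnatr_eq0.
rewrite gS schur_rec !big_nat; apply: eq_bigr => i /andP[i1 il].
by rewrite IH //; lia.
Qed.

Lemma eq_schur u u' l : (forall i, (0 < i <= l)%N -> u i = u' i) ->
  schur l u = schur l u'.
Proof.
elim/ltn_ind: l => -[|l] IH h; first by rewrite !schur0.
apply: (@scalerI _ _ l.+1%:R); first by rewrite pnatr_eq0.
rewrite !schur_rec !big_nat; apply: eq_bigr => i /andP[i1 il].
rewrite h; last by lia.
by rewrite (IH (l.+1 - i)%N) // => [|j /andP[j0 jl]]; [lia|apply: h; lia].
Qed.

End SchurRecursion.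

(** * Values of Schur polynomials, and residues of polynomials against exponentials *)

Section SchurScalar.
Variables (K : numFieldType).
Implicit Types (u : nat -> K) (x : K) (Q : {poly K}).

Definition hS u (l : nat) : K := @schur K K^o l u.

Lemma hS0 u : hS u 0 = 1. Proof. exact: (@schur0 K K^o). Qed.

Lemma hS_rec u l : l%:R * hS u l =
  \sum_(1 <= i < l.+1) i%:R * (u i * hS u (l - i)).
Proof. exact: (@schur_rec K K^o). Qed.

Lemma hS_uniq u (g : nat -> K) : g 0%N = 1 ->
  (forall l, l.+1%:R * g l.+1 =
     \sum_(1 <= i < l.+2) i%:R * (u i * g (l.+1 - i)%N)) ->
  forall l, g l = hS u l.
Proof. exact: (@schur_uniq K K^o). Qed.

Lemma eq_hS u u' l : (forall i, (0 < i <= l)%N -> u i = u' i) ->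
  hS u l = hS u' l.
Proof. exact: (@eq_schur K K^o). Qed.

Lemma hS_inj u u' l : (forall i, (i <= l)%N -> hS u i = hS u' i) ->
  forall i, (0 < i <= l)%N -> u i = u' i.
Proof.
move=> h i; elim/ltn_ind: i => i IH /andP[i0 il].
have ni : (i%:R : K) != 0 by rewrite pnatr_eq0 -lt0n.
have := hS_rec u i; have := hS_rec u' i; rewrite h //.
rewrite !big_nat_recr //= !subnn !hS0 !mulr1 => ->.
have -> : \sum_(1 <= i0 < i) i0%:R * (u i0 * hS u (i - i0)) =
          \sum_(1 <= i0 < i) i0%:R * (u' i0 * hS u' (i - i0)).
  rewrite !big_nat; apply: eq_bigr => j /andP[j1 ji].
  by rewrite IH // ?h //; lia.
by move/addrI/(mulfI ni).
Qed.

Definition conv (f g : nat -> K) l := \sum_(0 <= i < l.+1) f i * g (l - i)%N.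

Lemma conv_comm f g l : conv f g l = conv g f l.
Proof.
rewrite /conv big_nat_rev /= !big_nat; apply: eq_bigr => i /andP[_ il].
by rewrite add0n subSS subKn 1?mulrC.
Qed.

(** With U the series of [u], the hypothesis is z f' = (z U') f and the conclusion (z f') g = (z U')
    (f g). Used for both factors, it yields in [hSD] the equation characterising the exponential of
    a sum. *)
Lemma conv_weight u f g l :
  (forall i, i%:R * f i = \sum_(1 <= a < i.+1) a%:R * (u a * f (i - a)%N)) ->
  \sum_(0 <= i < l.+1) i%:R * (f i * g (l - i)%N) =
  \sum_(1 <= a < l.+1) a%:R * (u a * conv f g (l - a)).
Proof.
move=> hf.
transitivity (\sum_(0 <= i < l.+1) \sum_(1 <= a < l.+1 | (a <= i)%N)
    a%:R * (u a * (f (i - a)%N * g (l - i)%N))).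
  rewrite !big_nat; apply: eq_bigr => i /andP[_ il].
  rewrite mulrA hf mulr_suml (big_nat_widen 1 i.+1 l.+1) //.
  by apply: eq_bigr => a _; rewrite -!mulrA.
rewrite (exchange_big_dep_nat xpredT) //= !big_nat; apply: eq_bigr => a /andP[a1 al].
rewrite /conv !mulr_sumr.
rewrite (big_cat_nat (n := a)) //=; last by lia.
rewrite big_nat_cond big1 ?add0r => [|i]; last by lia.
rewrite -{1}[a]add0n (_ : l.+1 = ((l - a).+1 + a)%N); last by lia.
rewrite big_addn addnK big_nat_cond [RHS]big_nat_cond.
apply: eq_big => i; first by rewrite /= leq_addl.
by move=> _; rewrite addnK; congr (_ * (_ * (_ * g _))); lia.
Qed.

Lemma hSD u u' l : hS (fun i => u i + u' i) l = conv (hS u) (hS u') l.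
Proof.
symmetry; move: l; apply: hS_uniq => [|l].
  by rewrite /conv big_nat1 !hS0 mulr1.
rewrite {1}/conv mulr_sumr.
transitivity (\sum_(0 <= i < l.+2) i%:R * (hS u i * hS u' (l.+1 - i)%N) +
   \sum_(0 <= i < l.+2) i%:R * (hS u' i * hS u (l.+1 - i)%N)).
  rewrite [X in _ + X]big_nat_rev /= -big_split /= !big_nat; apply: eq_bigr => i /andP[_ il].
  rewrite add0n subSS subKn //= [hS u' _ * _]mulrC -mulrDl -natrD subnKC //.
rewrite (conv_weight _ _ (hS_rec u)) (conv_weight _ _ (hS_rec u')) -big_split /=.
apply: eq_bigr => i _.
by rewrite (conv_comm (hS u')) -mulrDr -mulrDl.
Qed.

(* exp(\sum_i (pt x)_i z^i) = 1 / (1 - x z). *)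
Definition pt x : nat -> K := fun i => x ^+ i / i%:R.

Lemma hS_pt x l : hS (pt x) l = x ^+ l.
Proof.
symmetry; move: l; apply: hS_uniq => [|l]; first by rewrite expr0.
rewrite big_nat (eq_bigr (fun=> x ^+ l.+1)) => [|i /andP[i1 il]].
  by rewrite -big_nat big_const_nat iter_addr_0 subn1 mulr_natl.
rewrite /pt mulrA [_ * (_ / _)]mulrCA divff ?mulr1; last by rewrite pnatr_eq0; lia.
by rewrite -exprD subnKC.
Qed.

Lemma hS_ptN x l : hS (fun i => - pt x i) l.+1 = if l == 0%N then - x else 0.
Proof.
pose g l := if l is l.+1 then if l == 0%N then - x else 0 else 1 : K.
rewrite -(@hS_uniq _ g) // => -[|k]; rewrite /g.
  by rewrite big_nat1 subnn /pt expr1 divr1 mulr1.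
rewrite mulr0 big_nat_recr //= subnn big_nat_recr //= subSnn /=.
rewrite big_nat big1 ?add0r => [|i /andP[i1 ik]]; last first.
  by have -> : (k.+2 - i = (k - i).+2)%N by [lia|]; rewrite !mulr0.
have h m : m.+1%:R * pt x m.+1 = x ^+ m.+1 by rewrite mulrC divfK ?pnatr_eq0.
rewrite mulr1 mulrNN mulrN mulrA !h -exprSr addrN //.
Qed.

(** The extension by 0 to negative degrees lets index shifts hold without side conditions. *)
Definition Sint u (z : int) : K := if z is Posz l then hS u l else 0.

Lemma Sint_sub u x z :
  Sint (fun i => u i - pt x i) z = Sint u z - x * Sint u (z - 1).
Proof.
case: z => [l|l]; last first.
  have -> : Negz l - 1 = Negz l.+1 by lia.
  by rewrite /= mulr0 subr0.
case: l => [|l].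
  by have -> : Posz 0 - 1 = Negz 0 by []; rewrite /= !hS0 mulr0 subr0.
have -> : Posz l.+1 - 1 = Posz l by lia.
rewrite /= (hSD u (fun i => - pt x i)) conv_comm /conv.
rewrite !big_nat_recl // !hS0 mul1r subn0 hS_ptN eqxx subSS subn0.
rewrite [X in _ + (_ + X)]big1; first by rewrite addr0 mulNr.
by move=> i _; rewrite hS_ptN mul0r.
Qed.

Lemma Sint0 z : Sint (fun=> 0) z = (z == 0)%:R.
Proof.
case: z => [[|l]|//]; first by rewrite /= hS0.
rewrite /= -[RHS]/0; have := @hS_uniq (fun=> 0) (fun l => (l == 0%N)%:R).
move=> <- // k; rewrite mulr0 big1 // => i _; by rewrite mul0r mulr0.
Qed.

(* The coefficient of z^e in Q(z) exp(\sum_i u_i z^(-i)). *)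
Definition Lf u (e : int) Q : K := \sum_(l < size Q) Q`_l * Sint u (l%:Z - e).

Lemma LfE N u e Q : (size Q <= N)%N ->
  Lf u e Q = \sum_(l < N) Q`_l * Sint u (l%:Z - e).
Proof.
move=> QN; rewrite /Lf (big_ord_widen N (fun l => Q`_l * Sint u (l%:Z - e))) //.
rewrite [RHS](bigID (fun l : 'I_N => (l < size Q)%N)) /=.
rewrite [X in _ = _ + X]big1 ?addr0 // => l; rewrite -leqNgt => Ql.
by rewrite nth_default ?mul0r.
Qed.

Lemma LfP u e c p q : Lf u e (c *: p + q) = c * Lf u e p + Lf u e q.
Proof.
pose N := maxn (size (c *: p + q)) (maxn (size p) (size q)).
rewrite !(@LfE N) /N ?leq_max ?leqnn ?orbT // mulr_sumr -big_split /=.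
by apply: eq_bigr => l _; rewrite coefD coefZ mulrDl mulrA.
Qed.

Lemma Lfr0 u e : Lf u e 0 = 0.
Proof. by rewrite /Lf size_poly0 big_ord0. Qed.

Lemma LfZ u e c Q : Lf u e (c *: Q) = c * Lf u e Q.
Proof. by rewrite -[c *: Q]addr0 LfP Lfr0 addr0. Qed.

Lemma LfD u e p q : Lf u e (p + q) = Lf u e p + Lf u e q.
Proof. by rewrite -[p in LHS]scale1r LfP mul1r. Qed.

Lemma LfB u e p q : Lf u e (p - q) = Lf u e p - Lf u e q.
Proof. by rewrite addrC -scaleN1r LfP mulN1r addrC. Qed.

Lemma Lf_sum u e (I : Type) (r : seq I) (P : pred I) F :
  Lf u e (\sum_(i <- r | P i) F i) = \sum_(i <- r | P i) Lf u e (F i).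
Proof. by apply: (big_morph _ (LfD u e) (Lfr0 u e)). Qed.

Lemma LfXM u e Q : Lf u e ('X * Q) = Lf u (e - 1) Q.
Proof.
rewrite (@LfE (size Q).+1) ?(leq_trans (size_polyMleq _ _)) ?size_polyX //.
rewrite big_ord_recl coefXM eqxx mul0r add0r; apply: eq_bigr => l _.
by rewrite coefXM /= add0n; congr (_ * Sint u _); rewrite /bump /=; lia.
Qed.

Lemma LfXnM u e k Q : Lf u e ('X^k * Q) = Lf u (e - k%:Z) Q.
Proof.
elim: k e => [|k IH] e; first by rewrite expr0 mul1r subr0.
by rewrite exprS -mulrA LfXM IH; congr (Lf u _ _); lia.
Qed.

(** Subtracting the times of x multiplies the exponential, a series in 1/z, by 1 - x/z = z^(-1) (z -
    x). *)
Lemma Lf_sub u x e Q :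
  Lf (fun i => u i - pt x i) e Q = Lf u (e + 1) (('X - x%:P) * Q).
Proof.
rewrite mulrBl LfB LfXM mul_polyC LfZ addrK /Lf mulr_sumr -sumrB.
apply: eq_bigr => l _; rewrite Sint_sub mulrBr mulrCA.
by congr (_ - x * (_ * Sint u _)); lia.
Qed.

Lemma eq_Lf u u' e Q : u =1 u' -> Lf u e Q = Lf u' e Q.
Proof.
move=> h; apply: eq_bigr => l _; congr (_ * _).
by case: (_ - e) => //= k; apply: eq_hS.
Qed.

Lemma Lf_sub_seq u xs e Q :
  Lf (fun i => u i - \sum_(x <- xs) pt x i) e Q =
  Lf u (e + (size xs)%:Z) (\prod_(x <- xs) ('X - x%:P) * Q).
Proof.
elim: xs e Q => [|x xs IH] e Q.
  by rewrite big_nil mul1r addr0; apply: eq_Lf => i; rewrite big_nil subr0.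
transitivity (Lf (fun i => u i - \sum_(y <- xs) pt y i - pt x i) e Q).
  by apply: eq_Lf => i; rewrite big_cons [pt x i + _]addrC opprD addrA.
rewrite (Lf_sub (fun i => u i - \sum_(y <- xs) pt y i)) IH big_cons.
by rewrite [_ * \prod_(_ <- _) _]mulrC -mulrA; congr (Lf u _ _); rewrite /=; lia.
Qed.

Lemma Lf0 e Q : Lf (fun=> 0) e Q = if e is Posz j then Q`_j else 0.
Proof.
rewrite /Lf; case: e => [j|j]; last first.
  by rewrite big1 // => l _; rewrite Sint0; case: eqP => [|_]; [lia|rewrite mulr0].
case: (ltnP j (size Q)) => [jQ|Qj]; last first.
  rewrite nth_default // big1 // => l _; rewrite Sint0 subr_eq0.
  case: eqP => [/= [e]|_]; last by rewrite mulr0.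
  by have := ltn_ord l; rewrite e ltnNge Qj.
rewrite (bigD1 (Ordinal jQ)) //= Sint0 subrr eqxx mulr1 big1 ?addr0 // => l lj.
rewrite Sint0 subr_eq0; case: eqP => [[e]|_]; last by rewrite mulr0.
by case/eqP: lj; apply: val_inj.
Qed.

Lemma Lf_small u e Q : ((size Q)%:Z <= e)%R -> Lf u e Q = 0.
Proof.
move=> h; rewrite /Lf big1 // => l _; have := ltn_ord l => lQ.
have : (l%:Z - e < 0)%R by lia.
by case: (_ - e) => // k _; rewrite mulr0.
Qed.

Definition pts xs : nat -> K := fun i => \sum_(x <- xs) pt x i.

Lemma Lf_pts xs e Q : Lf (pts xs) (e + (size xs)%:Z)
  (\prod_(x <- xs) ('X - x%:P) * Q) = if e is Posz j then Q`_j else 0.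
Proof.
by rewrite -Lf0 -Lf_sub_seq; apply: eq_Lf => i; rewrite subrr.
Qed.

(** The left side is the coefficient of 1/z, at infinity, of Q(z) / \prod_(x <- xs) (z - x), so this
    is the residue theorem. By Lagrange interpolation [Q] is a combination of the polynomials [l x],
    on each of which the functional is 1, plus a multiple [R] of the full product, whose quotient is
    a polynomial without 1/z term. *)
Lemma Lf_divided_difference xs Q : uniq xs ->
  Lf (pts xs) ((size xs)%:Z - 1) Q =
  \sum_(x <- xs) Q.[x] / \prod_(y <- xs | y != x) (x - y).
Proof.
move=> uxs; pose l x := \prod_(y <- xs | y != x) ('X - y%:P).
have lx x : (l x).[x] = \prod_(y <- xs | y != x) (x - y).
  by rewrite horner_prod; apply: eq_bigr => y _; rewrite hornerXsubC.
have lx0 x : (l x).[x] != 0.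
  rewrite lx; elim: xs {uxs l lx} => [|y xs IH]; first by rewrite big_nil oner_eq0.
  by rewrite big_cons; case: ifP => // yx; rewrite mulf_neq0 // subr_eq0 eq_sym.
have ly x y : y \in xs -> y != x -> (l x).[y] = 0.
  move=> yxs yx; rewrite /l horner_prod (big_rem y) //= yx.
  by rewrite hornerXsubC subrr mul0r.
have Ll x : x \in xs -> Lf (pts xs) ((size xs)%:Z - 1) (l x) = 1.
  move=> xxs; have px := perm_to_rem xxs.
  have -> : l x = \prod_(y <- rem x xs) ('X - y%:P) * 1.
    rewrite mulr1 /l (perm_big _ px) /= big_cons eqxx /=.
    rewrite big_seq_cond [RHS]big_seq; apply: eq_bigl => y.
    by rewrite mem_rem_uniq // !inE; case: (y != x); rewrite ?andbF ?andbT.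
  have -> : Lf (pts xs) ((size xs)%:Z - 1) (\prod_(y <- rem x xs) ('X - y%:P) * 1)
     = Lf (pt x) 0 1.
    have := Lf_sub_seq (pts xs) (rem x xs) 0 1.
    rewrite size_rem // => h; rewrite [X in Lf _ X](_ : _ = 0 + (size xs).-1%:Z).
      rewrite -h; apply: eq_Lf => i; rewrite /pts (perm_big _ px) /= big_cons.
      by rewrite addrK.
    have s0 : (0 < size xs)%N by rewrite -has_predT; apply/hasP; exists x.
    lia.
  by rewrite /Lf size_poly1 big_ord1 coef1 mul1r /= hS0.
pose R := Q - \sum_(x <- xs) (Q.[x] / (l x).[x]) *: l x.
have Rx x : x \in xs -> root R x.
  move=> xxs; rewrite rootE /R hornerD hornerN horner_sum (big_rem x) //=.
  rewrite hornerZ divfK // big_seq big1 ?addr0 ?subrr //= => y.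
  rewrite mem_rem_uniq // !inE => /andP[yx yxs].
  by rewrite hornerZ (ly y x) ?mulr0 // eq_sym.
have /dvdpP[q Rq] : \prod_(x <- xs) ('X - x%:P) %| R.
  apply: uniq_roots_dvdp; first exact/allP.
  by rewrite uniq_rootsE.
have LR : Lf (pts xs) ((size xs)%:Z - 1) R = 0.
  by rewrite Rq mulrC addrC -[- 1]/(Negz 0) Lf_pts.
have QE : Q = R + \sum_(x <- xs) (Q.[x] / (l x).[x]) *: l x by rewrite subrK.
rewrite {1}QE LfD LR add0r Lf_sum big_seq [RHS]big_seq; apply: eq_bigr => x xxs.
by rewrite LfZ Ll // mulr1 lx.
Qed.

End SchurScalar.

(** * The bilinear identity at points *)

Lemma peval_schur (K : numFieldType) (V : choiceType) (t : V -> K)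
    (u : nat -> polyring K V) l :
  peval t (schur l u) = hS (fun i => peval t (u i)) l.
Proof.
move: l; apply: hS_uniq => [|l]; first by rewrite schur0 rmorph1.
have := congr1 (peval t) (schur_rec u l.+1).
rewrite (pevalZ t) => ->; rewrite (rmorph_sum (peval t)) /=.
by apply: eq_bigr => i _; rewrite (pevalZ t) (rmorphM (peval t)).
Qed.

Lemma rmorph_leibniz (A B : pzRingType) (f : {rmorphism A -> B}) (d x y dx dy : A) :
  d = dx * y + x * dy -> f d = f dx * f y + f x * f dy.
Proof. by move=> ->; rewrite rmorphD !rmorphM. Qed.

(** * The exponential of a family of derivations is a substitution *)

Section Taylor.
Variables (K : numFieldType) (W : choiceType).
Local Notation B := (polyring K W).
Variables (L : nat -> B -> B) (e : W -> nat) (c : W -> K) (p : W -> K).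
Hypothesis L_linear : forall i, linear (L i).
Hypothesis L_comm : forall i j x, L i (L j x) = L j (L i x).
Hypothesis L_M : forall i x y, L i (x * y) = L i x * y + x * L i y.
Hypothesis L_var : forall i w, (0 < i)%N ->
  L i (var K w) = (if i == e w then c w else 0)%:A.
Hypothesis L_C : forall i a, L i a%:A = 0.
Hypothesis e0 : forall w, e w = 0%N -> c w = 0.

Let x w : {poly K} := (p w)%:P + c w *: 'X^(e w).

(** Chain rule for z d/dz along the curve p_w + c_w z^(e w): both sides obey the Leibniz rule along
    the substitution, so constants and variables suffice. *)
Lemma subst_euler (Q : B) : exists N0, forall N, (N0 <= N)%N ->
  'X * (subst x Q)^`() =
  \sum_(1 <= i < N) i%:R *: ('X^i * subst x (L i Q)).
Proof.
elim/polyring_ind: Q => [a|w|P Q [N1 IHP] [N2 IHQ]|P Q [N1 IHP] [N2 IHQ]].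
- exists 0%N => N _; rewrite substC derivZ derivC scaler0 mulr0.
  rewrite big1 // => i _; rewrite L_C.
  by rewrite (raddf0 (subst x)) mulr0 scaler0.
- exists (e w).+2 => N hN; rewrite subst_var /x derivD derivC add0r derivZ derivXn.
  case: (posnP (e w)) => [ew|ew].
    rewrite e0 // scale0r mulr0 big_nat big1 // => i /andP[i1 _].
    rewrite L_var // ew; case: eqP i1 => [->//|_ _].
    by rewrite scale0r (raddf0 (subst x)) mulr0 scaler0.
  rewrite (bigD1_seq (e w)) ?iota_uniq //=; last first.
    by rewrite mem_index_iota ew /= (leq_trans _ hN).
  rewrite L_var // eqxx substC big_nat_cond big1 => [|i]; last first.
    case/andP=> /andP[i1 _] iw; rewrite L_var // (negPf iw).
    by rewrite scale0r (raddf0 (subst x)) mulr0 scaler0.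
  rewrite addr0 -!scalerAr mulr1 mulrnAr -exprS prednK //.
  by rewrite -scaler_nat !scalerA mulrC.
- exists (maxn N1 N2) => N; rewrite geq_max => /andP[h1 h2].
  rewrite (rmorphD (subst x)) derivD mulrDr (IHP N h1) (IHQ N h2) -big_split /=.
  apply: eq_bigr => i _; rewrite (L_D L_linear).
  by rewrite (rmorphD (subst x)) mulrDr scalerDr.
- exists (maxn N1 N2) => N; rewrite geq_max => /andP[h1 h2].
  rewrite (rmorphM (subst x)) derivM mulrDr mulrA (IHP N h1) mulrCA (IHQ N h2).
  rewrite mulr_suml mulr_sumr -big_split /=; apply: eq_bigr => i _.
  have -> : subst x (L i (P * Q)) =
      subst x (L i P) * subst x Q + subst x P * subst x (L i Q).
    exact: (rmorph_leibniz (subst x) (L_M i P Q)).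
  move: (subst x P) (subst x Q) (subst x (L i P)) (subst x (L i Q)) => f g f' g'.
  rewrite mulrDr scalerDr; congr (_ + _); first by rewrite -scalerAl mulrA.
  by rewrite -scalerAr mulrCA.
Qed.

(** Both sides obey the recursion coming from z d/dz. The induction ranges over all [Q] because each
    [L i] is moved onto [Q]. *)
Lemma peval_expz Q l : peval p (expz L (constz Q) l) = (subst x Q)`_l.
Proof.
elim/ltn_ind: l Q => -[|l] IH Q.
  rewrite expz0 -horner_coef0 horner_subst; apply: peval_ext => w.
  rewrite /x hornerD hornerC hornerZ hornerXn expr0n.
  by case: eqP => [/e0 ->|_]; rewrite ?mul0r ?mulr0 addr0.
apply: (@mulfI K l.+1%:R); first by rewrite pnatr_eq0.
have [N0 hN] := subst_euler Q.
have := congr1 (fun P : {poly K} => P`_l.+1) (hN (maxn N0 l.+2) (leq_maxl _ _)).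
rewrite coefXM /= coef_deriv => e1; rewrite [RHS]mulr_natl e1.
have := congr1 (peval p) (expz_rec L_linear L_comm Q l.+1).
rewrite (pevalZ p) => ->; rewrite (rmorph_sum (peval p)) coef_sum /=.
rewrite [RHS](big_cat_nat (n := l.+2)) ?leq_maxr //= [X in _ = _ + X]big_nat.
rewrite [X in _ = _ + X]big1 ?addr0 => [|i /andP[li _]]; last first.
  by rewrite coefZ coefXnM li mulr0.
rewrite !big_nat; apply: eq_bigr => i /andP[i1 il].
rewrite (pevalZ p) (L_expz L_linear L_comm) IH; last by lia.
by rewrite coefZ coefXnM ltnNge -ltnS il.
Qed.

End Taylor.

Section Leibniz.
Variables (K : fieldType) (A : comAlgType K) (D D' : {linear A -> A}).
Variable k : K.
Let E x := k *: (D x - D' x).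

Lemma scaled_diff_linear : linear E.
Proof.
move=> a x y; rewrite /E (linearP D) (linearP D') opprD addrACA -scalerBr scalerDr.
by rewrite !scalerA mulrC.
Qed.

Lemma scaled_diff_leibniz :
  (forall x y, D (x * y) = D x * y + x * D y) ->
  (forall x y, D' (x * y) = D' x * y + x * D' y) ->
  forall x y, E (x * y) = E x * y + x * E y.
Proof.
move=> hD hD' x y; rewrite /E hD hD' opprD addrACA -mulrBl -mulrBr scalerDr.
by rewrite -scalerAl -scalerAr.
Qed.

Variables (F F' : {linear A -> A}) (l : K).
Let G x := l *: (F x - F' x).

Lemma scaled_diff_comm : (forall x, D (F x) = F (D x)) ->
  (forall x, D (F' x) = F' (D x)) -> (forall x, D' (F x) = F (D' x)) ->
  (forall x, D' (F' x) = F' (D' x)) -> forall x, E (G x) = G (E x).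
Proof.
move=> h1 h2 h3 h4 x; rewrite /E /G.
rewrite (linearZZ D) (linearZZ D') (linearZZ F) (linearZZ F') !raddfB /=.
by rewrite h1 h2 h3 h4 -!scalerBr !scalerA [l * k]mulrC !scalerBr addrACA.
Qed.

End Leibniz.

Lemma scaled_diff_nat (K : fieldType) (A : comAlgType K) (k : K) (x y : A)
    (i j : nat) : x = i%:R -> y = j%:R -> k *: (x - y) = (k * (i%:R - j%:R))%:A.
Proof. by move=> -> ->; rewrite -scalerA scalerBl !scaler_nat. Qed.

Lemma scaled_diff0 (K : fieldType) (A : comAlgType K) (k : K) (x y : A) :
  x = 0 -> y = 0 -> k *: (x - y) = 0.
Proof. by move=> -> ->; rewrite subr0 scaler0. Qed.

Section BilinearValue.
Variables (K : numFieldType) (s : nat) (n : 'I_s -> nat).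
Local Notation V := (tvars s).
Local Notation A := (polyring K V).
Local Notation B := (polyring K (V + V)%type).

Definition diff_op (a : 'I_s) (i : nat) (x : B) : B :=
  i%:R^-1 *: (pderiv (inr (tidx a i)) x - pderiv (inl (tidx a i)) x).

(** Degree 0 marks the variables of the other colours, which are not shifted. *)
Definition shift_deg (a : 'I_s) (w : V + V) : nat :=
  let v := match w with inl v => v | inr v => v end in
  if v.1 == a then v.2.+1 else 0%N.

Definition shift_coef (a : 'I_s) (w : V + V) : K :=
  match w with
  | inl v => if v.1 == a then - v.2.+1%:R^-1 else 0
  | inr v => if v.1 == a then v.2.+1%:R^-1 else 0
  end.

Definition join_pt (t y : V -> K) (w : V + V) : K :=
  match w with inl v => t v | inr v => y v end.

(* The point t + c [zeta], where [zeta] = (zeta, zeta^2/2, zeta^3/3, ...) is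
   added to the variables of colour a. *)
Definition shift_pt (a : 'I_s) (c : K) (t : V -> K) (v : V) : {poly K} :=
  (t v)%:P + (if v.1 == a then c / v.2.+1%:R else 0) *: 'X^(v.2.+1).

Lemma diff_op_linear a i : linear (diff_op a i).
Proof. exact: (@scaled_diff_linear K B (pderiv _) (pderiv _)). Qed.

Lemma diff_op_comm a i j x : diff_op a i (diff_op a j x) = diff_op a j (diff_op a i x).
Proof.
by apply: (@scaled_diff_comm K B (pderiv _) (pderiv _) _ (pderiv _) (pderiv _));
  move=> z; apply: pderiv_comm.
Qed.

Lemma diff_op_leibniz a i x y :
  diff_op a i (x * y) = diff_op a i x * y + x * diff_op a i y.
Proof.
by apply: (@scaled_diff_leibniz K B (pderiv _) (pderiv _)) => z z';
  apply: pderivM.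
Qed.

Lemma diff_op_C a i c : diff_op a i c%:A = 0.
Proof.
exact: (@scaled_diff0 K B _ _ _ (pderivC (inr (tidx a i)) c)
  (pderivC (inl (tidx a i)) c)).
Qed.

Lemma diff_op_var a i w : (0 < i)%N ->
  diff_op a i (var K w) = (if i == shift_deg a w then shift_coef a w else 0)%:A.
Proof.
move=> i0; case: i i0 => [i0|i _]; first discriminate i0.
have e : diff_op a i.+1 (var K w) =
    (i.+1%:R^-1 * ((w == inr (tidx a i.+1))%:R - (w == inl (tidx a i.+1))%:R))%:A.
  exact: (@scaled_diff_nat K B i.+1%:R^-1 _ _ (w == inr (tidx a i.+1))
    (w == inl (tidx a i.+1)) (pderiv_var K (inr (tidx a i.+1)) w)
    (pderiv_var K (inl (tidx a i.+1)) w)).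
apply: etrans e _; apply: (congr1 (fun z : K => z%:A)).
case: w => -[b k]; rewrite /shift_deg /shift_coef.
  have -> : (inl (b, k) == inr (tidx a i.+1) :> V + V) = false by [].
  have -> : (inl (b, k) == inl (tidx a i.+1) :> V + V) = (b == a) && (k == i).
    by [].
  rewrite sub0r /=; case: (b == a); last by rewrite oppr0 mulr0.
  rewrite eqSS [i == k]eq_sym /=.
  by case: eqP => [->|_]; rewrite ?mulrN1 // oppr0 mulr0.
have -> : (inr (b, k) == inl (tidx a i.+1) :> V + V) = false by [].
have -> : (inr (b, k) == inr (tidx a i.+1) :> V + V) = (b == a) && (k == i).
  by [].
rewrite subr0 /=; case: (b == a); last by rewrite mulr0.
rewrite eqSS [i == k]eq_sym /=.
by case: eqP => [->|_]; rewrite ?mulr1 // mulr0.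
Qed.

Lemma peval_exp_diff a (f g : A) t y l :
  peval (join_pt t y) (exp_diff a (in_t f * in_y g) l) =
  (subst (shift_pt a (-1) t) f * subst (shift_pt a 1 y) g)`_l.
Proof.
apply: etrans.
  apply: (@peval_expz K _ (diff_op a) (shift_deg a) (shift_coef a)
    (join_pt t y) (diff_op_linear a) (diff_op_comm a) (diff_op_leibniz a)
    (@diff_op_var a) (diff_op_C a)).
  by case=> -[b k] /=; rewrite /shift_deg /=; case: ifP.
congr (_ : {poly K})`_l.
rewrite rmorphM /in_t /in_y; set x := fun w => _; congr (_ * _).
  apply: (polyring_morph_ext (F := subst x \o subst (fun v => var K (inl v)))).
    by move=> c /=; rewrite !substC.
  move=> v /=; rewrite !subst_var /x /shift_pt /shift_deg /=; case: ifP => _.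
    by rewrite mulN1r.
  by rewrite !scale0r.
apply: (polyring_morph_ext (F := subst x \o subst (fun v => var K (inr v)))).
  by move=> c /=; rewrite !substC.
move=> v /=; rewrite !subst_var /x /shift_pt /shift_deg /=; case: ifP => _.
  by rewrite mul1r.
by rewrite !scale0r.
Qed.

End BilinearValue.

Section BilinearIdentity.
Variables (K : numFieldType) (s : nat) (n : 'I_s -> nat).
Local Notation V := (tvars s).
Local Notation A := (polyring K V).
Local Notation B := (polyring K (V + V)%type).

(* By Taylor's formula the exponentials of derivatives shift t by -[zeta] and y
   by [zeta], where zeta = 1 / z. *)
Definition bilin_term (T : lattice s -> A) (m p : lattice s) (a : 'I_s)
    (t y : V -> K) : {poly K} :=
  subst (shift_pt a (-1) t) (T (m - unitv a)) *
  subst (shift_pt a 1 y) (T (p + unitv a)).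

(** The residue is read in zeta = 1 / z: the coefficient of z^(-1) in z^N f is that of zeta^(N + 1)
    in f, whence -1 in place of the -2 of the identity. *)
Definition bilin_val (T : lattice s -> A) (j : nat) (m p : lattice s)
    (t y : V -> K) : K :=
  \sum_(a < s) (-1) ^ (\sum_(b < s | (b < a)%N) (m b + p b)) *
    Lf (fun i => t (tidx a i) - y (tidx a i)) (m a - p a + (j * n a)%:Z - 1)
      (bilin_term T m p a t y).

Lemma size_shift_pt a c (t : V -> K) v : (size (shift_pt a c t v) <= v.2.+2)%N.
Proof.
apply: leq_trans (size_polyD _ _) _; rewrite geq_max; apply/andP; split.
  by apply: leq_trans (size_polyC_leq1 _) _.
by apply: leq_trans (size_scale_leq _ _) _; rewrite size_polyXn.
Qed.

Lemma shift_size_bound (f : A) : exists C : nat, forall a c t,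
  (size (subst (shift_pt a c t) f) <= C.+1)%N.
Proof.
have [C hC] := size_subst_bound f (fun v => v.2.+1).
by exists C => a c t; apply: hC => v; apply: size_shift_pt.
Qed.

Lemma bilin_size_bound (T : lattice s -> A) (m p : lattice s) :
  exists C : nat, forall a t y,
  (size (bilin_term T m p a t y) <= C)%N.
Proof.
have h (a : 'I_s) : exists C : nat, forall t y,
    (size (bilin_term T m p a t y) <= C)%N.
  have [C1 h1] := shift_size_bound (T (m - unitv a)%R).
  have [C2 h2] := shift_size_bound (T (p + unitv a)%R).
  exists (C1.+1 + C2.+1)%N => t y; apply: leq_trans (size_polyMleq _ _) _.
  by apply: leq_trans (leq_pred _) _; apply: leq_add.
have [C hC] := fin_all_exists h.
exists (\max_a C a)%N => a t y; apply: leq_trans (hC a t y) _.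
exact: leq_bigmax.
Qed.

Definition bilin_sum (T : lattice s -> A) (j : nat) (m p : lattice s) (L : nat) : B :=
  \sum_(a < s) ((-1) ^ (\sum_(b < s | (b < a)%N) (m b + p b)) : K) *:
      res_trunc L (m a - p a + (j * n a)%:Z - 2)
        (exp_mult K a)
        (exp_diff a (in_t (T (m - unitv a)) * in_y (T (p + unitv a)))).

Lemma peval_exp_mult (a : 'I_s) t y l : peval (join_pt t y) (exp_mult K a l) =
  hS (fun i => t (tidx a i) - y (tidx a i)) l.
Proof.
apply: etrans (peval_schur _ (fun i => tvar K a i - yvar K a i) l) _.
apply: eq_hS => i _.
apply: etrans (raddfB (peval (join_pt t y)) _ _) _.
have e1 : peval (join_pt t y) (tvar K a i) = t (tidx a i) := peval_var _ _.
have e2 : peval (join_pt t y) (yvar K a i) = y (tidx a i) := peval_var _ _.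
exact: (f_equal2 (fun b c => b - c) e1 e2).
Qed.

Lemma peval_res_trunc (W : choiceType) (w : W -> K) L N (S P : nat -> polyring K W) u
    (Q : {poly K}) :
  (size Q <= L)%N -> (forall l, peval w (S l) = hS u l) ->
  (forall l, peval w (P l) = Q`_l) ->
  peval w (res_trunc L N S P) = Lf u (N + 1) Q.
Proof.
move=> QL hSu hP; rewrite (LfE _ _ QL) (rmorph_sum (peval w)) /=.
apply: eq_bigr => l _.
have -> : l%:Z - (N + 1) = l%:Z - N - 1 by rewrite opprD addrA.
case: (_ - 1) => i /=; last by rewrite (raddf0 (peval w)) mulr0.
by rewrite (rmorphM (peval w)) /= hSu hP mulrC.
Qed.

(** [L0] is uniform in t and y, so that the truncated residue, a polynomial, can be compared with
    its values at all points. *)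
Lemma bilin_sumP T j (m p : lattice s) : exists L0, forall L t y, (L0 <= L)%N ->
  peval (join_pt t y) (bilin_sum T j m p L) = bilin_val T j m p t y.
Proof.
have [C hC] := bilin_size_bound T m p; exists C => L t y CL.
rewrite /bilin_sum (rmorph_sum (peval (join_pt t y))) /=.
apply: eq_bigr => a _; rewrite (pevalZ (join_pt t y)); congr (_ * _).
rewrite (_ : _ - 1 = m a - p a + (j * n a)%:Z - 2 + 1); last by lia.
apply: peval_res_trunc => [|l|l]; first exact: leq_trans (hC a t y) CL.
  exact: peval_exp_mult.
exact: peval_exp_diff.
Qed.

Lemma bilin_val_poly T j m p : exists Z : B, forall t y,
  peval (join_pt t y) Z = bilin_val T j m p t y.
Proof.
have [L0 hL] := bilin_sumP T j m p.
by exists (bilin_sum T j m p L0) => t y; apply: hL.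
Qed.

Lemma bilinear_identityP (tau : tau_space K s) j m p :
  bilinear_identity n tau j m p <->
  forall t y, bilin_val (fun mu => tau@_mu) j m p t y = 0.
Proof.
have [L0 hL] := bilin_sumP (fun mu => tau@_mu) j m p; split=> [[L1 h] t y|h].
  rewrite -(hL (maxn L0 L1)) ?leq_maxl //.
  apply: etrans (congr1 (peval (join_pt t y)) (h (maxn L0 L1) (leq_maxr _ _))) _.
  exact: (raddf0 (peval (join_pt t y))).
exists L0 => L L0L; apply: (@peval_eq0 _ _ (bilin_sum (fun mu => tau@_mu) j m p L)).
move=> w; rewrite -(h (fun v => w (inl v)) (fun v => w (inr v))) -(hL L) //.
by apply: peval_ext => -[].
Qed.

End BilinearIdentity.

(** * Configurations of coloured points *)

Section Points.
Variables (K : numFieldType) (s : nat).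
Local Notation V := (tvars s).
Local Notation A := (polyring K V).
Local Notation Pt := ('I_s * K)%type.

(** Points of different colours contribute only the sign of their order. This keeps the function
    antisymmetric and produces the signs (-1)^(m_1 + ... + m_(a-1)) of the bilinear identity. *)
Definition pt_diff (x y : Pt) : K :=
  if x.1 == y.1 then x.2 - y.2 else if (x.1 < y.1)%N then 1 else -1.

Definition delta k (X : 'I_k -> Pt) : K :=
  \prod_(i < k) \prod_(j < k) (if (i < j)%N then pt_diff (X i) (X j) else 1).

(* A configuration of coloured points stands for a lattice vector, its numbers of
   points by colour, and for the power sums t_k^(a) = \sum x^k / k over its points
   of colour a. *)
Definition cnt k (X : 'I_k -> Pt) : lattice s := \sum_(i < k) unitv (X i).1.

Definition tpt k (X : 'I_k -> Pt) (v : V) : K :=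
  \sum_(i < k | (X i).1 == v.1) pt (X i).2 v.2.+1.

Definition omega (T : lattice s -> A) k (X : 'I_k -> Pt) : K :=
  peval (tpt X) (T (cnt X)) * delta X.

Definition pcons k (x : Pt) (X : 'I_k -> Pt) (i : 'I_k.+1) : Pt :=
  oapp X x (unlift ord0 i).

Definition prem k (c : 'I_k.+1) (X : 'I_k.+1 -> Pt) (i : 'I_k) : Pt :=
  X (lift c i).

Lemma pt_diffC x y : pt_diff x y = - pt_diff y x.
Proof.
rewrite /pt_diff [y.1 == _]eq_sym; case: eqP => [_|/eqP xy]; first by rewrite opprB.
by case: ltngtP => [_|_|/val_inj/eqP]; rewrite ?opprK // (negPf xy).
Qed.

Lemma pt_diffxx x : pt_diff x x = 0.
Proof. by rewrite /pt_diff eqxx subrr. Qed.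

Lemma pcons0 k x (X : 'I_k -> Pt) : pcons x X ord0 = x.
Proof. by rewrite /pcons unlift_none. Qed.

Lemma pconsS k x (X : 'I_k -> Pt) i : pcons x X (lift ord0 i) = X i.
Proof. by rewrite /pcons liftK. Qed.

Lemma eq_delta k (X Y : 'I_k -> Pt) : X =1 Y -> delta X = delta Y.
Proof.
by move=> h; apply: eq_bigr => i _; apply: eq_bigr => j _; rewrite !h.
Qed.

Lemma eq_cnt k (X Y : 'I_k -> Pt) : X =1 Y -> cnt X = cnt Y.
Proof. by move=> h; apply: eq_bigr => i _; rewrite h. Qed.

Lemma eq_tpt k (X Y : 'I_k -> Pt) : X =1 Y -> tpt X =1 tpt Y.
Proof. by move=> h v; apply: eq_big => i; rewrite h. Qed.

Lemma eq_omega T k (X Y : 'I_k -> Pt) : X =1 Y -> omega T X = omega T Y.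
Proof.
move=> h; rewrite /omega (eq_cnt h) (eq_delta h).
by rewrite (peval_ext (eq_tpt h)).
Qed.

Lemma card_lt_lift k (c : 'I_k.+1) : #|[pred i : 'I_k | (lift c i < c)%N]| = c.
Proof.
have ck : (c <= k)%N by rewrite -ltnS.
rewrite -[RHS]card_ord -(card_image (f := widen_ord ck)); last first.
  by move=> i j /(congr1 val)/= h; apply: val_inj.
apply: eq_card => i; rewrite !inE /= /bump.
have -> : ((c <= i) + i < c)%N = (i < c)%N by case: leqP => h /=; lia.
apply/idP/imageP => [ic|[j _ ->]]; last exact: (ltn_ord j).
by exists (Ordinal ic) => //; apply: val_inj.
Qed.

Lemma delta_rem k (c : 'I_k.+1) (X : 'I_k.+1 -> Pt) :
  delta X = (-1) ^+ c * (\prod_(i < k) pt_diff (X c) (prem c X i)) *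
    delta (prem c X).
Proof.
rewrite /delta (bigD1_ord c) //= (bigD1_ord c) //= ltnn mul1r.
under [X in _ * X = _]eq_bigr => i _ do rewrite (bigD1_ord c) //=.
rewrite big_split /= mulrA; congr (_ * _); last first.
  apply: eq_bigr => i _; apply: eq_bigr => j _.
  suff -> : (bump c i < bump c j)%N = (i < j)%N by [].
  by rewrite /bump; do 2 case: leqP => ? /=; lia.
have -> : (-1) ^+ c = \prod_(i < k) (if (lift c i < c)%N then -1 else 1) :> K.
  rewrite -big_mkcond /= prodr_const; congr (_ ^+ _); symmetry.
  exact: card_lt_lift.
rewrite -!big_split /=; apply: eq_bigr => i _.
rewrite /prem; case: (ltngtP c (bump c i)) => h /=.
- by rewrite mulr1 mul1r.
- by rewrite mul1r mulN1r pt_diffC.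
- by have := neq_bump c i; rewrite -h eqxx.
Qed.

Lemma delta_cons k x (X : 'I_k -> Pt) :
  delta (pcons x X) = (\prod_(i < k) pt_diff x (X i)) * delta X.
Proof.
rewrite (delta_rem ord0) expr0 mul1r pcons0; congr (_ * _).
  by apply: eq_bigr => i _; rewrite /prem pconsS.
by apply: eq_delta => i; rewrite /prem pconsS.
Qed.

Lemma cnt_rem k (c : 'I_k.+1) (X : 'I_k.+1 -> Pt) :
  cnt (prem c X) = cnt X - unitv (X c).1.
Proof. by rewrite /cnt [in RHS](bigD1_ord c) //= [RHS]addrC addKr. Qed.

Lemma cnt_cons k x (X : 'I_k -> Pt) : cnt (pcons x X) = cnt X + unitv x.1.
Proof.
rewrite /cnt (bigD1_ord ord0) //= pcons0 addrC; congr (_ + _).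
by apply: eq_bigr => i _; rewrite pconsS.
Qed.

Lemma tpt_rem k (c : 'I_k.+1) (X : 'I_k.+1 -> Pt) v :
  tpt (prem c X) v = tpt X v - (if (X c).1 == v.1 then pt (X c).2 v.2.+1 else 0).
Proof.
rewrite /tpt [in RHS]big_mkcond (bigD1_ord c) //= [RHS]addrC addKr.
by rewrite -big_mkcond.
Qed.

Lemma tpt_cons k x (X : 'I_k -> Pt) v :
  tpt (pcons x X) v = tpt X v + (if x.1 == v.1 then pt x.2 v.2.+1 else 0).
Proof.
rewrite /tpt [in LHS]big_mkcond (bigD1_ord ord0) //= pcons0 addrC.
congr (_ + _); rewrite [in RHS]big_mkcond.
by apply: eq_bigr => i _; rewrite pconsS.
Qed.

Lemma omega_rem T k (c : 'I_k.+1) (X : 'I_k.+1 -> Pt) :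
  omega T X = (-1) ^+ c * omega T (pcons (X c) (prem c X)).
Proof.
rewrite /omega cnt_cons cnt_rem subrK delta_cons (delta_rem c).
rewrite (@peval_ext _ _ (tpt (pcons _ _)) (tpt X)) => [|v].
  by rewrite -!mulrA mulrCA.
by rewrite tpt_cons tpt_rem subrK.
Qed.

Lemma delta_eq0 k (X : 'I_k -> Pt) i j : i != j -> X i = X j -> delta X = 0.
Proof.
case: k X i j => [|k] X i j; first by case: i.
case: (unliftP i j) => [j' ->|-> /eqP//] _ e.
rewrite (delta_rem i) (bigD1 j') //= /prem -e pt_diffxx.
by rewrite mul0r mulr0 mul0r.
Qed.

Lemma omega_eq0 T k (X : 'I_k -> Pt) i j : i != j -> X i = X j -> omega T X = 0.
Proof. by move=> ij e; rewrite /omega (delta_eq0 ij e) mulr0. Qed.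

Lemma delta_neq0 k (X : 'I_k -> Pt) i j : delta X != 0 -> i != j ->
  (X i).1 = (X j).1 -> (X i).2 != (X j).2.
Proof.
move=> d0 ij e1; apply: contra d0 => /eqP e2; apply/eqP.
by apply: (delta_eq0 ij); case: (X i) (X j) e1 e2 => [? ?] [? ?] /= -> ->.
Qed.

Definition col_pts k (X : 'I_k -> Pt) (a : 'I_s) : seq K :=
  [seq (X i).2 | i <- enum 'I_k & (X i).1 == a].

Lemma big_col_pts (R : Type) (op : SemiGroup.com_law R) idx k (X : 'I_k -> Pt) a (P : pred K)
    (F : K -> R) :
  \big[op/idx]_(x <- col_pts X a | P x) F x =
  \big[op/idx]_(i < k | ((X i).1 == a) && P (X i).2) F (X i).2.
Proof.
by rewrite /col_pts big_map big_filter_cond big_enum_cond.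
Qed.

Lemma uniq_col_pts k (X : 'I_k -> Pt) a : delta X != 0 -> uniq (col_pts X a).
Proof.
move=> d0; rewrite map_inj_in_uniq => [|i j]; first exact/filter_uniq/enum_uniq.
rewrite !mem_filter => /andP[/eqP ia _] /andP[/eqP ja _] e.
apply/eqP/negPn/negP => ij.
by move: (delta_neq0 d0 ij (etrans ia (esym ja))); rewrite e eqxx.
Qed.

Lemma unitvE (a b : 'I_s) : unitv a b = (b == a)%:R.
Proof. by rewrite ffunE. Qed.

Lemma cntE k (X : 'I_k -> Pt) a : cnt X a = (size (col_pts X a))%:Z.
Proof.
rewrite sum_ffunE size_map size_filter -sum1_count big_enum_cond.
rewrite -natz natr_sum [RHS]big_mkcond; apply: eq_bigr => i _ /=.
by rewrite unitvE eq_sym; case: eqP.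
Qed.

Lemma tpt_pts k (X : 'I_k -> Pt) a i : (0 < i)%N ->
  tpt X (tidx a i) = pts (col_pts X a) i.
Proof.
move=> i0; rewrite /tpt /pts big_col_pts /=; apply: eq_big => c.
  by rewrite andbT.
by rewrite prednK.
Qed.

Definition below_sign k (X : 'I_k -> Pt) (a : 'I_s) : K :=
  \prod_(i < k) (if ((X i).1 < a)%N then -1 else 1).

Lemma signz_cnt k (X : 'I_k -> Pt) (a : 'I_s) :
  (-1) ^ (\sum_(b < s | (b < a)%N) cnt X b) = below_sign X a :> K.
Proof.
have -> : \sum_(b < s | (b < a)%N) cnt X b =
    \sum_(i < k) (if ((X i).1 < a)%N then 1 else 0).
  under eq_bigr => b _ do rewrite sum_ffunE.
  rewrite exchange_big /=; apply: eq_bigr => i _.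
  under eq_bigr => b _ do rewrite unitvE.
  case: ifP => ia; last first.
    by rewrite big1 // => b ba; case: eqP => // e; rewrite e ia in ba.
  rewrite (bigD1 (X i).1) //= eqxx big1 ?addr0 // => b /andP[_ /negPf ->] //.
rewrite (big_morph (fun z : int => (-1 : K) ^ z) (id1 := 1) (op1 := *%R)) //.
  by apply: eq_bigr => i _; case: ifP.
by move=> x y; rewrite expfzDr // oppr_eq0 oner_eq0.
Qed.

Lemma below_sign_sq k (X : 'I_k -> Pt) a : below_sign X a * below_sign X a = 1.
Proof.
rewrite -big_split big1 //= => i _; case: ifP => _; by rewrite ?mulrNN mulr1.
Qed.

Lemma prod_pt_diff k (X : 'I_k -> Pt) x : \prod_(i < k) pt_diff x (X i) =
  below_sign X x.1 * \prod_(y <- col_pts X x.1) (x.2 - y).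
Proof.
rewrite big_col_pts [X in _ * X]big_mkcond -big_split; apply: eq_bigr => i _ /=.
rewrite /pt_diff eq_sym andbT; case: eqP => [->|/eqP ne].
  by rewrite ltnn mul1r.
rewrite mulr1; case: ltngtP => // /val_inj e; by rewrite e eqxx in ne.
Qed.

End Points.

(** * The bilinear identity as a sum over points *)

Section Residue.
Variables (K : numFieldType) (s : nat) (n : 'I_s -> nat).
Local Notation V := (tvars s).
Local Notation A := (polyring K V).
Local Notation Pt := ('I_s * K)%type.

Lemma eq_Lf_pos (u u' : nat -> K) e Q : (forall i, (0 < i)%N -> u i = u' i) ->
  Lf u e Q = Lf u' e Q.
Proof.
move=> h; apply: eq_bigr => l _; congr (_ * _).
by case: (_ - e) => //= k; apply: eq_hS => i /andP[i0 _]; apply: h.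
Qed.

(* The coefficients of degree < d of F do not contribute: they could only do so
   through a residue at infinity, which the bound on T excludes. *)
Lemma Lf_pts_drop xs d (F T : {poly K}) : uniq xs -> (size T <= size xs)%N ->
  Lf (pts xs) ((size xs)%:Z + d%:Z - 1) (F * T) =
  \sum_(x <- xs) ((drop_poly d F).[x] * T.[x]) /
     \prod_(y <- xs | y != x) (x - y).
Proof.
move=> uxs Tm; case: (eqVneq T 0) => [->|T0].
  rewrite mulr0 Lfr0 big1 // => x _; by rewrite horner0 mulr0 mul0r.
have sT : (0 < size T)%N by rewrite size_poly_gt0.
rewrite -{1}(poly_take_drop d F) mulrDl LfD [X in X + _]Lf_small ?add0r; last first.
  have := size_polyMleq (take_poly d F) T.
  have := size_take_poly d F; move: (take_poly d F) => F1; lia.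
rewrite [_ * 'X^d]mulrC -mulrA LfXnM.
have -> : (size xs)%:Z + d%:Z - 1 - d%:Z = (size xs)%:Z - 1 by lia.
rewrite Lf_divided_difference //; apply: eq_bigr => x _.
by rewrite hornerM.
Qed.

(** [omega] of X with one more point of colour [a], divided by [delta X], as a polynomial in the
    position of that point: the shift of the times and the new factors of the Vandermonde product
    are both polynomial in it. *)
Definition insert_poly (T : lattice s -> A) k (X : 'I_k -> Pt) (a : 'I_s) : {poly K} :=
  below_sign X a *: (\prod_(y <- col_pts X a) ('X - y%:P) *
    subst (shift_pt a 1 (tpt X)) (T (cnt X + unitv a))).

Lemma insert_polyP T k (X : 'I_k -> Pt) x :
  omega T (pcons x X) = (insert_poly T X x.1).[x.2] * delta X.
Proof.
rewrite /omega delta_cons prod_pt_diff cnt_cons /insert_poly.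
rewrite hornerZ hornerM horner_prod horner_subst.
under [in RHS]eq_bigr => y _ do rewrite hornerXsubC.
rewrite (@peval_ext _ _ (tpt (pcons x X))
  (fun v => (shift_pt x.1 1 (tpt X) v).[x.2])) => [|v]; first by ring.
rewrite tpt_cons /shift_pt !hornerE eq_sym.
by case: eqP => _; rewrite ?mul0r // mulrC.
Qed.

(** Taking out the point c subtracts its powers from the times of colour [a] and divides [delta] by
    its differences with the other points. These split into a sign from the lower colours and the
    denominator of a Lagrange interpolation. *)
Lemma omega_prem (T : lattice s -> A) k (X : 'I_k.+1 -> Pt) (c : 'I_k.+1) a :
  delta X != 0 -> (X c).1 = a ->
  (-1) ^+ c * omega T (prem c X) / delta X = below_sign X a *
    ((subst (shift_pt a (-1) (tpt X)) (T (cnt X - unitv a))).[(X c).2] /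
     \prod_(y <- col_pts X a | y != (X c).2) ((X c).2 - y)).
Proof.
move=> d0 ca.
pose T' := subst (shift_pt a (-1) (tpt X)) (T (cnt X - unitv a)); rewrite -/T'.
have dX := delta_rem c X; rewrite dX /omega.
have -> : T'.[(X c).2] = peval (tpt (prem c X)) (T (cnt (prem c X))).
  rewrite /T' horner_subst cnt_rem ca; apply: peval_ext => v.
  rewrite tpt_rem ca /shift_pt !hornerE eq_sym /pt.
  by case: eqP => _; rewrite ?mul0r ?subr0 ?addr0 // mulNr mul1r mulNr [_ / _]mulrC.
have pdE : \prod_(i < k) pt_diff (X c) (prem c X i) =
    below_sign X a * \prod_(y <- col_pts X a | y != (X c).2) ((X c).2 - y).
  rewrite prod_pt_diff ca; congr (_ * _).
    rewrite /below_sign (bigD1_ord c) //= ca ltnn mul1r //.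
  rewrite !big_col_pts [RHS]big_mkcond (bigD1_ord c) //= ca !eqxx mul1r.
  rewrite [LHS]big_mkcond; apply: eq_bigr => i _; rewrite andbT.
  case: eqP => //= ia; rewrite (delta_neq0 d0) //.
    by rewrite eq_sym neq_lift.
  by rewrite -/(prem c X i) ia ca.
set P := \prod_(y <- _ | _) _; set w := below_sign X a.
move: d0; rewrite dX.
rewrite pdE -/P -/w.
rewrite !mulf_eq0 !negb_or => /andP[/andP[e0 /andP[w0 P0]] dr0].
have ww : w = w^-1 by apply: (mulfI w0); rewrite divff // below_sign_sq.
rewrite [in RHS]ww; field.
by rewrite e0 w0 P0 dr0.
Qed.

(** At these times the exponential of the difference is a quotient of products of factors 1 - x z,
    so colour a contributes a divided difference over the points of X of that colour. At such a
    point the two factors of [bilin_term] are the functions with the point removed from X and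
    inserted into X'; the power of z depending on j becomes [drop_poly]. *)
Lemma bilin_val_residue (T : lattice s -> A) k (X : 'I_k.+1 -> Pt) k' (X' : 'I_k' -> Pt) j :
  delta X != 0 ->
  (forall a, (size (subst (shift_pt a (-1) (tpt X)) (T (cnt X - unitv a)%R))
     <= size (col_pts X a))%N) ->
  bilin_val n T j (cnt X) (cnt X') (tpt X) (tpt X') =
  \sum_(c < k.+1) (-1) ^+ c * omega T (prem c X) / delta X *
    (drop_poly (j * n (X c).1) (insert_poly T X' (X c).1)).[(X c).2].
Proof.
move=> d0 degT; rewrite /bilin_val.
transitivity (\sum_(a < s) \sum_(c < k.+1 | (X c).1 == a)
    (-1) ^+ c * omega T (prem c X) / delta X *
    (drop_poly (j * n (X c).1) (insert_poly T X' (X c).1)).[(X c).2]); last first.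
  rewrite (exchange_big_dep xpredT) //=; apply: eq_bigr => c _.
  by rewrite (big_pred1 (X c).1) // => b; rewrite /= eq_sym.
apply: eq_bigr => a _.
pose u (i : nat) := tpt X (tidx a i) - tpt X' (tidx a i); rewrite -/u.
set f := bilin_term _ _ _ _ _ _.
pose T' := subst (shift_pt a (-1) (tpt X)) (T (cnt X - unitv a)).
pose F := \prod_(y <- col_pts X' a) ('X - y%:P) *
    subst (shift_pt a 1 (tpt X')) (T (cnt X' + unitv a)).
have -> : Lf u (cnt X a - cnt X' a + (j * n a)%:Z - 1) f =
    Lf (pts (col_pts X a)) ((size (col_pts X a))%:Z + (j * n a)%:Z - 1) (F * T').
  transitivity (Lf (fun i => pts (col_pts X a) i - \sum_(y <- col_pts X' a) pt y i)
      (cnt X a - cnt X' a + (j * n a)%:Z - 1) f).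
    by apply: eq_Lf_pos => i i0; rewrite /u !tpt_pts.
  rewrite Lf_sub_seq !cntE; congr (Lf _ _ _); first by lia.
  by rewrite /F -mulrA; congr (_ * _); rewrite mulrC.
rewrite Lf_pts_drop ?uniq_col_pts //; last exact: degT.
have -> : (-1) ^ (\sum_(b < s | (b < a)%N) (cnt X b + cnt X' b)) =
    below_sign X a * below_sign X' a.
  by rewrite big_split expfzDr ?oppr_eq0 ?oner_eq0 //= !signz_cnt.
rewrite big_col_pts mulr_sumr; apply: eq_big => [c|c]; first by rewrite andbT.
rewrite andbT => /eqP ca; rewrite ca.
have -> : drop_poly (j * n a) (insert_poly T X' a) =
    below_sign X' a *: drop_poly (j * n a) F.
  by apply/polyP => i; rewrite coef_drop_poly !coefZ coef_drop_poly.
rewrite hornerZ (omega_prem T d0 ca); ring.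
Qed.

End Residue.

(** * The coloured Vandermonde determinant and the bialternant formula *)

Section RowLabels.
Variables (s : nat) (m : 'I_s -> nat).

(* The block of colour a lists the orders m a, ..., 1. *)
Definition row_block (a : 'I_s) (M : nat) : seq ('I_s * nat) :=
  [seq (a, (M - i).+1) | i <- iota 1 M].

Definition row_labels (cs : seq 'I_s) : seq ('I_s * nat) :=
  flatten [seq row_block a (m a) | a <- cs].

Lemma size_row_block a M : size (row_block a M) = M.
Proof. by rewrite size_map size_iota. Qed.

Lemma row_labels_rcons cs a :
  row_labels (rcons cs a) = row_labels cs ++ row_block a (m a).
Proof. by rewrite /row_labels map_rcons flatten_rcons. Qed.

Lemma row_labels_cons a cs :
  row_labels (a :: cs) = row_block a (m a) ++ row_labels cs.
Proof. by []. Qed.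

Lemma nth_row_block x0 a M p : (p < M)%N -> nth x0 (row_block a M) p = (a, M - p)%N.
Proof.
move=> pM; rewrite (nth_map 0%N) ?size_iota // nth_iota // add1n.
by rewrite subnSK.
Qed.

Lemma mem_row_block a M x :
  (x \in row_block a M) = (x.1 == a) && (0 < x.2 <= M)%N.
Proof.
case: x => b q; apply/mapP/idP => /= [[j]|].
  rewrite mem_iota => /andP[j1 jM] [-> ->]; rewrite eqxx /=; lia.
case/andP=> /eqP -> /andP[q0 qM]; exists (M - q).+1; first by rewrite mem_iota; lia.
by congr (_, _); lia.
Qed.

Lemma mem_row_labels cs x :
  (x \in row_labels cs) = (x.1 \in cs) && (0 < x.2 <= m x.1)%N.
Proof.
elim: cs => [|a cs IH] //; rewrite row_labels_cons mem_cat IH mem_row_block inE.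
case: eqP => [->|_] //=; set B := (_ < x.2 <= m a)%N.
by case: B; rewrite ?andbF.
Qed.

Lemma size_row_labels cs : size (row_labels cs) = (\sum_(a <- cs) m a)%N.
Proof.
elim: cs => [|a cs IH]; first by rewrite big_nil.
by rewrite row_labels_cons size_cat IH size_row_block big_cons.
Qed.

Lemma row_labels_decr cs : uniq cs ->
  pairwise (fun x y : 'I_s * nat => (x.1 == y.1) ==> (y.2 < x.2)%N) (row_labels cs).
Proof.
elim: cs => [|a cs IH] //= /andP[acs ucs].
rewrite row_labels_cons pairwise_cat IH // andbT; apply/andP; split.
  apply/allrelP => x y; rewrite mem_row_block mem_row_labels.
  move=> /andP[/eqP xa _] /andP[ycs _]; rewrite xa; case: eqP => // e.
  by rewrite e ycs in acs.
apply/(pairwiseP (a, 0%N)) => i j; rewrite !inE size_row_block => iM jM ij.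
by rewrite !nth_row_block //= eqxx /=; lia.
Qed.

Lemma big_row_labels (R : Type) (idx : R) (op : Monoid.com_law idx) cs a
    (F : nat -> R) :
  uniq cs -> a \in cs ->
  \big[op/idx]_(x <- row_labels cs | x.1 == a) F x.2 =
  \big[op/idx]_(0 <= j < m a) F (m a - j)%N.
Proof.
move=> ucs acs; rewrite /row_labels big_flatten big_map (bigD1_seq a) //=.
rewrite [X in op _ X]big1 ?Monoid.mulm1 => [|b ba]; last first.
  by rewrite /row_block big_map big1 //= => i; rewrite (negPf ba).
rewrite /row_block big_map /= eqxx.
have -> : iota 1 (m a) = index_iota 1 (m a).+1 by rewrite /index_iota subn1.
rewrite big_add1 /= !big_nat; apply: eq_bigr => i /andP[_ im].
by rewrite subnSK.
Qed.

End RowLabels.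

Section Vandermonde.
Variables (K : numFieldType) (s : nat) (x0 : 'I_s * nat).
Local Notation Pt := ('I_s * K)%type.

(** [x0] is only the default of [nth], here and in everything indexed by row labels. *)
Definition vdm (rl : seq ('I_s * nat)) k (X : 'I_k -> Pt) : 'M[K]_k :=
  \matrix_(i, p) (if (X i).1 == (nth x0 rl p).1
                  then (X i).2 ^+ (nth x0 rl p).2.-1 else 0).

(** Vandermonde elimination: row c becomes the last unit vector, and each remaining row of colour
    [a] splits off its difference with [X c]. *)
Lemma det_vdm_step (pre : seq ('I_s * nat)) a M k (c : 'I_k.+1) (X : 'I_k.+1 -> Pt) :
  (size pre + M)%N = k -> (X c).1 = a ->
  (forall x : 'I_s * nat, x \in pre -> x.1 != a) ->
  \det (vdm (pre ++ row_block a M.+1) X) =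
  (-1) ^+ (c + k) *
  (\prod_(i < k) (if (prem c X i).1 == a then (prem c X i).2 - (X c).2 else 1)) *
  \det (vdm (pre ++ row_block a M) (prem c X)).
Proof.
move=> sk ca prea; set xc := (X c).2.
(* Right multiplication by [U] subtracts [xc] times the next column from every column of the last
   block but the final one. Orders decrease along a block, so z^(q+1) becomes z^q (z - xc). *)
pose U : 'M[K]_k.+1 := \matrix_(p', p) ((p' == p)%:R -
  (if (size pre <= p < k)%N && (p' == p.+1 :> nat) then xc else 0)).
have U1 : \det U = 1.
  rewrite det_trig.
    rewrite big1 // => p _; rewrite mxE eqxx; case: ifP; last by rewrite subr0.
    by case/andP => _ /eqP e; lia.
  apply/is_trig_mxP => i j ij; rewrite mxE.
  have -> : (i == j) = false by apply/negP => /eqP e; rewrite e ltnn in ij.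
  by case: ifP => [/andP[_ /eqP e]|_]; [lia|rewrite subr0].
set W := vdm _ X.
have WE i p : W i p = if (size pre <= p)%N then
    (if (X i).1 == a then (X i).2 ^+ (k - p) else 0)
  else (if (X i).1 == (nth x0 pre p).1 then (X i).2 ^+ (nth x0 pre p).2.-1 else 0).
  rewrite mxE nth_cat ltnNge; case: leqP => h //=.
  have pk := ltn_ord p; rewrite nth_row_block; last by lia.
  by rewrite /= (_ : (M.+1 - (p - size pre)).-1 = k - p)%N //; lia.
have WU i p : (W *m U) i p = W i p -
    (if (size pre <= p < k)%N then xc * (if (X i).1 == a then (X i).2 ^+ (k - p.+1) else 0) else 0).
  rewrite mxE; under eq_bigr => p' _ do rewrite [U _ _]mxE mulrBr.
  rewrite sumrB (bigD1 p) //= eqxx mulr1 big1 ?addr0; last first.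
    by move=> p' /negPf ->; rewrite mulr0.
  congr (_ - _); case: ifP => /= [/andP[pp pk]|_]; last first.
    by rewrite big1 // => p' _; rewrite mulr0.
  have pk' : (p.+1 < k.+1)%N by [].
  rewrite (bigD1 (Ordinal pk')) //= eqxx mulrC WE /= leqW //.
  rewrite big1 ?addr0 // => p' p'p; case: eqP => [e|_]; last by rewrite mulr0.
  by case/eqP: p'p; apply: val_inj.
have -> : \det W = \det (W *m U) by rewrite det_mulmx U1 mulr1.
have rowc p : (W *m U) c p = (p == ord_max)%:R.
  rewrite WU WE ca eqxx; have pk := ltn_ord p.
  case: (leqP (size pre) p) => h /=; last first.
    rewrite subr0 ifN //; last by rewrite eq_sym prea // mem_nth.
    by case: eqP => // e; move: h; rewrite e /= -sk; lia.
  case: (ltnP p k) => h' /=.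
    rewrite -exprS subnSK // subrr; case: eqP => // e; by rewrite e ltnn in h'.
  have -> : p = ord_max by apply: val_inj => /=; lia.
  by rewrite /= subnn expr0 eqxx subr0.
rewrite (expand_det_row _ c) (bigD1 ord_max) //= rowc eqxx mul1r big1 ?addr0; last first.
  by move=> p /negPf pm; rewrite rowc pm mul0r.
rewrite /cofactor -mulrA; congr (_ * _).
pose f : 'rV[K]_k := \row_i (if (prem c X i).1 == a then (prem c X i).2 - xc else 1).
have -> : \prod_(i < k) (if (prem c X i).1 == a then (prem c X i).2 - xc else 1)
    = \det (diag_mx f) by rewrite det_diag; apply: eq_bigr => i _; rewrite mxE.
rewrite -det_mulmx; congr (\det _); apply/matrixP => i p.
rewrite mul_diag_mx [RHS]mxE [f _ _]mxE [vdm _ _ _ _]mxE [LHS]mxE [LHS]mxE WU WE.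
rewrite -/(prem c X i) lift_max.
rewrite nth_cat ltnNge; have pk : (p < k)%N := ltn_ord p.
case: (leqP (size pre) p) => h /=; last first.
  rewrite subr0; case: eqP => [e|_]; last by rewrite mulr0.
  by rewrite ifN ?mul1r // e prea // mem_nth.
rewrite -ltnNge pk nth_row_block /=; last by rewrite ltn_subLR // sk.
case: eqP => _; last by rewrite !mulr0 subr0.
have -> : (M - (p - size pre)).-1 = (k - p.+1)%N.
  by rewrite subnBA // addnC sk subnS.
by rewrite mulrBl -exprS subnSK.
Qed.

Lemma det_vdm cs (m : 'I_s -> nat) k (X : 'I_k -> Pt) :
  sorted (fun a b : 'I_s => a < b)%N cs -> k = size (row_labels m cs) ->
  (forall a, a \in cs -> #|[pred i | (X i).1 == a]| = m a) ->
  (forall i, (X i).1 \in cs) ->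
  \det (vdm (row_labels m cs) X) = delta X.
Proof.
elim/last_ind: cs => [|cs a IH] in k m X *.
  move=> _ k0 _ _; move: X; rewrite k0 /= => X.
  by rewrite det_mx00 /delta big_ord0.
rewrite row_labels_rcons => scs ksz hm hX.
have lta b : b \in cs -> (b < a)%N.
  move=> bcs; move: scs; rewrite sorted_pairwise; last exact: ltn_trans.
  by rewrite pairwise_rcons => /andP[/allP/(_ _ bcs)].
have acs : a \notin cs by apply/negP => /lta; rewrite ltnn.
have hcs b : b \in cs -> #|[pred i | (X i).1 == b]| = m b.
  by move=> bcs; apply: hm; rewrite mem_rcons inE bcs orbT.
have ha : #|[pred i | (X i).1 == a]| = m a by apply: hm; rewrite mem_rcons inE eqxx.
have scs' : sorted (fun a b : 'I_s => a < b)%N cs.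
  move: scs; rewrite !sorted_pairwise; try exact: ltn_trans.
  by rewrite pairwise_rcons => /andP[].
move: (m a) ha ksz => M; elim: M => [|M IHM] in k X hX hcs {hm} * => ha ksz.
  rewrite /= cats0; move: ksz; rewrite /= cats0 => ksz.
  apply: IH => // i; have := hX i; rewrite mem_rcons inE => /orP[/eqP e|//].
  by move/eqP: ha => /pred0P/(_ i); rewrite /= e eqxx.
have /card_gt0P[c] : (0 < #|[pred i | (X i).1 == a]|)%N by rewrite ha.
rewrite inE /= => /eqP ca.
have := ksz; rewrite size_cat size_row_block => ksz'.
case: k => [|k] in X hX hcs ha ksz ksz' c ca *; first by case: c {ca}.
have pre_a (x : 'I_s * nat) : x \in row_labels m cs -> x.1 != a.
  rewrite mem_row_labels => /andP[/lta xa _].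
  by apply: contraTneq xa => ->; rewrite ltnn.
rewrite (det_vdm_step _ ca pre_a); last by lia.
have cardc b : #|[pred i | (X i).1 == b]| =
    ((a == b) + #|[pred i | (prem c X i).1 == b]|)%N.
  have cE q (P : pred 'I_q) : #|[pred i | P i]| = (\sum_i P i)%N.
    by rewrite -sum1_card big_mkcond; apply: eq_bigr => i _; rewrite inE; case: (P i).
  by rewrite !cE (bigD1_ord c) //= ca.
rewrite IHM.
- rewrite (delta_rem c); congr (_ * _); rewrite exprD -mulrA; congr (_ * _).
  (* The factor (-1)^k is spread over the k remaining points: it reverses the differences within
     colour [a] and gives -1 for each point of a lower colour, as in [pt_diff]. *)
  rewrite -[k in _ ^+ k](card_ord k) -prodr_const -big_split /=.
  apply: eq_bigr => i _; rewrite /pt_diff ca [a == _]eq_sym mulN1r.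
  case: eqP => [_|/eqP ne]; first by rewrite opprB.
  have := hX (lift c i); rewrite mem_rcons inE -/(prem c X i) (negPf ne) /=.
  by move=> /lta h; rewrite ltnNge ltnW.
- by move=> i; apply: hX.
- move=> b bcs; rewrite -(hcs b bcs) cardc; case: eqP => // e.
  by rewrite e bcs in acs.
- by apply/eqP; rewrite -(eqn_add2l 1) -[X in _ == X]ha cardc eqxx.
- by rewrite size_cat size_row_block; lia.
Qed.

End Vandermonde.

Section Bialternant.
Variables (K : numFieldType) (s : nat) (x0 : 'I_s * nat).
Local Notation Pt := ('I_s * K)%type.
Local Notation V := (tvars s).

Definition rows (m : 'I_s -> nat) : seq ('I_s * nat) := row_labels m (enum 'I_s).

(** The entry in the row labelled (a, q) is the coefficient of z^(q-1) in w_a(z) exp(\sum_i t_i^(a)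
    z^(-i)). Differentiating by t_k^(a) raises that index by k, so this is the q-th
    t_1^(a)-derivative of the coefficient of z^(-1), as in the statement. *)
Definition alt_mx k (w : 'I_k -> 'I_s -> {poly K}) (m : 'I_s -> nat) (t : V -> K) :=
  \matrix_(p < k, l < k)
    Lf (fun i => t (tidx (nth x0 (rows m) p).1 i)) ((nth x0 (rows m) p).2%:Z - 1)
       (w l (nth x0 (rows m) p).1).

Definition alt k (w : 'I_k -> 'I_s -> {poly K}) (m : 'I_s -> nat) (t : V -> K) : K :=
  \det (alt_mx w m t).

Definition cntn k (X : 'I_k -> Pt) (a : 'I_s) : nat := size (col_pts X a).

Lemma sorted_enum_ord : sorted (fun a b : 'I_s => a < b)%N (enum 'I_s).
Proof.
have := iota_ltn_sorted 0 s; rewrite -val_enum_ord sorted_map.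
by apply: sub_sorted.
Qed.

Lemma size_rows m : size (rows m) = (\sum_a m a)%N.
Proof. by rewrite size_row_labels big_enum. Qed.

Lemma cntn_card k (X : 'I_k -> Pt) a : cntn X a = #|[pred i | (X i).1 == a]|.
Proof.
rewrite /cntn /col_pts size_map size_filter -sum1_count big_enum_cond.
by rewrite -sum1_card; apply: eq_bigl => i; rewrite inE.
Qed.

Lemma sum_cntn k (X : 'I_k -> Pt) : (\sum_a cntn X a)%N = k.
Proof.
rewrite -[RHS]card_ord -sum1_card (partition_big (fun i => (X i).1) xpredT) //=.
by apply: eq_bigr => a _; rewrite cntn_card -sum1_card; apply: eq_bigl => i; rewrite inE.
Qed.

Lemma det_vdm_rows k (X : 'I_k -> Pt) : \det (vdm x0 (rows (cntn X)) X) = delta X.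
Proof.
apply: det_vdm => [||a _|i]; first exact: sorted_enum_ord.
- by have := size_rows (cntn X); rewrite sum_cntn.
- by rewrite cntn_card.
- by rewrite mem_enum.
Qed.

Lemma big_rows (m : 'I_s -> nat) k a (F : nat -> K) : (\sum_a m a)%N = k ->
  \sum_(p < k) (if (nth x0 (rows m) p).1 == a then F (nth x0 (rows m) p).2 else 0) =
  \sum_(0 <= j < m a) F (m a - j)%N.
Proof.
move=> sk; rewrite -[RHS](@big_row_labels _ m _ _ _ (enum 'I_s)) ?enum_uniq ?mem_enum //.
by rewrite [RHS]big_mkcond (big_nth x0) -/(rows m) size_rows sk big_mkord.
Qed.

Lemma Lf_pt (x : K) Q : Lf (pt x) 0 Q = Q.[x].
Proof.
rewrite /Lf horner_coef; apply: eq_bigr => l _.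
by rewrite subr0 /= hS_pt.
Qed.

Section Evaluation.
Variables (k : nat) (X : 'I_k -> Pt).

Definition others (i : 'I_k) : seq K :=
  [seq (X c).2 | c <- enum 'I_k & ((X c).1 == (X i).1) && (c != i)].

Definition eval_coef (i p : 'I_k) : K :=
  let x := nth x0 (rows (cntn X)) p in
  if x.1 == (X i).1
  then (\prod_(y <- others i) ('X - y%:P))`_(cntn X (X i).1 - x.2) else 0.

Lemma size_others i : (size (others i)).+1 = cntn X (X i).1.
Proof.
rewrite /cntn /others !size_map !size_filter -!sum1_count !big_enum_cond.
by rewrite [RHS](bigD1 i) ?eqxx //= add1n.
Qed.

Lemma pts_others i j :
  pts (col_pts X (X i).1) j = pt (X i).2 j + pts (others i) j.
Proof.
rewrite /pts big_col_pts /others big_map big_filter_cond big_enum_cond.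
rewrite [LHS](bigD1 i) ?eqxx //=; congr (_ + _).
by apply: eq_bigl => c; rewrite !andbT.
Qed.

(** The value at [X i] is [Lf] with the times of that point alone. Passing to it from all points of
    its colour multiplies by the product of z - y over the others, and expanding this product gives
    a combination of the rows. *)
Lemma eval_coefP (w : 'I_s -> {poly K}) i : (w (X i).1).[(X i).2] =
  \sum_(p < k) eval_coef i p *
    Lf (fun j => tpt X (tidx (nth x0 (rows (cntn X)) p).1 j))
      ((nth x0 (rows (cntn X)) p).2%:Z - 1) (w (nth x0 (rows (cntn X)) p).1).
Proof.
set a := (X i).1; set u := fun j => tpt X (tidx a j).
set P := \prod_(y <- others i) ('X - y%:P).
transitivity (\sum_(p < k) (if (nth x0 (rows (cntn X)) p).1 == a then
    P`_(cntn X a - (nth x0 (rows (cntn X)) p).2) *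
    Lf u ((nth x0 (rows (cntn X)) p).2%:Z - 1) (w a) else 0)); last first.
  apply: eq_bigr => p _; rewrite /eval_coef -/a -/P.
  by case: eqP => [->|_]; rewrite ?mul0r.
rewrite (big_rows a (fun q => P`_(cntn X a - q) * Lf u (q%:Z - 1) (w a))) ?sum_cntn //.
have sP : size P = cntn X a by rewrite size_prod_XsubC size_others.
transitivity (Lf u ((cntn X a)%:Z - 1) (P * w a)).
  have -> : (cntn X a)%:Z - 1 = 0 + (size (others i))%:Z.
    by rewrite -size_others; lia.
  rewrite -Lf_sub_seq -Lf_pt; apply: eq_Lf_pos => j j0.
  by rewrite /u tpt_pts // pts_others [RHS]addrK.
rewrite -{1}(coefK P) poly_def sP mulr_suml Lf_sum big_mkord.
apply: eq_bigr => j _; rewrite -scalerAl LfZ LfXnM.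
have jm := ltn_ord j; congr (_`_ _ * Lf _ _ _); lia.
Qed.

(** The matrix of values is [E] times the matrix of [alt], with [E] independent of the waves. Its
    determinant is found from the monomials [v] attached to the row labels: for these the second
    factor is unitriangular and the values form the coloured Vandermonde matrix. *)
Lemma bialternant (w : 'I_k -> 'I_s -> {poly K}) :
  delta X * alt w (cntn X) (tpt X) = \det (\matrix_(i, l) (w l (X i).1).[(X i).2]).
Proof.
pose E : 'M[K]_k := \matrix_(i, p) eval_coef i p.
have EM v : \matrix_(i, l) (v l (X i).1).[(X i).2] = E *m alt_mx v (cntn X) (tpt X).
  apply/matrixP => i l; rewrite !mxE eval_coefP; apply: eq_bigr => p _.
  by rewrite !mxE.
rewrite EM det_mulmx /alt; congr (_ * _).
pose v (l : 'I_k) a : {poly K} := if a == (nth x0 (rows (cntn X)) l).1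
  then 'X^((nth x0 (rows (cntn X)) l).2.-1) else 0.
have detv : \det (alt_mx v (cntn X) (tpt X)) = 1.
  have szr : size (rows (cntn X)) = k by rewrite size_rows sum_cntn.
  have q0 p : (p < k)%N -> (0 < (nth x0 (rows (cntn X)) p).2)%N.
    move=> pk; have : nth x0 (rows (cntn X)) p \in rows (cntn X) by rewrite mem_nth ?szr.
    by rewrite mem_row_labels => /andP[_ /andP[]].
  have Xn u e q : Lf u e 'X^q = Sint u (q%:Z - e) :> K.
    rewrite -['X^q]mulr1 LfXnM /Lf size_poly1 big_ord1 coef1 mul1r.
    by rewrite /= sub0r opprB.
  rewrite det_trig.
    rewrite big1 // => p _; rewrite mxE /v eqxx Xn.
    have := q0 p (ltn_ord p) => qp.
    move: (nth _ _ _).2 qp => q qp.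
    by have -> : q.-1%:Z - (q%:Z - 1) = 0; [lia|exact: hS0].
  apply/is_trig_mxP => i j ij; rewrite mxE /v.
  have := row_labels_decr (cntn X) (enum_uniq 'I_s).
  move/(pairwiseP x0)/(_ i j); rewrite !inE -/(rows _) szr !ltn_ord.
  move=> /(_ isT isT ij)/implyP h; case: eqP => [e|_]; last by rewrite Lfr0.
  rewrite Xn; have qj := q0 j (ltn_ord j); have hq := h (introT eqP e).
  move: (nth _ _ i).2 (nth _ _ j).2 qj hq => q q' qj hq.
  have : (q'.-1%:Z - (q%:Z - 1) < 0)%R by lia.
  by case: (_ - _).
have := congr1 determinant (EM v); rewrite det_mulmx detv mulr1 => <-.
rewrite -det_vdm_rows; congr (\det _); apply/matrixP => i p; rewrite !mxE /v.
by case: eqP => _; rewrite ?hornerXn ?horner0.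
Qed.

End Evaluation.

(** Antisymmetry is read off the Vandermonde determinant, whose columns depend only on the numbers
    of points by colour. *)
Lemma delta_perm k (X : 'I_k -> Pt) (sg : {perm 'I_k}) :
  delta (X \o sg) = (-1) ^+ sg * delta X.
Proof.
rewrite -!det_vdm_rows -det_perm -det_mulmx -row_permE; congr (\det _).
apply/matrixP => i p; rewrite !mxE.
suff -> : rows (cntn (X \o sg)) = rows (cntn X) by [].
rewrite /rows /row_labels; congr flatten; apply: eq_map => a; congr row_block.
rewrite !cntn_card -(card_image (perm_inj (s := sg))) //.
apply: eq_card => j; rewrite inE; apply/imageP/idP => [[i' h ->]|h]; first exact: h.
by exists (sg^-1 j)%g; rewrite ?inE /= permKV.
Qed.

End Bialternant.

(** * From the bilinear identity to determinants *)

Section Decomposition.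
Variables (K : numFieldType) (s : nat) (x0 : 'I_s * nat).
Local Notation V := (tvars s).
Local Notation A := (polyring K V).
Local Notation Pt := ('I_s * K)%type.

Lemma poly_eq_pts (p q : {poly K}) : (forall x, p.[x] = q.[x]) -> p = q.
Proof.
move=> h; apply/eqP; rewrite -subr_eq0; apply/negPn/negP => d0.
have := max_poly_roots (rs := [seq j%:R | j <- iota 0 (size (p - q))]) d0.
rewrite map_inj_uniq ?iota_uniq; last exact: (@mulrIn K 1 (oner_neq0 _)).
rewrite size_map size_iota ltnn => hr; suff : false by []; apply: hr => //.
by apply/allP => x _; rewrite rootE hornerD hornerN h subrr.
Qed.

Variables (T : lattice s -> A) (k : nat) (X0 : 'I_k.+1 -> Pt).
Hypothesis omega0 : omega T X0 != 0.

Definition pev (g : 'I_s -> {poly K}) (x : Pt) : K := (g x.1).[x.2].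

(** When [omega] is det (w_l(X_i)), the sum is the expansion of a determinant with [g] as an
    additional column; it vanishes for [g] in the span of the w_l. *)
Definition plucker (g : 'I_s -> {poly K}) := forall X : 'I_k.+2 -> Pt,
  delta X != 0 -> \sum_(c < k.+2) (-1) ^+ c * omega T (prem c X) * pev g (X c) = 0.

(** This is [omega] with the l-th point of [X0] replaced by a variable point; the sign comes from
    moving that point to the front. *)
Definition wave (l : 'I_k.+1) (a : 'I_s) : {poly K} :=
  ((-1) ^+ l * delta (prem l X0)) *: insert_poly T (prem l X0) a.

Lemma waveP l x : pev (wave l) x = (-1) ^+ l * omega T (pcons x (prem l X0)).
Proof. by rewrite /pev hornerZ insert_polyP -mulrA [delta _ * _]mulrC. Qed.

Lemma wave_base l i : pev (wave l) (X0 i) = if i == l then omega T X0 else 0.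
Proof.
rewrite waveP; case: (unliftP l i) => [j ->|->].
  rewrite eq_sym (negPf (neq_lift _ _)) (@omega_eq0 _ _ _ _ _ ord0 (lift ord0 j)) ?mulr0 //.
  by rewrite pcons0 pconsS.
by rewrite eqxx -omega_rem.
Qed.

Lemma prem_pcons x (X : 'I_k.+1 -> Pt) l :
  prem (lift ord0 l) (pcons x X) =1 pcons x (prem l X).
Proof.
move=> i; rewrite /prem; case: (unliftP ord0 i) => [j ->|->].
  rewrite pconsS.
  have -> : lift (lift ord0 l) (lift ord0 j) = lift ord0 (lift l j).
    by apply: val_inj; rewrite /= /bump /=; lia.
  by rewrite pconsS.
have -> : lift (lift ord0 l) ord0 = ord0 by apply: val_inj.
by rewrite !pcons0.
Qed.

Lemma plucker_interp g a : plucker g ->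
  omega T X0 *: g a = \sum_(l < k.+1) pev g (X0 l) *: wave l a.
Proof.
move=> pg; apply: poly_eq_pts => z; rewrite hornerZ horner_sum.
under eq_bigr => l _ do rewrite hornerZ -[(wave l a).[z]]/(pev (wave l) (a, z)).
rewrite -[(g a).[z]]/(pev g (a, z)).
case: (pickP (fun i => X0 i == (a, z))) => [i /eqP <-|hX].
  rewrite (bigD1 i) //= wave_base eqxx mulrC big1 ?addr0 // => l li.
  by rewrite wave_base eq_sym (negPf li) mulr0.
have d0 : delta X0 != 0 by apply: contra omega0 => /eqP e; rewrite /omega e mulr0.
have dX : delta (pcons (a, z) X0) != 0.
  rewrite delta_cons mulf_neq0 //; apply/prodf_neq0 => i _.
  rewrite /pt_diff /=; case: (a =P (X0 i).1) => [e|_]; last first.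
    by case: (a < _)%N; rewrite ?oppr_eq0 oner_eq0.
  rewrite subr_eq0; apply: contraFneq (hX i) => ez.
  by rewrite ez e; case: (X0 i).
have := pg _ dX; rewrite big_ord_recl expr0 mul1r (pcons0 (a, z) X0).
have -> : omega T (prem ord0 (pcons (a, z) X0)) = omega T X0.
  by apply: eq_omega => i; rewrite /prem pconsS.
move/eqP; rewrite addr_eq0 => /eqP ->; rewrite -sumrN; apply: eq_bigr => l _.
rewrite pconsS waveP (eq_omega T (prem_pcons (a, z) X0 l)) /= /bump /= add1n exprS.
by rewrite mulN1r !mulNr opprK mulrC.
Qed.

Definition replace (Y : 'I_k.+1 -> Pt) i x : 'I_k.+1 -> Pt :=
  fun j => if j == i then x else Y j.

Hypothesis plucker_insert : forall X' : 'I_k -> Pt, plucker (insert_poly T X').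

(** As a function of its i-th point, [omega] is an insertion polynomial, to which the interpolation
    formula applies. *)
Lemma omega_expand Y i : omega T Y * omega T X0 =
  \sum_l pev (wave l) (Y i) * omega T (replace Y i (X0 l)).
Proof.
pose g := insert_poly T (prem i Y); pose d := delta (prem i Y).
have eY : omega T Y = (-1) ^+ i * (pev g (Y i) * d).
  by rewrite (omega_rem T i Y) insert_polyP.
have e l : omega T (replace Y i (X0 l)) = (-1) ^+ i * (pev g (X0 l) * d).
  rewrite (omega_rem T i) -insert_polyP; congr (_ * _); rewrite /replace eqxx.
  apply: eq_omega => j; case: (unliftP ord0 j) => [j' ->|->].
    by rewrite !pconsS /prem /replace eq_sym (negPf (neq_lift _ _)).
  by rewrite !pcons0.
have := plucker_interp (Y i).1 (plucker_insert (prem i Y)).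
move/(congr1 (horner^~ (Y i).2)); rewrite hornerZ horner_sum => h.
rewrite eY; transitivity ((-1) ^+ i * d * (omega T X0 * pev g (Y i))); first by ring.
rewrite h mulr_sumr; apply: eq_bigr => l _.
by rewrite hornerZ e /pev -/g; ring.
Qed.

Definition wave_mx (Y : 'I_k.+1 -> Pt) : 'M[K]_k.+1 :=
  \matrix_(i, l) pev (wave l) (Y i).

Lemma wave_mx_expand Y i : \det (wave_mx Y) * omega T X0 =
  \sum_l pev (wave l) (Y i) * \det (wave_mx (replace Y i (X0 l))).
Proof.
have cof l j : cofactor (wave_mx (replace Y i (X0 l))) i j = cofactor (wave_mx Y) i j.
  rewrite /cofactor; congr (_ * \det _); apply/matrixP => p q; rewrite !mxE.
  by rewrite /replace eq_sym (negPf (neq_lift _ _)).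
rewrite (expand_det_row _ i) mulr_suml; apply: eq_bigr => l _.
rewrite mxE (expand_det_row _ i) (bigD1 l) //= big1 => [|j jl].
  by rewrite cof mxE /replace eqxx wave_base eqxx addr0 -mulrA; congr (_ * _); rewrite mulrC.
by rewrite mxE /replace eqxx wave_base eq_sym (negPf jl) mul0r.
Qed.

Lemma omega_perm (sg : {perm 'I_k.+1}) : omega T (X0 \o sg) = (-1) ^+ sg * omega T X0.
Proof.
rewrite /omega (delta_perm x0) mulrCA; congr (_ * (_ * _)).
have hb (R : nmodType) (P : pred Pt) (F : Pt -> R) :
    \sum_(i | P ((X0 \o sg) i)) F ((X0 \o sg) i) = \sum_(i | P (X0 i)) F (X0 i).
  rewrite [RHS](reindex_inj (perm_inj (s := sg))) /=.
  by apply: eq_big => i.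
have -> : cnt (X0 \o sg) = cnt X0 by apply: (hb _ xpredT (fun x => unitv x.1)).
apply: peval_ext => v.
exact: (hb _ (fun x => x.1 == v.1) (fun x => pt x.2 v.2.+1)).
Qed.

(** Both sides expand in the same way in each of their points, so the points can be replaced one by
    one by points of [X0]. There remain repetitions, where both sides vanish, and permutations of
    [X0]. *)
Theorem omega_det Y : omega T Y * omega T X0 ^+ k = \det (wave_mx Y).
Proof.
apply/eqP; rewrite -subr_eq0.
(* From position [j] on, the points already belong to [X0]. *)
suff h j : forall Y, (forall i : 'I_k.+1, (j <= i)%N -> exists l, Y i = X0 l) ->
    omega T Y * omega T X0 ^+ k - \det (wave_mx Y) == 0.
  by apply: (h k.+1) => i; rewrite leqNgt ltn_ord.
elim: j => [|j IH] {}Y hY; last first.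
  case: (ltnP j k.+1) => [jk|kj]; last by apply: IH => i ij; apply: hY; have := ltn_ord i; lia.
  pose i := Ordinal jk; rewrite -(mulIr_eq0 _ (mulIf omega0)) mulrBl.
  rewrite mulrAC (omega_expand Y i) (wave_mx_expand Y i) mulr_suml -sumrB big1 // => l _.
  rewrite -mulrA -mulrBr; apply/eqP; rewrite mulf_eq0; apply/orP; right.
  apply: IH => i' ji'; rewrite /replace; case: eqP => [_|ne]; first by exists l.
  apply: hY; rewrite ltn_neqAle ji' andbT; apply/eqP => e; apply: ne.
  by apply: val_inj.
have [phi hphi] := fin_all_exists (fun i => hY i (leq0n i)).
case: (boolP (injectiveb phi)) => [/injectiveP inj|/injectivePn[i [i' ii' e]]]; last first.
  have eY : Y i = Y i' by rewrite !hphi e.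
  rewrite (omega_eq0 T ii' eY) mul0r sub0r oppr_eq0; apply/eqP.
  by apply: (determinant_alternate ii') => l; rewrite !mxE eY.
pose sg := perm inj.
have eY : Y =1 X0 \o sg by move=> i; rewrite hphi /= permE.
rewrite (eq_omega T eY) omega_perm -mulrA -exprS.
have -> : wave_mx Y = row_perm sg (omega T X0)%:M.
  apply/matrixP => i l; rewrite !mxE eY /= wave_base.
  by case: eqP; rewrite ?mulr1n ?mulr0n.
by rewrite row_permE det_mulmx det_perm det_scalar subrr.
Qed.

End Decomposition.

(** * Prescribing times by points, and testing polynomials at points *)

Section PowerSums.
Variables (K : numClosedFieldType) (s : nat) (x0 : 'I_s * nat).
Local Notation V := (tvars s).
Local Notation A := (polyring K V).
Local Notation Pt := ('I_s * K)%type.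

(** The points are the roots of [P], which is exp(-\sum_i u_i z^i) truncated after z^m and reversed:
    for times given by points that exponential is the product of the factors 1 - x z. *)
Lemma pts_surj (u : nat -> K) m : exists2 xs : seq K, size xs = m &
  forall i, (0 < i <= m)%N -> pts xs i = u i.
Proof.
pose P := \poly_(j < m.+1) hS (fun i => - u i) (m - j).
have Pm : P`_m = 1 by rewrite coef_poly ltnSn subnn hS0.
have sP : size P = m.+1 by rewrite size_poly_eq // subnn hS0 oner_eq0.
have [r Pr] := closed_field_poly_normal P.
have lP : lead_coef P = 1 by rewrite lead_coefE sP.
move: Pr; rewrite lP scale1r => Pr.
have sr : size r = m by move: sP; rewrite Pr size_prod_XsubC => -[].
exists r => // i im; apply: oppr_inj; move: i im.
apply: hS_inj => j jm.
have := Lf_sub_seq (fun=> 0) r (- j%:Z) 1; rewrite mulr1 -Pr Lf0 sr.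
have -> : - j%:Z + m%:Z = (m - j)%N by lia.
rewrite coef_poly ltnS leq_subr subKn // => <-.
rewrite /Lf size_poly1 big_ord1 coef1 mul1r sub0r opprK /=.
by apply: eq_hS => i _; rewrite sub0r.
Qed.

Lemma config_of_rows (m : 'I_s -> nat) k (xs : 'I_s -> seq K) :
  (\sum_a m a)%N = k -> (forall a, size (xs a) = m a) ->
  exists X : 'I_k -> Pt, cntn X =1 m /\
    forall a i, (0 < i)%N -> tpt X (tidx a i) = pts (xs a) i.
Proof.
move=> mk sxs; pose L p := nth x0 (rows m) p.
exists (fun p : 'I_k => ((L p).1, nth 0 (xs (L p).1) (L p).2.-1)); split=> [a|a i i0].
  apply/eqP; rewrite -(eqr_nat K) cntn_card -sum1_card natr_sum big_mkcond /=.
  under eq_bigr => p _ do rewrite inE /=.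
  rewrite (big_rows x0 a (fun=> 1)) // big_const_nat iter_addr_0 subn0 //.
rewrite /tpt big_mkcond /= prednK //.
transitivity (\sum_(p < k) if (L p).1 == a then pt (nth 0 (xs a) (L p).2.-1) i else 0).
  by apply: eq_bigr => p _; case: eqP => [->|].
rewrite (big_rows x0 a (fun q => pt (nth 0 (xs a) q.-1) i)) //.
rewrite /pts [RHS](big_nth 0) sxs [RHS]big_nat_rev !big_nat; apply: eq_bigr => j /andP[_ jm].
by rewrite add0n subnS.
Qed.

(** The points realising given times may coincide. They are moved to X_p + p e; the value of [f] is
    then a polynomial [q] in e which vanishes wherever [B], the product of all differences, does
    not. As [B] is not 0, [q] is, and e = 0 gives the claim. *)
Lemma peval_eq0_at_points (f : A) (m : 'I_s -> nat) k M :
  (\sum_a m a)%N = k -> (forall a, (M <= m a)%N) ->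
  (forall t t' : V -> K, (forall v, (v.2 < M)%N -> t v = t' v) ->
     peval t f = peval t' f) ->
  (forall X : 'I_k -> Pt, cntn X =1 m -> delta X != 0 -> peval (tpt X) f = 0) ->
  forall t, peval t f = 0.
Proof.
move=> mk Mm fdep f0 t.
have hx a : exists xs : seq K, size xs = m a /\
    forall i, (0 < i <= m a)%N -> pts xs i = t (tidx a i).
  by have [xs h1 h2] := pts_surj (fun i => t (tidx a i)) (m a); exists xs.
have [xs hxs] := fin_all_exists hx.
have [X [cX tX]] := config_of_rows mk (fun a => (hxs a).1).
rewrite (fdep t (tpt X)) => [|[a i] /= iM]; last first.
  by rewrite -[(a, i)]/(tidx a i.+1) tX // (hxs a).2 //= (leq_trans iM).
pose Xe e (p : 'I_k) : Pt := ((X p).1, (X p).2 + p%:R * e).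
pose q := subst (fun v : V => \sum_(p < k | (X p).1 == v.1)
  v.2.+1%:R^-1 *: (((X p).2)%:P + p%:R *: 'X) ^+ v.2.+1) f.
have qE e : q.[e] = peval (tpt (Xe e)) f.
  rewrite horner_subst; apply: peval_ext => v; rewrite horner_sum /tpt.
  apply: eq_bigr => p _; rewrite hornerZ horner_exp hornerD hornerC hornerZ hornerX.
  by rewrite /pt mulrC.
pose B : {poly K} := \prod_(i < k) \prod_(j < k)
  (if (i < j)%N then ((X i).2 - (X j).2)%:P + (i%:R - j%:R) *: 'X else 1).
have B0 : B != 0.
  apply/prodf_neq0 => i _; apply/prodf_neq0 => j _; case: ifP => ij; last exact: oner_neq0.
  apply/eqP => /(congr1 (fun p : {poly K} => p`_1)); rewrite coefD coefC coefZ coefX /=.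
  rewrite add0r mulr1 coef0 => /eqP; rewrite subr_eq0 eqr_nat => /eqP e.
  by rewrite e ltnn in ij.
have qB : q * B = 0.
  apply: poly_eq_pts => e; rewrite horner0 hornerM; apply/eqP; rewrite mulf_eq0.
  case: (eqVneq B.[e] 0) => [_|Be]; rewrite ?orbT //; apply/orP; left; apply/eqP.
  rewrite qE f0 //.
    by move=> a; rewrite -cX !cntn_card.
  apply/prodf_neq0 => i _; apply/prodf_neq0 => j _; case: ifP => ij; last exact: oner_neq0.
  rewrite /pt_diff /=; case: ((X i).1 =P (X j).1) => [_|_]; last first.
    by case: ((X i).1 < _)%N; rewrite ?oppr_eq0 oner_neq0.
  move: Be; rewrite horner_prod => /prodf_neq0/(_ i isT).
  rewrite horner_prod => /prodf_neq0/(_ j isT); rewrite ij.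
  rewrite hornerD hornerC hornerZ hornerX mulrBl; apply: contra => /eqP e0.
  by apply/eqP; rewrite -[RHS]e0; ring.
have q0 : q = 0 by apply/eqP; move/eqP: qB; rewrite mulf_eq0 (negPf B0) orbF.
rewrite -[RHS](horner0 0) -q0 qE; apply: peval_ext => v.
by apply: eq_tpt => p; rewrite /Xe mulr0 addr0; case: (X p).
Qed.

Lemma peval_dep_bound (f : A) : exists M, forall t t' : V -> K,
  (forall v, (v.2 < M)%N -> t v = t' v) -> peval t f = peval t' f.
Proof.
have [d hd] := peval_dep f; exists (\max_(v <- d) v.2).+1 => t t' h.
apply: hd => v vd; apply: h; rewrite ltnS.
exact: (@leq_bigmax_seq _ _ xpredT (fun v : V => v.2) v vd isT).
Qed.

End PowerSums.

(** * The waves of a given tau-function *)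

Section ForwardWaves.
Variables (K : numClosedFieldType) (s : nat) (n : 'I_s -> nat) (x0 : 'I_s * nat).
Local Notation V := (tvars s).
Local Notation A := (polyring K V).
Local Notation Pt := ('I_s * K)%type.

Lemma seq_uniform_bound (I : eqType) (r : seq I) (P : I -> nat -> Prop) :
  (forall i C C', (C <= C')%N -> P i C -> P i C') ->
  (forall i, exists C, P i C) -> exists C, forall i, i \in r -> P i C.
Proof.
move=> mono ex; elim: r => [|i r [C IH]]; first by exists 0%N.
have [C' hC'] := ex i; exists (maxn C C') => j; rewrite inE => /orP[/eqP ->|jr].
  by apply: mono hC'; apply: leq_maxr.
by apply: mono (IH j jr); apply: leq_maxl.
Qed.

Lemma lattice_shiftE (d : lattice s) (tau : tau_space K s) m :
  (lattice_shift d tau)@_m = tau@_(m - d).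
Proof.
rewrite /lattice_shift [LHS](raddf_sum (mcoeff m)).
transitivity (\sum_(m' <- msupp tau) if m' == m - d then tau@_m' else 0).
  by apply: eq_bigr => m' _; rewrite [LHS]mcoeffU eq_sym -subr_eq eq_sym; case: eqP.
case: (boolP (m - d \in msupp tau)) => h.
  rewrite (big_fsetD1 _ h) /= eqxx big_seq big1 ?addr0 // => m'.
  by rewrite in_fsetD1 => /andP[/negPf -> _].
rewrite big_seq big1 => [|m' hm']; first by rewrite mcoeff_outdom.
by case: eqP => // e; rewrite -e hm' in h.
Qed.

(** The shift enters the signs twice, through m and through p, and cancels in the exponents of z. *)
Lemma bilin_val_shift (T : lattice s -> A) (d : lattice s) j m p t y :
  bilin_val n (fun m => T (m - d)) j m p t y = bilin_val n T j (m - d) (p - d) t y.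
Proof.
apply: eq_bigr => a _; rewrite !ffunE.
have -> : m a - d a - (p a - d a) = m a - p a by lia.
rewrite /bilin_term [m - _ - d]addrAC [p + _ - d]addrAC; congr (_ * _).
have -> : \sum_(b < s | (b < a)%N) (m b + p b) =
    \sum_(b < s | (b < a)%N) ((m - d) b + (p - d) b) +
    (\sum_(b < s | (b < a)%N) d b) *+ 2.
  rewrite mulr2n -!big_split /=; apply: eq_bigr => b _; rewrite !ffunE; ring.
rewrite expfzDr ?oppr_eq0 ?oner_eq0 // mulr2n expfzDr ?oppr_eq0 ?oner_eq0 //.
by rewrite -expr2 exprnP exprzAC -exprnP sqrrN expr1n exp1rz mulr1.
Qed.

Lemma latticeD (m d : lattice s) a : ((m + d) a : int) = (m a : int) + d a.
Proof. by rewrite ffunE. Qed.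

Lemma latticeB (m d : lattice s) a : ((m - d) a : int) = (m a : int) - d a.
Proof. by rewrite !ffunE. Qed.

(** One set of constants serves all components, as finitely many are nonzero: [B] bounds the
    support, [C] the degree in the shift parameter, [L] the times involved. *)
Lemma support_bounds (tau : tau_space K s) : exists B C L : nat, forall m : lattice s,
  [/\ tau@_m != 0 -> forall a, (`|m a| <= B)%N,
      forall a c t, (size (subst (shift_pt a c t) tau@_m) <= C.+1)%N &
      forall t t' : V -> K, (forall v, (v.2 < L)%N -> t v = t' v) ->
        peval t tau@_m = peval t' tau@_m].
Proof.
have [B hB] : exists B, forall m, m \in msupp tau -> forall a, (`|m a| <= B)%N.
  apply: seq_uniform_bound => [m C C' CC' h a|m]; first exact: leq_trans (h a) CC'.
  by exists (\max_a `|m a|)%N => a; apply: leq_bigmax.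
have [C hC] : exists C, forall m, m \in msupp tau -> forall a c t,
    (size (subst (shift_pt a c t) tau@_m) <= C.+1)%N.
  apply: seq_uniform_bound => [m C C' CC' h a c t|m].
    by apply: leq_trans (h a c t) _.
  exact: shift_size_bound.
have [L hL] : exists L, forall m, m \in msupp tau -> forall t t' : V -> K,
    (forall v, (v.2 < L)%N -> t v = t' v) -> peval t tau@_m = peval t' tau@_m.
  apply: seq_uniform_bound => [m C1 C' CC' h t t' tt'|m]; last exact: peval_dep_bound.
  by apply: h => v vC; apply: tt'; apply: leq_trans vC CC'.
exists B, C, L => m; case: (boolP (m \in msupp tau)) => hm.
  by split; [move=> _; apply: hB|apply: hC|apply: hL].
have t0 := mcoeff_outdom hm; split; first by rewrite t0 eqxx.
  by move=> a c t; rewrite t0 raddf0 size_poly0.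
by move=> t t' _; rewrite t0 !(raddf0 (peval _)).
Qed.

Definition spans k (w : 'I_k -> 'I_s -> {poly K}) (g : 'I_s -> {poly K}) :=
  exists f : 'I_k -> K, forall a, g a = \sum_l f l *: w l a.

Definition mono (a : 'I_s) (i : nat) (b : 'I_s) : {poly K} :=
  if b == a then 'X^i else 0.

Definition represented (T : lattice s -> A) k (w : 'I_k -> 'I_s -> {poly K}) (c : K) :=
  forall X : 'I_k -> Pt, delta X != 0 ->
    peval (tpt X) (T (cnt X)) = c * alt x0 w (cntn X) (tpt X).

Lemma sum_cnt k (X : 'I_k -> Pt) : \sum_a cnt X a = k%:Z.
Proof.
rewrite -[in RHS](sum_cntn X) -natz natr_sum; apply: eq_bigr => a _.
by rewrite cntE natz.
Qed.

(** [E] and [L] are fixed before M, so that M can later be taken above the bounds on the reduced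
    waves; the waves depend on M through the shift [d]. *)
Lemma polynomial_tau_waves (tau : tau_space K s) : (0 < s)%N -> polynomial_tau n tau ->
  exists E L : nat, forall M, (0 < M)%N -> (L <= M)%N ->
  exists (d : lattice s) k (w : 'I_k.+1 -> 'I_s -> {poly K}) (c : K),
  let T (m : lattice s) := tau@_(m - d) in
  [/\ c != 0, represented T w c,
      forall l, spans w (fun a => drop_poly (n a) (w l a)) &
      forall a i, (i < M)%N -> spans w (mono a i)] /\
  [/\ forall l a, (size (w l a) <= M + E)%N,
      forall m : lattice s, T m != 0 -> (forall a, M%:Z <= m a) /\ \sum_a m a = k.+1%:Z,
      forall m (t t' : V -> K), (forall v, (v.2 < L)%N -> t v = t' v) ->
        peval t (T m) = peval t' (T m) &
      forall f : 'I_k.+1 -> K, (forall a, \sum_l f l *: w l a = 0) -> forall l, f l = 0].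
Proof.
move=> s0 [tau0 [k0 [hk0 hbil]]]; have [B [C [L hBCL]]] := support_bounds tau.
(* A wave is a product over at most M + 2B + C + 1 points of its colour times a factor of degree at
   most C. *)
exists (C + C + B + B + 4)%N, L => M M0 LM.
(* The shift leaves at least M + C + 2 in every coordinate of the support: enough points to dominate
   the size C + 1 of the shifted components, with a margin M. *)
pose N := (B + C + 2)%N; pose d : lattice s := [ffun=> (M + N)%:Z].
pose T (m : lattice s) := tau@_(m - d).
have suppT (m : lattice s) : T m != 0 -> forall a, (M + C + 2)%:Z <= m a <= (M + N + B)%:Z.
  move=> Tm a; have [h _ _] := hBCL (m - d); move: (h Tm a).
  rewrite latticeB; have -> : (d a : int) = (M + N)%:Z by rewrite ffunE.
  rewrite /N; move: (m a : int) => z; lia.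
have [m0 Tm0] : exists m0 : lattice s, T m0 != 0.
  apply: contrapT => no; move/eqP: tau0; apply; apply/malgP => m1.
  rewrite mcoeff0; apply/eqP/negPn/negP => h; apply: no.
  by exists (m1 + d); rewrite /T addrK.
pose m0n a := `|m0 a|%N.
have m0E a : m0 a = (m0n a)%:Z by have := suppT _ Tm0 a; rewrite /m0n; lia.
have Mm0 a : (M <= m0n a)%N by have := suppT _ Tm0 a; rewrite m0E; lia.
have [k hk] : exists k, (\sum_a m0n a)%N = k.+1.
  exists (\sum_a m0n a).-1; rewrite prednK // (bigD1 (Ordinal s0)) //=.
  by have := Mm0 (Ordinal s0); lia.
have sumT (m : lattice s) : T m != 0 -> \sum_a m a = k.+1%:Z.
  have h (m' : lattice s) : T m' != 0 -> \sum_a m' a = k0 + \sum_a d a.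
    move=> /hk0 <-; rewrite -big_split /=; apply: eq_bigr => a _.
    by rewrite latticeB subrK.
  move=> Tm; rewrite h // -(h _ Tm0) -hk -natz natr_sum; apply: eq_bigr => a _.
  by rewrite m0E natz.
have k0E : k0 = k.+1%:Z - \sum_a d a.
  rewrite -(sumT _ Tm0); have h := hk0 _ Tm0; rewrite -h -sumrB.
  by apply: eq_bigr => a _; rewrite latticeB.
have [X0 [cX0 wX0]] : exists X0 : 'I_k.+1 -> Pt, cnt X0 = m0 /\ omega T X0 != 0.
  apply: contrapT => no.
  have f0 : forall t, peval t (T m0) = 0.
    apply: (peval_eq0_at_points x0 hk Mm0) => [t t' h|X cX dX].
      have [_ _ hL] := hBCL (m0 - d); apply: hL => v vL; apply: h.
      exact: leq_trans vL LM.
    have cXm : cnt X = m0 by apply/ffunP => a; rewrite cntE -/(cntn X a) cX m0E.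
    apply/eqP/negPn/negP => h; apply: no; exists X; split=> //.
    by rewrite /omega cXm mulf_neq0.
  by move: Tm0; rewrite (peval_eq0 f0) eqxx.
have degT k' (X : 'I_k' -> Pt) a :
    (size (subst (shift_pt a (-1) (tpt X)) (T (cnt X - unitv a)%R)) + M <=
      size (col_pts X a))%N \/ T (cnt X - unitv a)%R = 0.
  case: (eqVneq (T (cnt X - unitv a)%R) 0) => h; [by right|left].
  have := suppT _ h a; rewrite latticeB unitvE eqxx cntE => hh.
  have [_ hC _] := hBCL (cnt X - unitv a - d).
  have := hC a (-1) (tpt X); rewrite -/(T _); lia.
have degT' k' (X : 'I_k' -> Pt) a :
    (size (subst (shift_pt a (-1) (tpt X)) (T (cnt X - unitv a)%R)) <= size (col_pts X a))%N.
  case: (degT _ X a) => [h|->]; last by rewrite raddf0 size_poly0.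
  by apply: leq_trans h; apply: leq_addr.
(* [delta X] clears the denominators of the residue sum. j = 0 gives the Pluecker relations of the
   insertion polynomials, j = 1 those of their images under D. *)
have PL j (X' : 'I_k -> Pt) : @plucker K s T k (fun a => drop_poly (j * n a) (insert_poly T X' a)).
  move=> X dX.
  have : bilin_val n T j (cnt X) (cnt X') (tpt X) (tpt X') = 0.
    rewrite /T (bilin_val_shift (fun m => tau@_m)).
    have sd k' (Y : 'I_k' -> Pt) : \sum_a (cnt Y - d) a = k'%:Z - \sum_a d a.
      by rewrite -(sum_cnt Y) -sumrB; apply: eq_bigr => a _; rewrite latticeB.
    apply: (bilinear_identityP n tau j (cnt X - d) (cnt X' - d)).1.
    by apply: hbil; rewrite sd k0E; lia.
  rewrite bilin_val_residue // => /(congr1 ( *%R (delta X))); rewrite mulr0 mulr_sumr => h.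
  rewrite -[RHS]h; apply: eq_bigr => c _; rewrite /pev; field; exact: dX.
have PL0 (X' : 'I_k -> Pt) : @plucker K s T k (insert_poly T X').
  move=> X dX; rewrite -[RHS](PL 0%N X' X dX); apply: eq_bigr => c _.
  by rewrite /pev mul0n drop_poly0l.
have span_of g : @plucker K s T k g -> spans (wave T X0) g.
  move=> pg; exists (fun l => pev g (X0 l) / omega T X0) => a.
  apply: (@scalerI _ _ (omega T X0)) => //; rewrite (plucker_interp wX0) //.
  rewrite scaler_sumr; apply: eq_bigr => l _.
  by rewrite [RHS]scalerA [_ * (_ / _)]mulrC divfK.
exists d, k, (wave T X0), (omega T X0 ^- k).
split; split.
- by rewrite invr_eq0 expf_neq0.
- move=> X dX; have h := omega_det x0 wX0 PL0 X.
  have b := bialternant x0 X (wave T X0).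
  have : peval (tpt X) (T (cnt X)) * delta X * omega T X0 ^+ k =
      delta X * alt x0 (wave T X0) (cntn X) (tpt X) := etrans h (esym b).
  move=> e; apply: (mulfI dX); rewrite mulrCA -e mulrC [RHS]mulrC mulfK //.
  exact: expf_neq0.
- move=> l; apply: span_of => X dX.
  have := PL 1%N (prem l X0) X dX => /(congr1 ( *%R ((-1) ^+ l * delta (prem l X0)))).
  rewrite mulr0 mulr_sumr => h; rewrite -[RHS]h; apply: eq_bigr => c _.
  rewrite /pev mul1n /wave; set e := _ * delta _; set f := insert_poly _ _ _.
  have -> : drop_poly (n (X c).1) (e *: f) = e *: drop_poly (n (X c).1) f.
    by apply/polyP => i; rewrite !(coef_drop_poly, coefZ).
  by rewrite hornerZ; ring.
(* For z^i in colour [a] the Pluecker sum is a divided difference of z^i T', which vanishes because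
   the margin M keeps the degree too low. *)
- move=> a i iM; apply: span_of => X dX.
  pose T' := subst (shift_pt a (-1) (tpt X)) (T (cnt X - unitv a)).
  transitivity (delta X * below_sign X a *
      Lf (pts (col_pts X a)) ((size (col_pts X a))%:Z - 1) ('X^i * T')); last first.
    case: (degT _ X a) => h; last by rewrite /T' h raddf0 mulr0 Lfr0 mulr0.
    rewrite Lf_small ?mulr0 //.
    have h1 : (size T' + M <= size (col_pts X a))%N := h.
    have := size_polyMleq 'X^i T'; rewrite size_polyXn.
    move: (size ('X^i * T')) (size T') (size (col_pts X a)) h1 => p q r; lia.
  rewrite Lf_divided_difference ?uniq_col_pts // big_col_pts mulr_sumr.
  rewrite [RHS]big_mkcond; apply: eq_bigr => c _; rewrite andbT /pev /mono.
  case: eqP => [ca|_]; last by rewrite horner0 mulr0.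
  have := omega_prem T dX ca; rewrite -/T' hornerM => h.
  rewrite -[(-1) ^+ c * _](divfK dX) h; ring.
- move=> l a; apply: leq_trans (size_scale_leq _ _) _.
  apply: leq_trans (size_scale_leq _ _) _.
  set f := subst _ _; case: (eqVneq (T (cnt (prem l X0) + unitv a)) 0) => h.
    by rewrite /f h raddf0 mulr0 size_poly0.
  have := suppT _ h a; rewrite latticeD unitvE eqxx cntE.
  have [_ hC _] := hBCL (cnt (prem l X0) + unitv a - d).
  have hf : (size f <= C.+1)%N := hC a 1 (tpt (prem l X0)).
  have := size_polyMleq (\prod_(y <- col_pts (prem l X0) a) ('X - y%:P)) f.
  rewrite size_prod_XsubC /N; move: (size (_ * f)) (size f) (size (col_pts _ _)) hf.
  by move=> p q r; lia.
- move=> m Tm; split; last exact: sumT.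
  by move=> a; have := suppT _ Tm a; lia.
- by move=> m t t' h; have [_ _ hL] := hBCL (m - d); apply: hL.
- move=> f hf l.
  have := congr1 (horner^~ (X0 l).2) (hf (X0 l).1); rewrite horner0 horner_sum.
  rewrite (bigD1 l) //= big1 => [|i il]; rewrite hornerZ -/(pev _ (X0 l)) wave_base.
    rewrite eqxx addr0 => /eqP; by rewrite mulf_eq0 (negPf wX0) orbF => /eqP.
  by rewrite eq_sym (negPf il) mulr0.
Qed.

End ForwardWaves.

(** * Removing a trivial wave *)

Section Downshift.
Variables (K : numClosedFieldType) (s : nat) (x0 : 'I_s * nat).

Definition decr (m : 'I_s -> nat) (a b : 'I_s) : nat := (m b - (b == a))%N.

Definition low_sign (a b : 'I_s) : K := if (b <= a)%N then -1 else 1.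

(** The cofactor sign, -1 to the number of rows above the label (a, 1), is put on those rows, which
    have the colours up to [a]. Being constant on each colour, it commutes with D. *)
Definition down (a : 'I_s) (w : 'I_s -> {poly K}) (b : 'I_s) : {poly K} :=
  low_sign a b *: drop_poly (b == a) (w b).

Lemma enum_split (a : 'I_s) : exists cs1 cs2, enum 'I_s = cs1 ++ a :: cs2 /\
  (forall b, b \in cs1 -> (b < a)%N) /\ (forall b, b \in cs2 -> (a < b)%N).
Proof.
have : a \in enum 'I_s by rewrite mem_enum.
have := sorted_enum_ord s => hs /splitPr h; move: hs; case: h => cs1 cs2 hs.
exists cs1, cs2; split=> //; move: hs.
rewrite sorted_pairwise; last exact: ltn_trans.
rewrite pairwise_cat => /and3P[/allrelP h1 _ /=/andP[/allP h2 _]].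
split=> b hb; last exact: h2.
by apply: h1 => //; rewrite inE eqxx.
Qed.

Lemma row_labels_ext (m m' : 'I_s -> nat) cs :
  {in cs, m =1 m'} -> row_labels m cs = row_labels m' cs.
Proof.
elim: cs => [|a cs IH] h //; rewrite !row_labels_cons h ?inE ?eqxx // IH // => b hb.
by apply: h; rewrite inE hb orbT.
Qed.

Lemma row_labels_cat (m : 'I_s -> nat) cs cs' :
  row_labels m (cs ++ cs') = row_labels m cs ++ row_labels m cs'.
Proof. by rewrite /row_labels map_cat flatten_cat. Qed.

(** The column of the constant wave of colour [a] is the unit vector of the row (a, 1), or 0 if that
    colour has no rows. In the minor the other orders of colour [a] must go down by one, which the
    division by z achieves. *)
Lemma alt_down (a : 'I_s) k (w : 'I_k.+1 -> 'I_s -> {poly K}) m t :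
  (\sum_b m b)%N = k.+1 -> w ord0 =1 mono K a 0 ->
  alt x0 w m t = if (0 < m a)%N
    then alt x0 (fun l => down a (w (lift ord0 l))) (decr m a) t else 0.
Proof.
move=> mk w0; have [cs1 [cs2 [ecs [lt1 lt2]]]] := enum_split a.
pose R1 := row_labels m cs1; pose R2 := row_labels m cs2.
have rE : rows m = R1 ++ row_block a (m a) ++ R2.
  by rewrite /rows ecs row_labels_cat row_labels_cons.
have rE' : rows (decr m a) = R1 ++ row_block a (m a).-1 ++ R2.
  rewrite /rows ecs row_labels_cat row_labels_cons /decr eqxx subn1.
  by congr (_ ++ (_ ++ _)); apply: row_labels_ext => b hb;
    rewrite (_ : b == a = false) ?subn0 //; apply/eqP => e;
    [have := lt1 b hb|have := lt2 b hb]; rewrite e ltnn.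
have szr : size (rows m) = k.+1 by rewrite size_rows mk.
have col0 p : (p < k.+1)%N -> Lf (fun i => t (tidx (nth x0 (rows m) p).1 i))
    ((nth x0 (rows m) p).2%:Z - 1) (mono K a 0 (nth x0 (rows m) p).1) =
    (nth x0 (rows m) p == (a, 1%N))%:R.
  move=> pk; have : nth x0 (rows m) p \in rows m by rewrite mem_nth ?szr.
  rewrite mem_row_labels; case: (nth x0 (rows m) p) => b q /= /and3P[_ q0 _].
  rewrite /mono xpair_eqE; case: eqP => _; last by rewrite Lfr0.
  rewrite /Lf expr0 size_poly1 big_ord1 coef1 mul1r /= sub0r opprB.
  case: q q0 => // -[|q] _; first by rewrite subrr /= hS0.
  by have -> : 1 - q.+2%:Z = Negz q by lia.
case: posnP => [ma0|ma].
  rewrite /alt (expand_det_col _ ord0) big1 // => p _; rewrite mxE w0 col0 //.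
  case: eqP => [e|_]; last by rewrite mul0r.
  have : nth x0 (rows m) p \in rows m by rewrite mem_nth ?szr.
  by rewrite e mem_row_labels /= ma0 andbF.
pose p0 := (size R1 + (m a).-1)%N.
have p0k : (p0 < k.+1)%N.
  by rewrite -szr rE !size_cat size_row_block /p0; lia.
have nthp0 : nth x0 (rows m) p0 = (a, 1%N).
  rewrite rE nth_cat ltnNge leq_addr /= addKn nth_cat size_row_block.
  by rewrite ltn_predL ma nth_row_block ?ltn_predL //; congr (_, _); lia.
have nthP p : (p < k)%N -> nth x0 (rows m) (bump p0 p) =
    ((nth x0 (rows (decr m a)) p).1,
     (nth x0 (rows (decr m a)) p).2 + ((nth x0 (rows (decr m a)) p).1 == a))%N.
  move=> pk; rewrite rE rE' /bump !nth_cat !size_row_block.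
  have R1E q : (q < size R1)%N -> ((nth x0 R1 q).1 == a) = false.
    move=> qR; have : nth x0 R1 q \in R1 by rewrite mem_nth.
    rewrite mem_row_labels => /andP[/lt1 h _].
    by apply/eqP => e; rewrite e ltnn in h.
  have R2E q : (q < size R2)%N -> ((nth x0 R2 q).1 == a) = false.
    move=> qR; have : nth x0 R2 q \in R2 by rewrite mem_nth.
    rewrite mem_row_labels => /andP[/lt2 h _].
    by apply/eqP => e; rewrite e ltnn in h.
  have szt : (size R1 + (m a + size R2) = k.+1)%N.
    by rewrite -szr rE !size_cat size_row_block.
  case: (leqP p0 p) => pp /=.
    have -> : (1 + p < size R1)%N = false by apply/negP; rewrite /p0 in pp; lia.
    have -> : (p < size R1)%N = false by apply/negP; rewrite /p0 in pp; lia.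
    have -> : (1 + p - size R1 < m a)%N = false by apply/negP; rewrite /p0 in pp; lia.
    have -> : (p - size R1 < (m a).-1)%N = false by apply/negP; rewrite /p0 in pp; lia.
    have -> : (1 + p - size R1 - m a = p - size R1 - (m a).-1)%N.
      by rewrite /p0 in pp; lia.
    rewrite R2E ?addn0; first by case: (nth _ _ _).
    by rewrite /p0 in pp; lia.
  rewrite add0n; case: (ltnP p (size R1)) => pR /=.
    by rewrite R1E // addn0; case: (nth _ _ _).
  have -> : (p - size R1 < m a)%N by rewrite /p0 in pp; lia.
  have h : (p - size R1 < (m a).-1)%N by rewrite /p0 in pp; lia.
  rewrite h !nth_row_block //= ?eqxx; last by lia.
  by congr (_, _); lia.
rewrite /alt (expand_det_col _ ord0) (bigD1 (Ordinal p0k)) //= mxE w0 col0 //.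
rewrite nthp0 eqxx mul1r big1 ?addr0 => [|p pp0]; last first.
  rewrite mxE w0 col0 // -nthp0 nth_uniq ?szr //; last first.
    by have := row_labels_decr m (enum_uniq 'I_s); apply: pairwise_uniq => -[b q] /=;
      rewrite eqxx ltnn.
  have -> : (p == p0 :> nat) = false.
    by apply: contraNF pp0 => /eqP e; apply/eqP/val_inj.
  by rewrite mul0r.
rewrite /cofactor addn0.
pose f : 'rV[K]_k := \row_p low_sign a (nth x0 (rows (decr m a)) p).1.
have detf : \det (diag_mx f) = (-1) ^+ p0.
  rewrite det_diag; under eq_bigr => p _ do rewrite mxE.
  have szr' : size (rows (decr m a)) = k.
    by apply: succn_inj; rewrite -szr rE rE' !size_cat !size_row_block; lia.
  transitivity (\prod_(x <- rows (decr m a)) low_sign a x.1).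
    by rewrite [RHS](big_nth x0) szr' big_mkord.
  rewrite rE' !big_cat /=.
  have cst (R : seq ('I_s * nat)) (c : K) : (forall x, x \in R -> low_sign a x.1 = c) ->
      \prod_(x <- R) low_sign a x.1 = c ^+ size R.
    move=> h; rewrite big_seq (eq_bigr (fun=> c)) // -big_seq.
    by rewrite big_const_seq count_predT iter_mulr_1.
  rewrite (cst R1 (-1)) => [|x]; last first.
    by rewrite mem_row_labels /low_sign => /andP[/lt1/ltnW -> _].
  rewrite (cst (row_block a (m a).-1) (-1)) => [|x]; last first.
    by rewrite mem_row_block /low_sign => /andP[/eqP -> _]; rewrite leqnn.
  rewrite (cst R2 1) => [|x]; last first.
    by rewrite mem_row_labels /low_sign => /andP[/lt2 h _]; rewrite leqNgt h.
  by rewrite expr1n mulr1 size_row_block -exprD.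
rewrite -detf -det_mulmx; congr (\det _); apply/matrixP => p l.
rewrite mul_diag_mx !mxE /=; have pk : (p < k)%N := ltn_ord p.
rewrite nthP //; set b := (nth _ _ _).1; set q := (nth _ _ _).2.
have q0 : (0 < q)%N.
  have szr' : size (rows (decr m a)) = k.
    by apply: succn_inj; rewrite -szr rE rE' !size_cat !size_row_block; lia.
  have : nth x0 (rows (decr m a)) p \in rows (decr m a) by rewrite mem_nth ?szr'.
  by rewrite mem_row_labels => /and3P[].
rewrite /down LfZ; congr (_ * _).
rewrite -{1}(poly_take_drop (b == a) (w (lift ord0 l) b)) LfD.
rewrite [X in X + _]Lf_small ?add0r; last first.
  have := size_take_poly (b == a) (w (lift ord0 l) b); move: (size _) => z.
  by case: (b == a) => /=; lia.
by rewrite mulrC LfXnM; congr (Lf _ _ _); rewrite PoszD; ring.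
Qed.

End Downshift.

(** * Jordan bases of nilpotent operators *)

Section Jordan.
Variables (F : fieldType) (vT : vectType F) (f : 'End(vT)).

Definition chain (h : vT) (k : nat) : seq vT := [seq iter e f h | e <- iota 0 k].

Definition jordan_seq (hs : seq (vT * nat)) : seq vT :=
  flatten [seq chain h.1 h.2.+1 | h <- hs].

Lemma chainS h k : chain h k.+1 = rcons (chain h k) (iter k f h).
Proof. by rewrite /chain -[k.+1]addn1 iotaD map_cat cats1. Qed.

Lemma chain_cons h k : chain h k.+1 = h :: chain (f h) k.
Proof.
rewrite /chain /= -[1%N]addn0 iotaDl -map_comp; congr (_ :: _).
by apply: eq_map => e /=; rewrite -iterSr.
Qed.

Lemma iter_sub (W : {vspace vT}) k v : (f @: W <= W)%VS -> v \in W -> iter k f v \in W.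
Proof.
move=> fW vW; elim: k => [|k IH] //=.
by apply: (subvP fW); apply: memv_img.
Qed.

Lemma jordan_seq_cons h hs : jordan_seq (h :: hs) = chain h.1 h.2.+1 ++ jordan_seq hs.
Proof. by []. Qed.

Lemma jordan_ends_free hs : free (jordan_seq hs) ->
  free [seq iter h.2 f h.1 | h <- hs].
Proof.
have h : perm_eq (jordan_seq hs) ([seq iter h.2 f h.1 | h <- hs] ++
    flatten [seq chain h.1 h.2 | h <- hs]).
  elim: hs => [|h hs IH] //; rewrite jordan_seq_cons chainS map_cons cat_cons.
  set z := iter _ _ _; set zs := [seq _ | _ <- hs] in IH *.
  have -> : flatten [seq chain h0.1 h0.2 | h0 <- h :: hs] =
    chain h.1 h.2 ++ flatten [seq chain h0.1 h0.2 | h0 <- hs] by [].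
  rewrite cat_rcons (perm_catCA _ [:: z]) /= perm_cons.
  rewrite perm_sym perm_catCA perm_cat2l perm_sym.
  exact: IH.
by rewrite (perm_free h); apply: catl_free.
Qed.

(** Induction on the nilpotency order: the chains of f(W) are lengthened by a preimage of their
    first vector, and their ends are completed to a basis of the kernel of f in W by chains of
    length 1. The ends of all chains are free in this kernel, which bounds their number. *)
Lemma jordan_basis N (W : {vspace vT}) : (f @: W <= W)%VS ->
  (forall v, v \in W -> iter N f v = 0) ->
  exists hs, [/\ basis_of W (jordan_seq hs),
    forall h, h \in hs -> iter h.2.+1 f h.1 = 0 &
    (size hs <= \dim (W :&: lker f))%N].
Proof.
elim: N W => [|N IH] W fW nilW.
  exists [::]; split=> //; rewrite /jordan_seq /= basisEdim /= span_nil andbT.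
  by apply/subvP => v /nilW /= ->; apply: mem0v.
have fW1 : (f @: (f @: W) <= f @: W)%VS by apply: limgS.
have [|hs1 [b1 nil1 _]] := IH _ fW1.
  by move=> v /memv_imgP[u uW ->]; rewrite -iterSr nilW.
have h1W h : h \in hs1 -> exists g, g \in W /\ f g = h.1.
  move=> hh; have : h.1 \in (f @: W)%VS.
    rewrite -(span_basis b1) memv_span //; apply/flattenP.
    by exists (chain h.1 h.2.+1); [apply: map_f|rewrite chain_cons inE eqxx].
  by move=> /memv_imgP[g gW ->]; exists g.
have [lift liftP] : exists lift : vT * nat -> vT,
    forall h, h \in hs1 -> lift h \in W /\ f (lift h) = h.1.
  have ex h : exists g, h \in hs1 -> g \in W /\ f g = h.1.
    case: (boolP (h \in hs1)) => [/h1W[g hg]|_]; [by exists g|by exists 0].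
  by have [l hl] := choice ex; exists l.
pose zs := [seq iter h.2 f h.1 | h <- hs1].
have fzs : free zs by apply: jordan_ends_free; apply: basis_free b1.
pose Z := (W :&: lker f)%VS; pose C := (Z :\: <<zs>>)%VS.
have zsZ : (<<zs>> <= Z)%VS.
  apply/span_subvP => z /mapP[h hh ->]; rewrite memv_cap memv_ker.
  rewrite -iterS nil1 // eqxx andbT; have [lW lf] := liftP h hh.
  by apply: iter_sub => //; rewrite -lf; apply: (subvP fW); apply: memv_img.
pose hs := [seq (lift h, h.2.+1) | h <- hs1] ++ [seq (c, 0%N) | c <- vbasis C].
have jE : jordan_seq hs = flatten [seq lift h :: chain (f (lift h)) h.2.+1 | h <- hs1] ++ vbasis C.
  rewrite /jordan_seq map_cat flatten_cat -!map_comp; congr (flatten _ ++ _).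
    by apply: eq_map => h /=; rewrite chain_cons.
  elim: (vbasis C : seq _) => [|c cs IHc] //=.
  by rewrite /chain /= in IHc *; rewrite IHc.
have CZ : (C <= Z)%VS by apply: diffvSl.
have jW v : v \in jordan_seq hs -> v \in W.
  rewrite jE mem_cat => /orP[/flattenP[ch /mapP[h hh ->]]|vC].
    have [lW lf] := liftP h hh; rewrite -chain_cons => /mapP[e _ ->].
    exact: iter_sub.
  by have := subvP CZ _ (vbasis_mem vC); rewrite memv_cap => /andP[].
have Zspan : (Z <= <<jordan_seq hs>>)%VS.
  apply: (@subv_trans _ _ (C + <<zs>>)%VS).
    by rewrite addv_diff addvSl.
  rewrite subv_add; apply/andP; split.
    rewrite -(span_basis (vbasisP C)); apply: sub_span => v vC.
    by rewrite jE mem_cat vC orbT.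
  apply: sub_span => z /mapP[h hh ->]; rewrite jE mem_cat; apply/orP; left.
  apply/flattenP; exists (lift h :: chain (f (lift h)) h.2.+1); first exact: map_f.
  have [lW lf] := liftP h hh; rewrite lf inE; apply/orP; right.
  by rewrite chainS mem_rcons inE eqxx.
have W1span : (f @: W <= f @: <<jordan_seq hs>>)%VS.
  rewrite -(span_basis b1) limg_span; apply: sub_span => v.
  move=> /flattenP[ch /mapP[h hh ->]] vch; apply/mapP.
  have [lW lf] := liftP h hh; move: vch => /mapP[e]; rewrite mem_iota => /= eh ->.
  exists (iter e f (lift h)); last by rewrite -iterS iterSr lf.
  rewrite jE mem_cat; apply/orP; left; apply/flattenP.
  exists (lift h :: chain (f (lift h)) h.2.+1); first exact: map_f.
  by rewrite -chain_cons; apply/mapP; exists e; rewrite // mem_iota /= ltnS ltnW.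
have Wspan : (W <= <<jordan_seq hs>>)%VS.
  apply/subvP => v vW; have /(subvP W1span) : f v \in (f @: W)%VS by apply: memv_img.
  move=> /memv_imgP[u uS fvu].
  have uW : u \in W by apply: (subvP _ u uS); apply/span_subvP.
  rewrite -(subrK u v) memvD //; apply: (subvP Zspan).
  by rewrite memv_cap memvB //= memv_ker linearB /= fvu subrr.
have dimZ : (size zs + \dim C = \dim Z)%N.
  rewrite -(dimv_cap_compl Z <<zs>>) -/C; congr (_ + _)%N.
  by rewrite (capv_idPr zsZ); apply/esym/eqP.
have szj hs' : size (jordan_seq hs') = (\sum_(h <- hs') h.2.+1)%N.
  rewrite /jordan_seq size_flatten /shape -map_comp sumnE big_map.
  by apply: eq_bigr => h _; rewrite /= size_map size_iota.
(* A generating family whose size is the dimension given by rank-nullity. *)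
have bhs : basis_of W (jordan_seq hs).
  rewrite basisEdim Wspan -(limg_ker_dim f W) -/Z -dimZ.
  have -> : \dim (f @: W) = size (jordan_seq hs1).
    by rewrite -(span_basis b1); apply/eqP; apply: (basis_free b1).
  rewrite !szj /hs big_cat !big_map /=.
  have -> : (\sum_(h <- hs1) h.2.+2 = \sum_(h <- hs1) h.2.+1 + size hs1)%N.
    by rewrite -sum1_size -big_split; apply: eq_bigr => h _; rewrite /= addn1.
  rewrite sum1_size size_tuple size_map.
  by rewrite -addnA leq_eqVlt addnC eqxx.
exists hs; split=> // [h|].
  rewrite mem_cat => /orP[/mapP[h' hh ->]|/mapP[c cC ->]] /=.
    by have [lW lf] := liftP h' hh; rewrite -[RHS](nil1 h' hh) -lf -iterSr.
  by have := subvP CZ _ (vbasis_mem cC); rewrite memv_cap memv_ker => /andP[_ /eqP].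
have <- : \dim <<[seq iter h.2 f h.1 | h <- hs]>>%VS = size hs.
  by apply/eqP; rewrite -(size_map (fun h => iter h.2 f h.1) hs);
    apply: jordan_ends_free; apply: basis_free bhs.
apply: dimvS; apply/span_subvP => z /mapP[h hh ->]; rewrite memv_cap memv_ker.
apply/andP; split; last first.
  move: hh; rewrite mem_cat => /orP[/mapP[h' hh ->]|/mapP[c cC ->]] /=.
    by have [lW lf] := liftP h' hh; rewrite -[X in _ == X](nil1 h' hh) -lf -iterSr.
  by have := subvP CZ _ (vbasis_mem cC); rewrite memv_cap memv_ker => /andP[].
apply: jW; apply/flattenP; exists (chain h.1 h.2.+1); first exact: map_f.
by rewrite chainS mem_rcons inE eqxx.
Qed.

End Jordan.

(** * Spaces of waves *)

Section BasisChange.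
Variables (F : fieldType) (vT : vectType F).

Lemma basis_change (W : {vspace vT}) X X' : basis_of W X -> basis_of W X' ->
  exists2 C : 'M[F]_(\dim W), \det C != 0 &
    forall l : 'I_(\dim W), X`_l = \sum_i C i l *: X'`_i.
Proof.
move=> bX bX'.
have sX : size X == \dim W by have /andP[/eqP <- /eqP ->] := bX.
have sX' : size X' == \dim W by have /andP[/eqP <- /eqP ->] := bX'.
pose Y := Tuple sX; pose Y' := Tuple sX'.
have YE (l : 'I_(\dim W)) : Y`_l = \sum_i coord Y' i Y`_l *: Y'`_i.
  by apply: (@coord_basis _ _ W _ Y' _ bX'); apply: (basis_mem bX); rewrite mem_nth // size_tuple.
have YE' (l : 'I_(\dim W)) : Y'`_l = \sum_i coord Y i Y'`_l *: Y`_i.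
  by apply: (@coord_basis _ _ W _ Y _ bX); apply: (basis_mem bX'); rewrite mem_nth // size_tuple.
pose c (i l : 'I_(\dim W)) : F := coord Y' i X`_l.
pose c' (i l : 'I_(\dim W)) : F := coord Y i X'`_l.
pose C : 'M[F]_(\dim W) := \matrix_(i, l) c i l.
pose C' : 'M[F]_(\dim W) := \matrix_(i, l) c' i l.
have CC' : C' *m C = 1%:M.
  apply/matrixP => i l; rewrite !mxE eq_sym.
  have <- := @coord_free _ _ _ Y l i (basis_free bX).
  rewrite [in RHS]YE linear_sum.
  by apply: eq_bigr => j _; rewrite !mxE linearZ /= mulrC.
exists C => [|l]; last by rewrite -[X]/(tval Y) YE; apply: eq_bigr => i _; rewrite mxE.
apply: contra_eq_neq (congr1 determinant CC') => C0.
by rewrite det_mulmx C0 mulr0 det1 eq_sym oner_eq0.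
Qed.

End BasisChange.

Section WaveSpaces.
Variables (K : numClosedFieldType) (s : nat) (n : 'I_s -> nat) (x0 : 'I_s * nat) (wd : nat).
Local Notation vT := 'M[K]_(s, wd).

(** Waves of degree below [wd], written as matrices with one row of coefficients per colour, form a
    space of finite dimension. *)
Definition wave_of (v : vT) (a : 'I_s) : {poly K} := rVpoly (row a v).
Definition of_wave (w : 'I_s -> {poly K}) : vT := \matrix_a poly_rV (w a).

Lemma of_waveK (w : 'I_s -> {poly K}) : (forall a, size (w a) <= wd)%N ->
  forall a, wave_of (of_wave w) a = w a.
Proof. by move=> sw a; rewrite /wave_of rowK poly_rV_K. Qed.

Lemma size_wave v a : (size (wave_of v a) <= wd)%N.
Proof. exact: size_poly. Qed.

Lemma wave_ofP v v' : wave_of v =1 wave_of v' -> v = v'.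
Proof. by move=> h; apply/row_matrixP => a; apply: (can_inj rVpolyK); apply: h. Qed.

Lemma wave_ofD v v' a : wave_of (v + v') a = wave_of v a + wave_of v' a.
Proof. by rewrite /wave_of !linearD. Qed.

Lemma wave_ofZ c v a : wave_of (c *: v) a = c *: wave_of v a.
Proof. by rewrite /wave_of !linearZ. Qed.

Lemma wave_of0 a : wave_of 0 a = 0.
Proof. by rewrite /wave_of !linear0. Qed.

Lemma wave_of_sum (I : finType) (F : I -> vT) a :
  wave_of (\sum_i F i) a = \sum_i wave_of (F i) a.
Proof. by apply: (big_morph (wave_of^~ a)) => [v v'|]; rewrite ?wave_ofD ?wave_of0. Qed.

Definition drop_wave (d : 'I_s -> nat) (e : 'I_s -> K) (v : vT) : vT :=
  of_wave (fun b => e b *: drop_poly (d b) (wave_of v b)).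

Lemma drop_wave_linear d e : linear (drop_wave d e).
Proof.
move=> c v v'; apply/row_matrixP => a; rewrite !(rowK, linearP) /=.
by rewrite wave_ofD wave_ofZ !linearD !linearZ /= !rowK scalerA mulrC -scalerA !linearZ.
Qed.
HB.instance Definition _ d e :=
  GRing.isLinear.Build K vT vT _ (drop_wave d e) (drop_wave_linear d e).

Definition dropL d e : 'End(vT) := linfun (drop_wave d e).

Lemma dropLE d e v b : wave_of (dropL d e v) b = e b *: drop_poly (d b) (wave_of v b).
Proof.
rewrite lfunE of_waveK // => a.
apply: leq_trans (size_scale_leq _ _) _; rewrite size_drop_poly.
by apply: leq_trans (leq_subr _ _) _; apply: size_wave.
Qed.

Definition wave_D := dropL n (fun=> 1).
Definition wave_down a := dropL (fun b => (b == a) : nat) (low_sign K a).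
Definition wave_mono a i : vT := of_wave (mono K a i).

Lemma wave_monoE a i b : (i < wd)%N -> wave_of (wave_mono a i) b = mono K a i b.
Proof.
move=> iw; apply: of_waveK => c; rewrite /mono; case: eqP => _; rewrite ?size_poly0 //.
by rewrite size_polyXn.
Qed.

Lemma wave_D_down a v : wave_D (wave_down a v) = wave_down a (wave_D v).
Proof.
apply: wave_ofP => b; rewrite !dropLE !drop_polyZ !scale1r; congr (_ *: _).
by apply/polyP => i; rewrite !coef_drop_poly addnAC.
Qed.

Lemma low_sign_neq0 (a b : 'I_s) : low_sign K a b != 0.
Proof. by rewrite /low_sign; case: ifP; rewrite ?oppr_eq0 oner_eq0. Qed.

Lemma wave_down_mono a b i : (i < wd)%N ->
  wave_down a (wave_mono b i) =
  low_sign K a b *: (if b == a then if i is j.+1 then wave_mono b j else 0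
                     else wave_mono b i).
Proof.
move=> iw; apply: wave_ofP => c; rewrite dropLE wave_ofZ wave_monoE // /mono.
case: (c =P b) => [->|cb].
  case: eqP => _; last by rewrite drop_poly0l wave_monoE // /mono eqxx.
  case: i iw => [|i] iw.
    by rewrite wave_of0 expr0 drop_poly_eq0 // size_poly1.
  rewrite wave_monoE ?(ltnW iw) // /mono eqxx; congr (_ *: _).
  by apply/polyP => j; rewrite coef_drop_poly !coefXn addn1 eqSS.
rewrite drop_poly0r !scaler0; case: eqP => _.
  case: i iw => [|i] iw; first by rewrite wave_of0 scaler0.
  by rewrite wave_monoE ?(ltnW iw) // /mono; case: eqP => [/cb|]; rewrite ?scaler0.
by rewrite wave_monoE // /mono; case: eqP => [/cb|]; rewrite ?scaler0.
Qed.

Definition altv k (X : seq vT) m t := alt x0 (fun l : 'I_k => wave_of X`_l) m t.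

Lemma alt_mul k (w w' : 'I_k -> 'I_s -> {poly K}) (C : 'M[K]_k) m t :
  (forall l a, w l a = \sum_i C i l *: w' i a) ->
  alt x0 w m t = \det C * alt x0 w' m t.
Proof.
move=> h; rewrite /alt mulrC -det_mulmx; congr (\det _); apply/matrixP => p l.
rewrite !mxE h Lf_sum; apply: eq_bigr => i _; rewrite LfZ mxE mulrC //.
Qed.

Lemma altv_basis (W : {vspace vT}) X X' : basis_of W X -> basis_of W X' ->
  exists2 c : K, c != 0 &
    forall m t, altv (\dim W) X m t = c * altv (\dim W) X' m t.
Proof.
move=> bX bX'; have [C C0 CE] := basis_change bX bX'.
exists (\det C) => // m t; apply: alt_mul => l a.
rewrite CE wave_of_sum; apply: eq_bigr => i _; exact: wave_ofZ.
Qed.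

Lemma eq_alt k (w w' : 'I_k -> 'I_s -> {poly K}) m t : (forall l, w l =1 w' l) ->
  alt x0 w m t = alt x0 w' m t.
Proof. by move=> h; congr (\det _); apply/matrixP => p l; rewrite !mxE h. Qed.

Lemma eq_alt_rows k (w : 'I_k -> 'I_s -> {poly K}) m m' t : m =1 m' ->
  alt x0 w m t = alt x0 w m' t.
Proof. by move=> h; rewrite /alt /alt_mx /rows (row_labels_ext (m' := m')). Qed.

End WaveSpaces.

(** * Removal of all constant waves *)

Section Reduction.
Variables (K : numClosedFieldType) (s : nat) (n : 'I_s -> nat) (x0 : 'I_s * nat) (wd : nat).
Hypothesis wd_gt0 : (0 < wd)%N.
Local Notation vT := 'M[K]_(s, wd).
Local Notation wmono := (@wave_mono K s wd).
Local Notation wdown := (@wave_down K s wd).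
Local Notation wD := (@wave_D K s n wd).

Lemma wave_down_ker a v : wdown a v = 0 -> v \in <[wmono a 0]>%VS.
Proof.
move=> dv; have h b : drop_poly (b == a) (wave_of v b) = 0.
  have /eqP := dropLE (fun b => (b == a) : nat) (low_sign K a) v b.
  rewrite -/(wave_down _ _) dv wave_of0 eq_sym scaler_eq0.
  by rewrite (negPf (low_sign_neq0 K a b)) /= => /eqP.
apply/vlineP; exists (wave_of v a)`_0; apply: wave_ofP => b.
rewrite wave_ofZ wave_monoE // /mono -[LHS](poly_take_drop (b == a)) h mul0r addr0.
case: eqP => [->|_]; last by rewrite take_poly0l scaler0.
by apply/polyP => -[|i]; rewrite coef_take_poly coefZ expr0 coef1 ?mulr1 ?mulr0.
Qed.

Lemma wmono0_neq0 a : wmono a 0 != 0.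
Proof.
apply/eqP => /(congr1 (fun v => wave_of v a)); rewrite wave_monoE // wave_of0 /mono eqxx.
by move/eqP; rewrite expr0 oner_eq0.
Qed.

(** The kernel of [wdown a] is the line of the constant wave, so a complement [C] of this line in W
    maps isomorphically onto the image. [alt_down] applies to the basis made of the constant
    followed by a basis of [C]. *)
Lemma altv_down (W : {vspace vT}) a X : wmono a 0 \in W -> basis_of W X ->
  [/\ \dim W = (\dim (wdown a @: W)).+1 & exists X1, basis_of (wdown a @: W) X1 /\
  exists2 c : K, c != 0 & forall m t, (\sum_b m b)%N = \dim W ->
  altv x0 (\dim W) X m t =
    if (0 < m a)%N then c * altv x0 (\dim (wdown a @: W)) X1 (decr m a) t else 0].
Proof.
move=> v0W bX; set v0 := wmono a 0; pose C := (W :\: <[v0]>)%VS.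
have dv0 : wdown a v0 = 0.
  by rewrite /v0 wave_down_mono // eqxx scaler0.
have CW : (C + <[v0]> = W)%VS.
  by rewrite addv_diff; apply/addv_idPl; rewrite -memvE.
have CI : (C :&: lker (wdown a) = 0)%VS.
  apply/eqP; rewrite -subv0 -(capv_diff W <[v0]>) subv_cap capvSl /=.
  by apply/subvP => v; rewrite memv_cap memv_ker => /andP[_ /eqP /wave_down_ker].
have dW : (wdown a @: W = wdown a @: C)%VS.
  by rewrite -CW limgD limg_line dv0 addvC (_ : <[0]>%VS = 0%VS) ?add0v //;
    apply/eqP; rewrite -dimv_eq0 dim_vline eqxx.
have bX0 : basis_of W (v0 :: vbasis C).
  rewrite -CW addvC -cat1s; apply: cat_basis; last exact: vbasisP.
    by apply/directv_addP; rewrite capvC capv_diff.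
  by rewrite basisEdim span_seq1 subvv dim_vline wmono0_neq0.
have bX1 : basis_of (wdown a @: W) (map (wdown a) (vbasis C)).
  by rewrite dW; apply: limg_basis_of => //; apply: vbasisP.
have dimC : \dim (wdown a @: W) = \dim C.
  by have := limg_ker_dim (wdown a) C; rewrite CI dimv0 add0n dW => ->.
have dimW : \dim W = (\dim (wdown a @: W)).+1.
  have /andP[/eqP e /eqP] := bX0; rewrite e => ->.
  by rewrite /= size_tuple dimC.
split=> //; exists (map (wdown a) (vbasis C)); split=> //.
have [c c0 hc] := altv_basis x0 bX bX0; exists c => // m t mk.
rewrite hc dimW; move: mk; rewrite dimW => mk.
rewrite /altv (@alt_down K s x0 a) => //; last first.
  by move=> b; rewrite /= wave_monoE.
case: ifP => _; last by rewrite mulr0.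
congr (_ * _); apply: eq_alt => l b; rewrite /= (nth_map 0); last first.
  by rewrite size_tuple -dimC.
by rewrite dropLE.
Qed.

Definition stable (W : {vspace vT}) := (wD @: W <= W)%VS.

Lemma stable_down W a : stable W -> stable (wdown a @: W)%VS.
Proof.
move=> sW; apply/subvP => _ /memv_imgP[_ /memv_imgP[v vW ->] ->].
by rewrite wave_D_down memv_img //; apply: (subvP sW); apply: memv_img.
Qed.

Definition diffn (m e : 'I_s -> nat) a := (m a - e a)%N.

(** Induction on the dimension. Each removal takes one unit of its colour both from the number
    [Mn a] of available powers of z and from the bound [Sz a]. When no constant is left no power is
    guaranteed any more, so at least [Mn a] removals of colour a took place. *)
Lemma reduce (Mn Sz : 'I_s -> nat) (W : {vspace vT}) : (forall a, Mn a <= wd)%N ->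
  stable W -> (forall a i, (i < Mn a)%N -> wmono a i \in W) ->
  (forall v a, v \in W -> size (wave_of v a) <= Sz a)%N ->
  exists e (W' : {vspace vT}),
  [/\ stable W', forall a, wmono a 0 \notin W', forall a, (Mn a <= e a)%N,
      forall v a, v \in W' -> (size (wave_of v a) <= Sz a - e a)%N &
      \dim W = (\dim W' + \sum_a e a)%N] /\
  forall X, basis_of W X -> exists X', basis_of W' X' /\
  exists2 c : K, c != 0 & forall m t, (\sum_b m b)%N = \dim W ->
  altv x0 (\dim W) X m t = if [forall a, e a <= m a]%N
    then c * altv x0 (\dim W') X' (diffn m e) t else 0.
Proof.
have [k hk] := ubnP (\dim W); elim: k => // k IH in Mn Sz W hk *.
move=> Mnwd sW monoW szW.
have [/existsP[a aW]|no] := boolP [exists a, wmono a 0 \in W]; last first.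
  exists (fun=> 0%N), W; split; first split=> //.
  - by rewrite negb_exists in no; move/forallP: no.
  - move=> a; rewrite leqn0; case: posnP => // /monoW h; move: no; rewrite negb_exists.
    by move/forallP => h2; have := h2 a; rewrite h.
  - by move=> v a vW; rewrite subn0 szW.
  - by rewrite big1 ?addn0.
  move=> X bX; exists X; split=> //; exists 1 => [|m t _]; first exact: oner_neq0.
  rewrite (_ : [forall a, _]) ?mul1r; last by apply/forallP.
  by rewrite /altv; apply: eq_alt_rows => a; rewrite /diffn subn0.
have [dimW _] := altv_down aW (vbasisP W).
have dk : (\dim (wdown a @: W) < k)%N by rewrite -ltnS -dimW.
have [||||e [W' [[sW' noW' Me szW' dimW'] hX]]] :=
    IH (decr Mn a) (decr Sz a) (wdown a @: W)%VS dk.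
- by move=> b; apply: leq_trans (leq_subr _ _) (Mnwd b).
- exact: stable_down.
- move=> b i; rewrite /decr => iM.
  have iM' : (i + (b == a) < Mn b)%N by lia.
  have := memv_img (wdown a) (monoW b _ iM').
  rewrite (@wave_down_mono K s wd a b _ (leq_trans iM' (Mnwd b))).
  rewrite (_ : (if _ then _ else _) = wmono b i).
    by rewrite rpredZeq (negPf (low_sign_neq0 K a b)).
  by case: eqP => _; rewrite ?addn0 ?addn1.
- move=> _ b /memv_imgP[v vW ->]; rewrite dropLE.
  apply: leq_trans (size_scale_leq _ _) _; rewrite size_drop_poly /decr.
  by apply: leq_sub2r; apply: szW.
exists (fun b => e b + (b == a))%N, W'; split; first split=> //.
- by move=> b; have := Me b; rewrite /decr leq_subLR addnC.
- by move=> v b vW'; rewrite addnC subnDA; apply: szW'.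
- rewrite dimW dimW' big_split /= -addnS; congr (_ + _)%N.
  rewrite -addn1; congr (_ + _)%N; rewrite (bigD1 a) //= eqxx big1 // => b /negPf -> //.
move=> X bX; have [_ [X1 [bX1 [c1 c10 h1]]]] := altv_down aW bX.
have [X' [bX' [c2 c20 h2]]] := hX X1 bX1.
exists X'; split=> //; exists (c1 * c2) => [|m t mk]; first by rewrite mulf_neq0.
rewrite h1 //; case: posnP => ma.
  case: forallP => // /(_ a); rewrite ma eqxx addn1 //.
rewrite h2; last first.
  apply: succn_inj; rewrite -dimW -mk.
  rewrite (bigD1 a) //= [in RHS](bigD1 a) //= /decr eqxx subn1 -addSn prednK //.
  by congr (_ + _)%N; apply: eq_bigr => b /negPf ->; rewrite subn0.
have -> : [forall b, e b <= decr m a b]%N = [forall b, e b + (b == a) <= m b]%N.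
  apply: eq_forallb => b; rewrite /decr; case: eqP => [->|_]; rewrite ?subn0 ?addn0 //.
  by rewrite addn1 subn1 -ltnS prednK.
case: ifP => _; last by rewrite mulr0.
rewrite mulrA; congr (_ * _); rewrite /altv; apply: eq_alt_rows => b.
by rewrite /diffn /decr subnDA subnAC.
Qed.

End Reduction.

(** * Polynomials attached to waves, and the Jordan chains of D *)

Section WaveStructure.
Variables (K : numClosedFieldType) (s : nat) (n : 'I_s -> nat) (x0 : 'I_s * nat).
Local Notation V := (tvars s).
Local Notation A := (polyring K V).

Definition Lf_poly (a : 'I_s) (e : int) (Q : {poly K}) : A :=
  \sum_(l < size Q) Q`_l *:
    (if l%:Z - e is Posz j then schur j (fun i => var K (tidx a i)) else 0).

Lemma peval_Lf_poly t a e Q : peval t (Lf_poly a e Q) = Lf (fun i => t (tidx a i)) e Q.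
Proof.
rewrite /Lf_poly (rmorph_sum (peval t)) /=; apply: eq_bigr => l _.
rewrite (pevalZ t) /Sint; case: (l%:Z - e) => j; last by rewrite (rmorph0 (peval t)).
by rewrite peval_schur; congr (_ * hS _ _); apply/funext => i; rewrite peval_var.
Qed.

Definition alt_poly k (w : 'I_k -> 'I_s -> {poly K}) (m : 'I_s -> nat) : A :=
  \det (\matrix_(p < k, l < k)
    Lf_poly (nth x0 (rows m) p).1 ((nth x0 (rows m) p).2%:Z - 1)
       (w l (nth x0 (rows m) p).1)).

Lemma peval_alt_poly t k (w : 'I_k -> 'I_s -> {poly K}) m :
  peval t (alt_poly w m) = alt x0 w m t.
Proof.
rewrite /alt_poly -(det_map_mx (peval t)) /alt; congr (\det _).
by apply/matrixP => p l; rewrite !mxE; apply: peval_Lf_poly.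
Qed.

(** A row has order at least 1, so a wave of degree at most N meets only Schur polynomials of degree
    at most N, hence the first N times. *)
Lemma alt_dep N k (w : 'I_k -> 'I_s -> {poly K}) m (t t' : V -> K) :
  (\sum_a m a)%N = k ->
  (forall l a, (size (w l a) <= N.+1)%N) -> (forall v, (v.2 < N)%N -> t v = t' v) ->
  alt x0 w m t = alt x0 w m t'.
Proof.
move=> mk sw tt'; congr (\det _); apply/matrixP => p l; rewrite !mxE.
have : nth x0 (rows m) p \in rows m by rewrite mem_nth // size_rows mk.
rewrite mem_row_labels; move: (nth x0 (rows m) p) => [a q] /= /and3P[_ q0 _].
apply: eq_bigr => i _; congr (_ * _); rewrite /Sint.
case e : (i%:Z - (q%:Z - 1)) => [j|//]; apply: eq_hS => h /andP[h0 hj]; apply: tt'.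
have il := leq_trans (ltn_ord i) (sw l a).
by rewrite /tidx /=; lia.
Qed.

Definition chain_list r (g : 'I_r -> 'I_s -> {poly K}) (kp : 'I_r -> nat) :
    seq ('I_s -> {poly K}) :=
  flatten [seq [seq (fun a => drop_poly (e * n a) (g j a)) | e <- iota 0 (kp j).+1]
          | j <- enum 'I_r].

Definition alt_seq (L : seq ('I_s -> {poly K})) m t :=
  alt x0 (fun l : 'I_(size L) => nth (fun=> 0) L l) m t.

Variable wd : nat.
Hypothesis wd_gt0 : (0 < wd)%N.
Hypothesis n_gt0 : forall a, (0 < n a)%N.
Local Notation vT := 'M[K]_(s, wd).
Local Notation wmono := (@wave_mono K s wd).
Local Notation wD := (@wave_D K s n wd).

Lemma iter_wD N v a : wave_of (iter N wD v) a = drop_poly (N * n a) (wave_of v a).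
Proof.
elim: N => [|N IH]; first by rewrite drop_poly0l.
rewrite iterS dropLE scale1r IH; apply/polyP => i.
by rewrite !coef_drop_poly mulSn addnA.
Qed.

Lemma wD_nilpotent v : iter wd wD v = 0.
Proof.
apply: wave_ofP => a; rewrite iter_wD wave_of0 drop_poly_eq0 //.
by apply: leq_trans (size_wave _ _) _; rewrite leq_pmulr.
Qed.

Lemma wmono_kerD a : wmono a 0 \in lker wD.
Proof.
rewrite memv_ker; apply/eqP; apply: wave_ofP => b.
rewrite dropLE wave_of0 scale1r wave_monoE // /mono; case: eqP => _; last exact: linear0.
by rewrite expr0 drop_poly_eq0 // size_poly1.
Qed.

(** A wave killed by D has degree below n_a in each colour a. *)
Lemma dim_kerD : (\dim (lker wD) <= \sum_a n a)%N.
Proof.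
pose X := flatten [seq [seq wmono a i | i <- iota 0 (n a)] | a <- enum 'I_s].
have -> : (\sum_a n a)%N = size X.
  rewrite size_flatten sumnE /shape !big_map /=.
  by apply: eq_bigr => a _; rewrite size_map size_iota.
apply: leq_trans (dim_span X); apply: dimvS; apply/subvP => v.
rewrite memv_ker => /eqP vD.
have sv a : (size (wave_of v a) <= n a)%N.
  have := congr1 (fun v => size (wave_of v a)) vD.
  by rewrite dropLE scale1r wave_of0 size_poly0 size_drop_poly => /eqP; rewrite subn_eq0.
have -> : v = \sum_(a < s) \sum_(i < n a) (wave_of v a)`_i *: wmono a i.
  apply: wave_ofP => b; rewrite wave_of_sum (bigD1 b) //= wave_of_sum.
  rewrite [X in _ + X]big1 => [|a ab]; last first.
    rewrite wave_of_sum big1 // => i _; rewrite wave_ofZ.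
    have [iw|wi] := ltnP i wd; last first.
      by rewrite nth_default ?scale0r // (leq_trans (size_wave _ _)).
    by rewrite wave_monoE // /mono eq_sym (negPf ab) scaler0.
  rewrite addr0 -{1}(take_poly_id (sv b)) /take_poly poly_def.
  apply: eq_bigr => i _; rewrite wave_ofZ.
  have [iw|wi] := ltnP i wd; last first.
    by rewrite nth_default ?scale0r // (leq_trans (size_wave _ _)).
  by rewrite wave_monoE // /mono eqxx.
apply: rpred_sum => a _; apply: rpred_sum => i _; apply: rpredZ; apply: memv_span.
apply/flattenP; exists [seq wmono a i | i <- iota 0 (n a)].
  by apply: map_f; rewrite mem_enum.
by apply: map_f; rewrite mem_iota /=.
Qed.

Lemma dim_cap_kerD (W : {vspace vT}) a : wmono a 0 \notin W ->
  (\dim (W :&: lker wD) < \sum_a n a)%N.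
Proof.
move=> aW; apply: leq_trans dim_kerD; rewrite ltnNge; apply: contra aW => h.
have /eqP e : (W :&: lker wD)%VS == lker wD by rewrite eqEdim capvSr.
by have := wmono_kerD a; rewrite -{1}e memv_cap => /andP[].
Qed.

Lemma free_span_tuple k (v : k.-tuple vT) :
  (forall f : 'I_k -> K, \sum_l f l *: v`_l = 0 -> forall l, f l = 0) ->
  \dim <<v>> = k /\ basis_of <<v>> v.
Proof.
move=> h; have fv : free v by apply/freeP.
by split; [have /eqP -> := fv; rewrite size_tuple|rewrite basisEfree fv subvv /= (eqP fv)].
Qed.

(* A vanishing space after the reduction is replaced by the one spanned by a
   constant wave, so that there is at least one Jordan block. *)
Lemma jordan_reduce (Mn E : nat) (W : {vspace vT}) X : (0 < s)%N -> (1 < \sum_a n a)%N ->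
  (0 < Mn <= wd)%N -> stable n W -> (forall a i, (i < Mn)%N -> wmono a i \in W) ->
  (forall v a, v \in W -> size (wave_of v a) <= Mn + E)%N -> basis_of W X ->
  exists (e : 'I_s -> nat) hs,
  [/\ (0 < size hs < \sum_a n a)%N, forall a, (Mn <= (e a).+1)%N,
      forall h, h \in hs -> iter h.2.+1 wD h.1 = 0 /\ iter h.2 wD h.1 != 0,
      forall v a, v \in jordan_seq wD hs -> (size (wave_of v a) <= E.+1)%N &
      \dim W = (size (jordan_seq wD hs) + \sum_a e a)%N] /\
  exists2 c : K, c != 0 & forall m t, (\sum_b m b)%N = \dim W ->
  altv x0 (\dim W) X m t = if [forall a, e a <= m a]%N
    then c * altv x0 (size (jordan_seq wD hs)) (jordan_seq wD hs) (diffn m e) t else 0.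
Proof.
move=> s0 n2 /andP[Mn0 Mnwd] sW monoW szW bX.
have [e [W' [[sW' noW' Me szW' dimW'] hX]]] :=
  @reduce K s n x0 wd wd_gt0 (fun=> Mn) (fun=> Mn + E)%N W (fun=> Mnwd) sW monoW szW.
have [X' [bX' [c c0 hc]]] := hX X bX.
have sz1 v a : v \in W' -> (size (wave_of v a) <= E)%N.
  by move=> vW'; apply: leq_trans (szW' v a vW') _; rewrite leq_subLR leq_add2r.
pose a0 : 'I_s := Ordinal s0.
have [W'0|W'0] := posnP (\dim W').
  exists (fun a => e a - (a == a0))%N, [:: (wmono a0 0, 0%N)].
  have ea0 : (0 < e a0)%N by apply: leq_trans (Me a0).
  have jE : jordan_seq wD [:: (wmono a0 0, 0%N)] = [:: wmono a0 0] by [].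
  have sume : (\sum_a e a = 1 + \sum_a (e a - (a == a0)))%N.
    rewrite (bigD1 a0) // [in RHS](bigD1 a0) //= ?eqxx subn1 addnA add1n prednK //.
    by congr (_ + _)%N; apply: eq_bigr => a /negPf ->; rewrite subn0.
  split; first split=> //.
  - by move=> a; apply: leq_trans (Me a) _; case: (a == a0) => /=; lia.
  - move=> h; rewrite inE => /eqP -> /=; split; last exact: wmono0_neq0.
    by apply/eqP; rewrite -memv_ker wmono_kerD.
  - move=> v a; rewrite jE inE => /eqP ->; rewrite wave_monoE // /mono expr0.
    by case: eqP => _; rewrite ?size_poly1 ?size_poly0.
  - by rewrite dimW' W'0 add0n sume.
  exists c => // m t mk; rewrite hc //.
  have -> : altv x0 (\dim W') X' (diffn m e) t = 1 by rewrite W'0 /altv /alt det_mx00.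
  have smk (P : [forall a, e a - (a == a0) <= m a]%N) :
     (\sum_a diffn m (fun a => e a - (a == a0)) a = 1)%N.
    rewrite /diffn; apply: (@addIn (\sum_a (e a - (a == a0)))%N).
    have me : (\sum_a m a = \sum_a e a)%N by rewrite mk dimW' W'0.
    rewrite -sume -me -big_split /=.
    by apply: eq_bigr => a _; rewrite subnK //; apply: (forallP P).
  case: ifP => [/forallP h|/negP h].
    have P : [forall a, e a - (a == a0) <= m a]%N.
      by apply/forallP => a; apply: leq_trans (leq_subr _ _) (h a).
    rewrite P jE /altv (@alt_down K s x0 a0 0); last 2 first.
    - exact: smk.
    - by move=> a; rewrite /= wave_monoE.
    have -> : (0 < diffn m (fun a => e a - (a == a0)) a0)%N.
      by rewrite /diffn eqxx subn1 subn_gt0 prednK.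
    by rewrite /alt det_mx00.
  case: ifP => // P; rewrite jE /altv (@alt_down K s x0 a0 0); last 2 first.
  - exact: smk.
  - by move=> a; rewrite /= wave_monoE.
  case: ifP => [|_]; last by rewrite mulr0.
  rewrite /diffn eqxx subn1 subn_gt0 prednK // => h'; case: h; apply/forallP => a.
  have := forallP P a; case: eqP => [-> //|_]; by rewrite subn0.
have [hs [bhs nil szhs]] := jordan_basis sW' (fun v (_ : v \in W') => wD_nilpotent v).
have dimJ : \dim W' = size (jordan_seq wD hs).
  by have /andP[/eqP <- /eqP ->] := bhs.
exists e, hs; split; first split=> //.
- apply/andP; split; last by apply: leq_ltn_trans szhs _; apply: (dim_cap_kerD (noW' a0)).
  by case: hs dimJ {bhs nil szhs} => //= dimJ; rewrite dimJ in W'0.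
- by move=> a; apply: leq_trans (Me a) _.
- move=> h hh; split; first exact: nil.
  have := jordan_ends_free (basis_free bhs); move/free_not0; apply.
  exact: map_f.
- by move=> v a vJ; apply: leqW; apply: sz1; apply: (basis_mem bhs).
- by rewrite -dimJ.
have [c' c'0 hc'] := altv_basis x0 bX' bhs.
exists (c * c') => [|m t mk]; first by rewrite mulf_neq0.
by rewrite hc // hc' dimJ mulrA.
Qed.

End WaveStructure.

(** * Tau-functions as determinants of Jordan chains *)

Section ForwardChains.
Variables (K : numClosedFieldType) (s : nat) (n : 'I_s -> nat) (x0 : 'I_s * nat).
Hypotheses (s_gt0 : (0 < s)%N) (n_gt0 : forall a, (0 < n a)%N).
Hypothesis n_ge2 : (2 <= \sum_a n a)%N.
Local Notation Pt := ('I_s * K)%type.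

Lemma alt_seqE k (L : seq ('I_s -> {poly K})) m t : size L = k ->
  alt_seq x0 L m t = alt x0 (fun l : 'I_k => nth (fun=> 0) L l) m t.
Proof. by move=> <-. Qed.

Lemma altv_seq wd (J : seq 'M[K]_(s, wd)) m t :
  altv x0 (size J) J m t = alt_seq x0 (map (@wave_of K s wd) J) m t.
Proof.
rewrite (alt_seqE (k := size J)) ?size_map //; apply: eq_alt => l a.
by rewrite (nth_map 0).
Qed.

Lemma chain_list_jordan wd (hs : seq ('M[K]_(s, wd) * nat)) :
  chain_list n (fun j : 'I_(size hs) => wave_of (nth (0, 0%N) hs j).1)
    (fun j => (nth (0, 0%N) hs j).2) =
  map (@wave_of K s wd) (jordan_seq (wave_D K n wd) hs).
Proof.
rewrite /jordan_seq [in RHS](esym (mkseq_nth (0, 0%N) hs)) /mkseq -val_enum_ord.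
rewrite map_flatten -!map_comp; congr flatten; rewrite enumT; apply: eq_map => j.
rewrite -[RHS]/(map (@wave_of K s wd)
  (chain (wave_D K n wd) (nth (0, 0%N) hs j).1 (nth (0, 0%N) hs j).2.+1)).
rewrite /chain -map_comp; apply: eq_map => e.
by apply/funext => a; apply/esym/iter_wD.
Qed.

Definition nonneg_part (m : lattice s) a := `|m a|%N.

Definition chain_form (tau : tau_space K s) (d : lattice s) r
    (g : 'I_r -> 'I_s -> {poly K}) (kp : 'I_r -> nat) c :=
  forall (m : lattice s) t, peval t tau@_m =
    if [forall a, 0 <= (m - d) a] && (\sum_a (m - d) a == (size (chain_list n g kp))%:Z)
    then c * alt_seq x0 (chain_list n g kp) (nonneg_part (m - d)) t else 0.

(** The two conditions on sizes say that D^(kp j + 1) kills g_j while D^(kp j) does not; they will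
    identify [kp] with the k_j of the statement. *)
Lemma polynomial_tau_chains (tau : tau_space K s) : polynomial_tau n tau ->
  exists (d : lattice s) r (g : 'I_r -> 'I_s -> {poly K}) (kp : 'I_r -> nat) c,
  [/\ (1 <= r < \sum_a n a)%N, c != 0,
      forall j a, (size (g j a) <= (kp j).+1 * n a)%N,
      forall j, exists a, (kp j * n a < size (g j a))%N &
      chain_form tau d g kp c].
Proof.
move=> htau; have [E [L hEL]] := polynomial_tau_waves x0 s_gt0 htau.
(* M exceeds the number L of times in tau and the size E + 1 allowed to the reduced waves. The extra
   unit compensates for the constant wave put back by [jordan_reduce] when nothing else is left. *)
pose M := (maxn L E.+1).+1.
have LM : (L <= M)%N by apply: leqW; apply: leq_maxl.
have [d [k [w [c []]]]] := hEL M isT LM.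
set T := fun m : lattice s => tau@_(m - d).
move=> [c0 Tw sw mw] [szw suppT depT freew].
pose wd := (M + E)%N; have wd0 : (0 < wd)%N by [].
pose v := [tuple of_wave wd (w l) | l < k.+1].
have vE (l : 'I_k.+1) : v`_l = of_wave wd (w l).
  by rewrite -[v`_l]/(nth 0 v l) -tnth_nth tnth_mktuple.
have wvE (l : 'I_k.+1) a : wave_of v`_l a = w l a.
  by rewrite vE of_waveK // => b; apply: szw.
pose W := <<v>>%VS.
have [dimW bX] : \dim W = k.+1 /\ basis_of W v.
  apply: free_span_tuple => f hf; apply: freew => a.
  have := congr1 (fun u => wave_of u a) hf; rewrite wave_of_sum wave_of0 => h.
  rewrite -[RHS]h.
  by apply: eq_bigr => l _; rewrite wave_ofZ wvE.
have spanW g u : spans w g -> (forall a, wave_of u a = g a) -> u \in W.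
  move=> [f hf] hu; have -> : u = \sum_l f l *: v`_l.
    apply: wave_ofP => a; rewrite hu hf wave_of_sum.
    by apply: eq_bigr => l _; rewrite wave_ofZ wvE.
  by apply: rpred_sum => l _; apply/rpredZ/memv_span/mem_nth; rewrite size_tuple.
have sW : stable n W.
  rewrite /stable limg_span; apply/span_subvP => u /mapP[u' /tnthP[l ->] ->].
  rewrite (tnth_nth 0); apply: spanW (sw l) _ => a.
  by rewrite dropLE scale1r wvE.
have monoW a i : (i < M)%N -> wave_mono K wd a i \in W.
  move=> iM; apply: spanW (mw a i iM) _ => b.
  by rewrite wave_monoE // (leq_trans iM) // leq_addr.
have szW u a : u \in W -> (size (wave_of u a) <= M + E)%N.
  by move=> _; apply: size_wave.
have Mwd : (0 < M <= wd)%N by apply/andP; split; rewrite // leq_addr.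
have [e [hs [[szhs Me nil szJ dimJ] [c1 c10 hc1]]]] :=
  jordan_reduce x0 wd0 n_gt0 s_gt0 n_ge2 Mwd sW monoW szW bX.
pose J := jordan_seq (wave_D K n wd) hs.
pose g (j : 'I_(size hs)) := wave_of (nth (0, 0%N) hs j).1.
pose kp (j : 'I_(size hs)) := (nth (0, 0%N) hs j).2.
have CLE : chain_list n g kp = map (@wave_of K s wd) J := chain_list_jordan hs.
have szC : size (chain_list n g kp) = size J by rewrite CLE size_map.
pose el : lattice s := [ffun a => (e a)%:Z].
have TE (m : lattice s) t : peval t (T m) =
    if [forall a, 0 <= (m - el) a] && (\sum_a (m - el) a == (size J)%:Z)
    then c * c1 * altv x0 (size J) J (nonneg_part (m - el)) t else 0.
  have rep (X : 'I_k.+1 -> Pt) : cnt X = m -> delta X != 0 -> peval (tpt X) (T m) =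
      c * (if [forall a, e a <= cntn X a]%N
           then c1 * altv x0 (size J) J (diffn (cntn X) e) (tpt X) else 0).
    move=> <- /Tw ->; congr (_ * _); rewrite -hc1 dimW ?sum_cntn //.
    by apply: eq_alt => l a; rewrite wvE.
  have mE (X : 'I_k.+1 -> Pt) : (forall a, 0 <= m a) -> cntn X =1 nonneg_part m -> cnt X = m.
    move=> m0 h; apply/ffunP => a; rewrite cntE -/(cntn X a) h /nonneg_part.
    by rewrite gez0_abs.
  have sumE : \sum_a (m - el) a = \sum_a m a - (\sum_a e a)%N%:Z.
    rewrite -natz natr_sum -sumrB; apply: eq_bigr => a _.
    by rewrite latticeB ffunE natz.
  have elE a : (m - el) a = m a - (e a)%:Z by rewrite latticeB ffunE.
  rewrite dimW in dimJ.
  case: ifP => [/andP[/forallP mge /eqP msum]|/negP nP].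
    have m0 a : 0 <= m a by have := mge a; rewrite elE; lia.
    have sumN : (\sum_a nonneg_part m a)%N = k.+1.
      apply/eqP; rewrite -eqz_nat -natz natr_sum dimJ PoszD -msum sumE subrK.
      by apply/eqP/eq_bigr => a _; rewrite natz gez0_abs.
    have sumJ : (\sum_a nonneg_part (m - el)%R a)%N = size J.
      apply/eqP; rewrite -eqz_nat -natz natr_sum -msum.
      by apply/eqP/eq_bigr => a _; rewrite natz gez0_abs.
    (* The difference between tau and the determinant involves at most [M.-1] times of each colour
       and is tested at configurations with at least that many points of each. *)
    pose f := T m - (c * c1) *:
      alt_poly x0 (fun l : 'I_(size J) => wave_of J`_l) (nonneg_part (m - el)).
    have pf t' : peval t' f = peval t' (T m) -
        c * c1 * altv x0 (size J) J (nonneg_part (m - el)) t'.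
      by rewrite (rmorphB (peval t')) /= (pevalZ t') peval_alt_poly.
    suff f0 : peval t f = 0 by apply/eqP; rewrite -subr_eq0 -pf f0.
    apply: (peval_eq0_at_points x0 sumN (M := M.-1)).
    - by move=> a; have := mge a; have := Me a; rewrite elE /nonneg_part; lia.
    - move=> t1 t2 tt; rewrite !pf; congr (_ - _ * _).
        by apply: depT => u uL; apply: tt; rewrite (leq_trans uL) // leq_maxl.
      apply: (@alt_dep _ _ _ M.-1) => // l a.
      apply: leq_trans (szJ _ a (mem_nth 0 (ltn_ord l))) _.
      by apply: leqW; apply: leq_maxr.
    move=> X cX dX; rewrite pf (rep X) ?(mE X) //.
    have -> : [forall a, e a <= cntn X a]%N.
      by apply/forallP => a; have := mge a; rewrite elE cX /nonneg_part; lia.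
    rewrite mulrA /altv; apply/eqP; rewrite subr_eq0; apply/eqP; congr (_ * _).
    apply: eq_alt_rows => a; rewrite /diffn cX /nonneg_part elE.
    by have := mge a; rewrite elE; lia.
  suff -> : T m = 0 by rewrite (rmorph0 (peval t)).
  apply/eqP; apply: contrapT => /negP Tm; have [mM msum] := suppT m Tm.
  have m0 a : 0 <= m a by have := mM a; lia.
  move/eqP: Tm; apply; apply: peval_eq0 => t'.
  have sumN : (\sum_a nonneg_part m a)%N = k.+1.
    apply/eqP; rewrite -eqz_nat -natz natr_sum -msum.
    by apply/eqP/eq_bigr => a _; rewrite natz gez0_abs.
  apply: (peval_eq0_at_points x0 sumN (M := M)).
  - by move=> a; have := mM a; rewrite /nonneg_part; lia.
  - by move=> t1 t2 tt; apply: depT => u uL; apply: tt; rewrite (leq_trans uL).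
  move=> X cX dX; rewrite (rep X) ?(mE X) //.
  case: ifP => [/forallP h|_]; last by rewrite mulr0.
  case: nP; rewrite sumE msum dimJ PoszD addrK eqxx andbT; apply/forallP => a.
  by have := h a; have := m0 a; rewrite elE cX /nonneg_part; lia.
exists (el - d), (size hs), g, kp, (c * c1); split=> //.
- by rewrite mulf_neq0.
- move=> j a; have [h1 _] := nil _ (mem_nth (0, 0%N) (ltn_ord j)).
  have := congr1 (fun u => size (wave_of u a)) h1.
  by rewrite iter_wD wave_of0 size_poly0 size_drop_poly => /eqP; rewrite subn_eq0.
- move=> j; have [_ h2] := nil _ (mem_nth (0, 0%N) (ltn_ord j)).
  apply: contrapT => no; move/eqP: h2; apply; apply: wave_ofP => a.
  rewrite iter_wD wave_of0 drop_poly_eq0 // leqNgt; apply/negP => h.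
  by apply: no; exists a.
move=> m t; have := TE (m + d) t; rewrite /T addrK => ->.
have -> : m + d - el = m - (el - d) by rewrite opprB addrA.
by rewrite szC altv_seq -CLE.
Qed.

End ForwardChains.

(** * The determinants of the statement *)

Section SchurDerivation.
Variables (K : numFieldType) (A : comAlgType K) (d : {linear A -> A}).
Hypothesis dM : forall x y, d (x * y) = d x * y + x * d y.
Variables (u : nat -> A) (c : K) (k : nat).
Hypotheses (k_gt0 : (0 < k)%N) (du : forall i, (0 < i)%N -> d (u i) = (c *+ (i == k))%:A).

(** The rule ds_l/du_k = s_(l-k), by induction through the recursion. The factor [c] is 0 when d
    differentiates by a variable of another colour. *)
Lemma schur_deriv l : d (schur l u) = c *: (if (k <= l)%N then schur (l - k) u else 0).
Proof.
elim/ltn_ind: l => -[_|l IH].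
  rewrite schur0 leqn0 (gtn_eqF k_gt0) scaler0.
  have := dM 1 1; rewrite !mulr1 mul1r => /eqP.
  by rewrite eq_sym addrC -subr_eq0 addrK => /eqP.
apply: (@scalerI _ _ l.+1%:R); first by rewrite pnatr_eq0.
rewrite -linearZ schur_rec linear_sum /=.
transitivity (\sum_(1 <= i < l.+2) (i%:R *: ((c *+ (i == k)) *: schur (l.+1 - i) u)
    + c *: (i%:R *: (u i * (if (k <= l.+1 - i)%N then schur (l.+1 - i - k) u else 0))))).
  apply: eq_big_nat => i /andP[i0 il].
  rewrite linearZ /= dM du // IH; last by lia.
  by rewrite scalerDr -scalerAl mul1r -scalerAr !scalerA [i%:R * c]mulrC.
rewrite big_split -scaler_sumr /=; have [kl|kl] := leqP k l.+1; last first.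
  rewrite !big_nat big1 => [|i /andP[_ il]]; last first.
    by rewrite (ltn_eqF (leq_trans _ kl)) // scale0r scaler0.
  rewrite big1 ?scaler0 ?addr0 // => i /andP[_ il].
  by rewrite leqNgt (leq_ltn_trans (leq_subr _ _) kl) mulr0 scaler0.
have -> : \sum_(1 <= i < l.+2) i%:R *: ((c *+ (i == k)) *: schur (l.+1 - i) u) =
    c *: (k%:R *: schur (l.+1 - k) u).
  rewrite (bigD1_seq k) ?mem_index_iota ?iota_uniq ?k_gt0 //= eqxx mulr1n.
  rewrite big1 ?addr0 => [|i /negPf ->]; last by rewrite scale0r scaler0.
  by rewrite !scalerA mulrC.
have -> : \sum_(1 <= i < l.+2) i%:R *:
      (u i * (if (k <= l.+1 - i)%N then schur (l.+1 - i - k) u else 0)) =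
    (l.+1 - k)%:R *: schur (l.+1 - k) u.
  rewrite schur_rec (big_cat_nat (n := (l.+1 - k).+1)) //=; last by lia.
  rewrite [X in _ + X]big_nat [X in _ + X]big1 ?addr0 => [|i /andP[h _]]; last first.
    by rewrite leqNgt (_ : (_ < k)%N) ?mulr0 ?scaler0 //; lia.
  apply: eq_big_nat => i /andP[i0 h]; rewrite (_ : (k <= _)%N); last by lia.
  by rewrite subnAC.
by rewrite -scalerDr -scalerDl -natrD subnKC // !scalerA mulrC.
Qed.

End SchurDerivation.

Section KdvComponents.
Variables (K : numClosedFieldType) (s : nat) (n : 'I_s -> nat) (x0 : 'I_s * nat).
Hypothesis n_gt0 : forall a, (0 < n a)%N.
Local Notation V := (tvars s).
Local Notation A := (polyring K V).

Lemma pderiv_Lf_poly b k a e Q : (0 < k)%N ->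
  pderiv (tidx b k) (Lf_poly a e Q) = if b == a then Lf_poly a (e + k%:Z) Q else 0 :> A.
Proof.
move=> k0.
have ds l : pderiv (tidx b k) (schur l (fun i => var K (tidx a i))) =
    (b == a)%:R *: (if (k <= l)%N then schur (l - k) (fun i => var K (tidx a i)) else 0) :> A.
  pose d : {linear A -> A} := @pderiv K V (tidx b k).
  have dM x y : d (x * y) = d x * y + x * d y := @pderivM K V (tidx b k) x y.
  have du i : (0 < i)%N -> d (var K (tidx a i)) = ((b == a)%:R *+ (i == k))%:A.
    move=> i0; apply: etrans (pderiv_var K (tidx b k) (tidx a i)) _.
    have -> : (tidx a i == tidx b k) = (b == a) && (i == k).
      by rewrite xpair_eqE [a == b]eq_sym; congr (_ && _); lia.
    by case: (b == a); case: (i == k); rewrite /= ?mul0rn ?scale1r ?scale0r.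
  have h := @schur_deriv K A d dM (fun i => var K (tidx a i)) (b == a)%:R k k0 du l.
  exact: h.
rewrite /Lf_poly linear_sum /=.
case: (b =P a) ds => [_|_] ds; last first.
  rewrite big1 // => l _; rewrite linearZ /=; case: (l%:Z - e) => j.
    by rewrite ds !scale0r scaler0.
  by rewrite linear0 scaler0.
apply: eq_bigr => l _; rewrite linearZ /=; congr (_ *: _).
have -> : l%:Z - (e + k%:Z) = l%:Z - e - k%:Z by rewrite opprD addrA.
case: (l%:Z - e) => j; last first.
  by rewrite linear0 (_ : Negz j - k%:Z = Negz (j + k)) //; lia.
rewrite ds scale1r; case: leqP => kj.
  by have -> : j%:Z - k%:Z = (j - k)%N by lia.
by have -> : j%:Z - k%:Z = Negz (k - j).-1 by lia.
Qed.

(** With [E] = 0 this is the shape of the functions h_j. D adds n_a to each [E a], a derivative in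
    one colour keeps only that colour, and the constant disappears with the first derivative. *)
Definition wave_fun (x : K) (E : 'I_s -> nat) (w : 'I_s -> {poly K}) : A :=
  x%:A + \sum_a Lf_poly a ((E a)%:Z - 1) (w a).

Lemma pderiv_wave_fun b k x E w : (0 < k)%N ->
  pderiv (tidx b k) (wave_fun x E w) = Lf_poly b ((E b + k)%N%:Z - 1) (w b).
Proof.
move=> k0; have h a : pderiv (tidx b k) (Lf_poly a ((E a)%:Z - 1) (w a)) =
    if a == b then Lf_poly b ((E b + k)%N%:Z - 1) (w b) else 0 :> A.
  have <- : (E b)%:Z - 1 + k%:Z = (E b + k)%N%:Z - 1 by lia.
  apply: etrans (pderiv_Lf_poly b a _ _ k0) _.
  by rewrite [b == a]eq_sym; case: (a =P b) => [->|_].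
rewrite /wave_fun linearD /=.
rewrite (pderivC (tidx b k) x) add0r linear_sum /=.
by rewrite (eq_bigr _ (fun a _ => h a)) -big_mkcond big_pred1_eq.
Qed.

Lemma opD_wave_fun x E w :
  opD n (wave_fun x E w) = wave_fun 0 (fun a => E a + n a)%N w.
Proof.
rewrite /opD /wave_fun scale0r add0r; apply: eq_bigr => a _.
exact: pderiv_wave_fun.
Qed.

Lemma iter_opD_wave_fun e x w : exists y,
  iter e (opD n) (wave_fun x (fun=> 0%N) w) = wave_fun y (fun a => e * n a)%N w.
Proof.
elim: e => [|e [y IH]]; first by exists x.
exists 0; apply: etrans (congr1 (opD n) IH) _; apply: etrans (opD_wave_fun _ _ _) _.
apply: (congr1 (fun E => wave_fun 0 E w)).
by apply/funext => a; rewrite mulSn addnC.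
Qed.

Lemma iter_pderiv_wave_fun q b x E w : (0 < q)%N ->
  iter q (pderiv (tidx b 1)) (wave_fun x E w) = Lf_poly b ((E b + q)%N%:Z - 1) (w b).
Proof.
elim: q => // -[_ _|q IH _]; first exact: pderiv_wave_fun.
have <- : (E b + q.+1)%N%:Z - 1 + 1%:Z = (E b + q.+2)%N%:Z - 1 by lia.
apply: etrans (congr1 (pderiv (tidx b 1)) (IH isT)) _.
by apply: etrans (pderiv_Lf_poly b b _ _ (ltn0Sn 0)) _; rewrite eqxx.
Qed.

(** The index e n_b + q - 1 on w_b is the index q - 1 after division by z^(e n_b), since the
    remainder has degree below e n_b and contributes nothing. This is why D acts on waves by
    [drop_poly]. *)
Lemma peval_iter_wave_fun t q b e x w : (0 < q)%N ->
  peval t (iter q (pderiv (tidx b 1)) (iter e (opD n) (wave_fun x (fun=> 0%N) w))) =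
  Lf (fun i => t (tidx b i)) (q%:Z - 1) (drop_poly (e * n b) (w b)).
Proof.
move=> q0; have [y ->] := iter_opD_wave_fun e x w.
apply: etrans (congr1 (peval t) (iter_pderiv_wave_fun b y _ w q0)) _.
rewrite peval_Lf_poly.
rewrite -{1}(poly_take_drop (e * n b) (w b)) LfD Lf_small; last first.
  by apply: (@le_trans _ _ (e * n b)%N%:Z); [rewrite lez_nat size_take_poly|lia].
rewrite add0r mulrC LfXnM; congr (Lf _ _ _); lia.
Qed.

End KdvComponents.

(** * The determinants of the statement in terms of waves *)

Section KdvTau.
Variables (K : numClosedFieldType) (s : nat) (n : 'I_s -> nat) (x0 : 'I_s * nat).
Hypothesis n_gt0 : forall a, (0 < n a)%N.
Local Notation V := (tvars s).

(* The constant term of s_M(t + c) in t is dropped, since every entry of the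
   determinants is a derivative. *)
Definition schur_poly (M : nat) (c : nat -> K) : {poly K} :=
  \poly_(i < M) hS c (M.-1 - i).

Lemma size_schur_poly M c : size (schur_poly M c) = M.
Proof.
case: M => [|M]; first by rewrite /schur_poly poly_def big_ord0 size_poly0.
by rewrite size_poly_eq //= subnn hS0 oner_eq0.
Qed.

(** The addition formula for s_M(t + c). The index -1 pairs the coefficient i of the wave with
    degree i + 1 in t, so degree 0 is left outside. *)
Lemma Lf_schur_poly t M c : hS (fun i => t i + c i) M =
  hS c M + Lf t (0%:Z - 1) (schur_poly M c).
Proof.
rewrite hSD /conv big_nat_recl // hS0 mul1r subn0; congr (_ + _).
rewrite big_mkord (LfE (N := M)) ?size_schur_poly //.
apply: eq_bigr => i _; rewrite coef_poly ltn_ord mulrC.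
have -> : i%:Z - (0%:Z - 1) = i.+1%:Z by lia.
by congr (hS _ _ * _); have := ltn_ord i; lia.
Qed.

Section Data.
Variables (r : nat) (M : 'I_r -> 'I_s -> nat) (b : 'I_r -> 'I_s -> K)
  (c : 'I_r -> 'I_s -> nat -> K).

Definition hwave (j : 'I_r) (a : 'I_s) : {poly K} := b j a *: schur_poly (M j a) (c j a).

Lemma hfun_wave j : exists x, hfun M b c j = wave_fun x (fun=> 0%N) (hwave j).
Proof.
exists (\sum_a b j a * hS (c j a) (M j a)).
apply/eqP; rewrite -subr_eq0; apply/eqP; apply: peval_eq0 => t.
rewrite (rmorphB (peval t)) /= /wave_fun (rmorphD (peval t)) /= (pevalC t).
apply/eqP; rewrite subr_eq0; apply/eqP.
rewrite /hfun !(rmorph_sum (peval t)) /= -big_split; apply: eq_bigr => a _ /=.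
rewrite (pevalZ t) peval_schur peval_Lf_poly LfZ -mulrDr -Lf_schur_poly.
congr (_ * _); apply: eq_hS => i _.
by rewrite (rmorphD (peval t)) /= peval_var (pevalC t).
Qed.

(** Euclidean division of M - 1 by n turns the ceiling into a quotient, which compares directly with
    the size of a wave. *)
Lemma kexpE j : (forall a, 0 < M j a)%N ->
  kexp n M j = \max_(a < s) ((M j a).-1 %/ n a)%N.
Proof.
move=> M0; apply: eq_bigr => a _.
rewrite (Num.Theory.ceil_def (m := ((M j a).-1 %/ n a).+1%:Z)) //.
have na : 0 < (n a)%:R :> rat by rewrite ltr0n.
have := divn_eq (M j a).-1 (n a); have := ltn_pmod (M j a).-1 (n_gt0 a).
set q := (_ %/ _)%N; set x := (_ %% _)%N => xn Me.
have qE : (q.+1%:Z - 1)%:~R = q%:R :> rat by rewrite -addn1 PoszD addrK.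
rewrite ltr_pdivlMr // ler_pdivrMr // qE -pmulrn -!natrM ltr_nat ler_nat.
have := M0 a; rewrite mulSn; lia.
Qed.

Definition label_list : seq ('I_r * nat) :=
  flatten [seq [seq (j, e) | e <- iota 0 (kexp n M j).+1] | j <- enum 'I_r].

Lemma size_label_list : size label_list = tau_size n M.
Proof.
rewrite size_flatten sumnE /shape -map_comp big_map big_enum /= /tau_size.
rewrite -[X in (X + _)%N]card_ord -sum1_card -big_split.
by apply: eq_bigr => j _; rewrite /= size_map size_iota add1n.
Qed.

Lemma Hlist_labels : Hlist n M b c =
  [seq iter x.2 (opD n) (hfun M b c x.1) | x <- label_list].
Proof.
rewrite /Hlist /label_list map_flatten -map_comp; congr flatten.
by apply: eq_map => j; rewrite /comp -map_comp.
Qed.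

Lemma chain_list_labels g : chain_list n g (kexp n M) =
  [seq (fun a => drop_poly (x.2 * n a) (g x.1 a)) | x <- label_list] :> seq ('I_s -> {poly K}).
Proof.
rewrite /chain_list /label_list map_flatten -map_comp; congr flatten.
by apply: eq_map => j; rewrite /comp -map_comp.
Qed.

Lemma row_ops_rows m : row_ops K m =
  [seq iter x.2 (@pderiv K V (tidx x.1 1)) | x <- rows m].
Proof.
rewrite /row_ops /rows /row_labels map_flatten -map_comp; congr flatten.
by apply: eq_map => a; rewrite /comp -map_comp.
Qed.

Lemma peval_tau_component t m : (\sum_a m a)%N = tau_size n M ->
  peval t (tau_component n M b c m) = alt_seq x0 (chain_list n hwave (kexp n M)) m t.
Proof.
move=> mk; rewrite (alt_seqE x0 (k := tau_size n M)); last first.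
  by rewrite chain_list_labels size_map size_label_list.
rewrite /tau_component -(det_map_mx (peval t)) /alt; congr (\det _).
apply/matrixP => p l; rewrite !mxE.
have pk : (p < size (rows m))%N by rewrite size_rows mk.
have lk : (l < size label_list)%N by rewrite size_label_list.
have [j0 _] : exists j0 : 'I_r, True.
  by move: lk; case: label_list => // x xs _; exists x.1.
have -> : nth id (row_ops K m) p =
    iter (nth x0 (rows m) p).2 (@pderiv K V (tidx (nth x0 (rows m) p).1 1)).
  by rewrite row_ops_rows (nth_map x0).
have -> : nth 0 (Hlist n M b c) l = iter (nth (j0, 0%N) label_list l).2 (opD n)
    (hfun M b c (nth (j0, 0%N) label_list l).1).
  by rewrite Hlist_labels (nth_map (j0, 0%N)).
have -> : nth (fun=> 0) (chain_list n hwave (kexp n M)) l =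
    fun a => drop_poly ((nth (j0, 0%N) label_list l).2 * n a)
      (hwave (nth (j0, 0%N) label_list l).1 a).
  by rewrite chain_list_labels (nth_map (j0, 0%N)).
have : nth x0 (rows m) p \in rows m by rewrite mem_nth.
move: (nth x0 _ p) (nth _ _ l) => [a q] [j e]; rewrite mem_row_labels /= => /and3P[_ q0 _].
have [x hx] := hfun_wave j.
refine (etrans _ (peval_iter_wave_fun n_gt0 t a e x (hwave j) q0)).
exact: (congr1 (fun h => peval t (iter q (pderiv (tidx a 1)) (iter e (opD n) h))) hx).
Qed.

Lemma kdv_tauE (mu : lattice s) : (kdv_tau n M b c)@_mu =
  if [forall a, 0 <= mu a] && (\sum_a mu a == (tau_size n M)%:Z)
  then tau_component n M b c (nonneg_part mu) else 0.
Proof.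
rewrite /kdv_tau [LHS](raddf_sum (mcoeff mu)).
pose N := tau_size n M; pose D m := tau_component n M b c m.
pose zf (m : {ffun 'I_s -> 'I_N.+1}) : lattice s := [ffun a => (m a : nat)%:Z].
transitivity (\sum_(m : {ffun 'I_s -> 'I_N.+1} | (\sum_a m a)%N == N)
    (if zf m == mu then D (fun a => m a) else 0)).
  by apply: eq_bigr => m _; rewrite [LHS]mcoeffU; case: eqP.
case: ifP => [/andP[/forallP mu0 /eqP smu]|/negP nP]; last first.
  rewrite big1 // => m /eqP sm; case: eqP => // e; case: nP; rewrite -e.
  apply/andP; split; first by apply/forallP => a; rewrite ffunE.
  rewrite -/N -sm -natz natr_sum; apply/eqP/eq_bigr => a _.
  by rewrite ffunE natz.
have sN : (\sum_a nonneg_part mu a)%N = N.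
  apply/eqP; rewrite -eqz_nat -natz natr_sum -smu.
  by apply/eqP/eq_bigr => a _; rewrite natz gez0_abs.
have leN a : (nonneg_part mu a < N.+1)%N by rewrite ltnS -sN (bigD1 a) //= leq_addr.
pose m0 : {ffun 'I_s -> 'I_N.+1} := [ffun a => inord (nonneg_part mu a)].
have m0E a : m0 a = nonneg_part mu a :> nat by rewrite ffunE inordK.
have zm0 m : (zf m == mu) = (m == m0).
  apply/eqP/eqP => [e|->].
    by apply/ffunP => a; apply: val_inj; rewrite /= m0E /nonneg_part -e ffunE.
  by apply/ffunP => a; rewrite ffunE m0E gez0_abs.
rewrite (bigD1 m0) /=; last first.
  by apply/eqP; rewrite -[RHS]sN; apply: eq_bigr => a _; apply: m0E.
rewrite zm0 eqxx big1 ?addr0 => [|m /andP[_ /negPf mm]]; last by rewrite zm0 mm.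
by congr (D _); apply/funext => a.
Qed.

End Data.

(** The i-th value is u_i plus a polynomial in the earlier variables, so the u_i can be solved for
    successively. *)
Lemma hS_surj (f : nat -> K) m : f 0%N = 1 ->
  exists u, forall i, (i <= m)%N -> hS u i = f i.
Proof.
move=> f0; elim: m => [|m [u IH]].
  by exists (fun=> 0) => i; rewrite leqn0 => /eqP ->; rewrite hS0.
pose u' i := if i == m.+1 then u i + f m.+1 - hS u m.+1 else u i.
have low i : (i <= m)%N -> hS u' i = hS u i.
  move=> im; apply: eq_hS => h /andP[_ hi]; rewrite /u' ltn_eqF //.
  by rewrite ltnS (leq_trans hi).
exists u' => i; rewrite leq_eqVlt ltnS => /orP[/eqP ->|im]; last by rewrite low ?IH.
have m0 : m.+1%:R != 0 :> K by rewrite pnatr_eq0.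
apply: (mulfI m0); rewrite hS_rec big_nat_recr //= subnn hS0 mulr1.
have := hS_rec u m.+1; rewrite big_nat_recr //= subnn hS0 mulr1 => h.
have -> : \sum_(1 <= i < m.+1) i%:R * (u' i * hS u' (m.+1 - i)) =
    \sum_(1 <= i < m.+1) i%:R * (u i * hS u (m.+1 - i)).
  by apply: eq_big_nat => h' /andP[h0 hm]; rewrite low ?/u' ?ltn_eqF //; lia.
rewrite /u' eqxx; set x := m.+1%:R in h *; set S := \sum_(1 <= i < m.+1) _ in h *.
by rewrite (_ : S = x * hS u m.+1 - x * u m.+1); [ring|rewrite h addrK].
Qed.

(** The coefficients of [g], divided by the leading one and read from the top, are prescribed as the
    values s_i(c). The zero polynomial becomes b = 0 with M = 1, as M must be positive. *)
Lemma schur_poly_surj (g : {poly K}) : exists (b : K) (c : nat -> K),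
  g = b *: schur_poly (maxn 1 (size g)) c.
Proof.
have [->|g0] := eqVneq g 0; first by exists 0, (fun=> 0); rewrite scale0r.
have lg : lead_coef g != 0 by rewrite lead_coef_eq0.
have sg : (0 < size g)%N by rewrite size_poly_gt0.
have [|c hc] := @hS_surj (fun i => g`_((size g).-1 - i) / lead_coef g) (size g).-1.
  by rewrite subn0 divff.
exists (lead_coef g), c; rewrite (maxn_idPr _) //; apply/polyP => i.
rewrite coefZ coef_poly; case: ltnP => ig; last by rewrite nth_default ?mulr0.
by rewrite hc ?leq_subr // mulrC divfK // subKn //; lia.
Qed.

End KdvTau.

(** * Every tau-function has the stated form *)

Section Forward.
Variables (K : numClosedFieldType) (s : nat) (n : 'I_s -> nat).
Hypotheses (s_gt0 : (0 < s)%N) (n_gt0 : forall a, (0 < n a)%N).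
Hypothesis n_ge2 : (2 <= \sum_a n a)%N.
Local Notation x0 := (Ordinal s_gt0, 0%N).

Lemma alt_seq_scale r (g : 'I_r -> 'I_s -> {poly K}) kp y m t :
  alt_seq x0 (chain_list n (fun j a => y *: g j a) kp) m t =
  y ^+ size (chain_list n g kp) * alt_seq x0 (chain_list n g kp) m t.
Proof.
have -> : chain_list n (fun j a => y *: g j a) kp =
    map (fun (w : 'I_s -> {poly K}) a => y *: w a) (chain_list n g kp).
  rewrite /chain_list map_flatten -map_comp; congr flatten; apply: eq_map => j.
  rewrite /comp -map_comp; apply: eq_map => e.
  by apply/funext => a; rewrite /comp drop_polyZ.
rewrite (alt_seqE x0 (k := size (chain_list n g kp))) ?size_map //.
rewrite -(det_scalar (size _) y); apply: alt_mul => l a.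
rewrite (nth_map (fun=> 0)) // (bigD1 l) //= big1 ?addr0 => [|i il].
  by rewrite mxE eqxx.
by rewrite mxE (negPf il) scale0r.
Qed.

Lemma polynomial_tau_kdv (tau : tau_space K s) : polynomial_tau n tau ->
  exists (r : nat) (M : 'I_r -> 'I_s -> nat) (b : 'I_r -> 'I_s -> K)
     (c : 'I_r -> 'I_s -> nat -> K) (d : lattice s),
   [/\ (1 <= r < \sum_(a < s) n a)%N, forall j a, (0 < M j a)%N &
       tau = lattice_shift d (kdv_tau n M b c)].
Proof.
move=> /(polynomial_tau_chains x0 s_gt0 n_gt0 n_ge2).
move=> [d [r [g [kp [c0 [hr c00 szg exg tauE]]]]]].
set N := size (chain_list n g kp) in tauE.
have N0 : (0 < N)%N.
  rewrite /N; case: r g kp hr {szg exg tauE N} => // r g kp _.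
  rewrite size_flatten sumnE /shape !big_map /=.
  apply: (@leq_trans (\sum_(j < r.+1) (kp j).+1)); first by rewrite big_ord_recl.
  by apply: eq_leq; apply: eq_bigr => j _; rewrite size_map size_iota.
(* Scaling every wave by an N-th root of the constant multiplies the determinants of size N by that
   constant. *)
pose y := N.-root c0; have yN : y ^+ N = c0 by rewrite rootCK.
have y0 : y != 0 by rewrite rootC_eq0.
pose M (j : 'I_r) a := maxn 1 (size (g j a)).
have ex (x : 'I_r * 'I_s) : exists bc : K * (nat -> K),
    y *: g x.1 x.2 = bc.1 *: schur_poly (M x.1 x.2) bc.2.
  have [b [c h]] := schur_poly_surj (y *: g x.1 x.2); exists (b, c).
  by rewrite h /M size_scale.
have [bc hbc] := choice ex.
pose b j a := (bc (j, a)).1; pose c j a := (bc (j, a)).2.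
have wE : hwave M b c = (fun j a => y *: g j a).
  by apply/funext => j; apply/funext => a; rewrite /hwave /b /c -(hbc (j, a)).
have M0 j a : (0 < M j a)%N by rewrite /M leq_max.
have kE : kexp n M = kp.
  apply/funext => j; rewrite kexpE //; apply/eqP; rewrite eqn_leq; apply/andP; split.
    apply/bigmax_leqP => a _; rewrite -ltnS ltn_divLR //.
    rewrite /M prednK ?leq_max //; rewrite geq_max szg andbT.
    by rewrite muln_gt0 n_gt0.
  have [a ha] := exg j; apply: leq_trans (leq_bigmax a).
  by rewrite leq_divRL // -ltnS prednK // /M leq_max ha orbT.
exists r, M, b, c, d; split=> //; apply/malgP => mu.
rewrite lattice_shiftE; apply/eqP; rewrite -subr_eq0; apply/eqP; apply: peval_eq0 => t.
rewrite (rmorphB (peval t)) /= kdv_tauE tauE.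
have NE : tau_size n M = N.
  by rewrite -(size_label_list n M) -(size_map (fun x a => drop_poly (x.2 * n a) (g x.1 a)))
    -chain_list_labels kE.
rewrite NE; case: ifP => [/andP[mu0 /eqP h]|_]; last by rewrite (rmorph0 (peval t)) subrr.
rewrite (peval_tau_component x0) //; last first.
  rewrite NE; apply/eqP; rewrite -eqz_nat -natz natr_sum -h.
  by apply/eqP/eq_bigr => a _; rewrite natz gez0_abs // (forallP mu0).
by rewrite wE kE alt_seq_scale yN subrr.
Qed.

End Forward.

(** * Determinants of stable wave spaces satisfy the bilinear identity *)

Section Upshift.
Variables (K : numClosedFieldType) (s : nat) (n : 'I_s -> nat) (x0 : 'I_s * nat).
Hypothesis n_gt0 : forall a, (0 < n a)%N.
Local Notation V := (tvars s).
Local Notation A := (polyring K V).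
Local Notation Pt := ('I_s * K)%type.

Definition wave_stable k (w : 'I_k -> 'I_s -> {poly K}) :=
  forall l, spans w (fun a => drop_poly (n a) (w l a)).

Lemma spans_mem k (w : 'I_k -> 'I_s -> {poly K}) l : spans w (w l).
Proof.
exists (fun i => (i == l)%:R) => a.
rewrite (bigD1 l) //= eqxx scale1r big1 ?addr0 // => i /negPf ->.
by rewrite scale0r.
Qed.

Lemma spans_lin k (w : 'I_k -> 'I_s -> {poly K}) I (r : seq I) (f : I -> K) g :
  (forall i, spans w (g i)) -> spans w (fun a => \sum_(i <- r) f i *: g i a).
Proof.
move=> /choice[h hh]; exists (fun l => \sum_(i <- r) f i * h i l) => a.
under eq_bigr => i _ do rewrite hh scaler_sumr.
rewrite exchange_big; apply: eq_bigr => l _ /=.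
by rewrite scaler_suml; apply: eq_bigr => i _; rewrite scalerA.
Qed.

(** Inverse to [down]: a constant wave of colour [a] is put in front, and the others are multiplied
    by z in that colour, with the same signs. *)
Definition up (a : 'I_s) k (w : 'I_k -> 'I_s -> {poly K}) (l : 'I_k.+1) (b : 'I_s) :=
  if unlift ord0 l is Some i then low_sign K a b *: ('X^(b == a) * w i b) else mono K a 0 b.

Lemma drop_mulX d (p : {poly K}) : (0 < d)%N ->
  drop_poly d ('X * p) = 'X * drop_poly d p + (p`_d.-1)%:P.
Proof.
move=> d0; apply/polyP => i; rewrite coefD coefC coefXM !coef_drop_poly coefXM.
case: i => [|i]; last by rewrite !addSn /= addr0.
by rewrite add0n (gtn_eqF d0) add0r.
Qed.

(** In colour [a], D (z w) is z (D w) plus a constant, and this constant is a multiple of the added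
    wave. *)
Lemma up_stable a k (w : 'I_k -> 'I_s -> {poly K}) :
  wave_stable w -> wave_stable (up a w).
Proof.
move=> sw l; have [i|] := unliftP ord0 l => ->; last first.
  exists (fun=> 0) => b; rewrite big1 => [|j _]; last by rewrite scale0r.
  rewrite /up unlift_none /mono; case: eqP => _; last exact: linear0.
  by rewrite expr0 drop_poly_eq0 // size_poly1.
have [f hf] := sw i; pose x : K := low_sign K a a * (w i a)`_(n a).-1.
exists (fun l' => if unlift ord0 l' is Some j then f j else x) => b.
rewrite big_ord_recl unlift_none.
rewrite [X in _ + X](eq_bigr (fun j => low_sign K a b *: ('X^(b == a) * (f j *: w j b))));
  last by move=> j _; rewrite /up liftK -scalerAr !scalerA mulrC.
rewrite -scaler_sumr -mulr_sumr -hf /up liftK unlift_none drop_polyZ /mono.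
case: eqP => [->|_]; last by rewrite !expr0 !mul1r scaler0 add0r.
rewrite !expr1 drop_mulX // scalerDr addrC; congr (_ + _).
by rewrite expr0 /x alg_polyC polyCM mul_polyC.
Qed.

Lemma alt_up a k (w : 'I_k -> 'I_s -> {poly K}) m t : (\sum_b m b)%N = k.+1 ->
  alt x0 (up a w) m t = if (0 < m a)%N then alt x0 w (decr m a) t else 0.
Proof.
move=> mk; rewrite (@alt_down K s x0 a) //; last by move=> b; rewrite /up unlift_none.
case: ifP => // _; apply: eq_alt => l b; rewrite /down /up liftK drop_polyZ scalerA.
have -> : low_sign K a b * low_sign K a b = 1.
  by rewrite /low_sign; case: ifP; rewrite ?mulr1 // mulrNN mulr1.
by rewrite scale1r mulrC drop_polyMXn_id.
Qed.

Lemma up_iter (L : seq 'I_s) k (w : 'I_k -> 'I_s -> {poly K}) : wave_stable w ->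
  exists w' : 'I_(size L + k) -> 'I_s -> {poly K}, wave_stable w' /\
  forall m t, (\sum_b m b)%N = (size L + k)%N ->
  alt x0 w' m t = if [forall a, count_mem a L <= m a]%N
    then alt x0 w (diffn m (fun a => count_mem a L)) t else 0.
Proof.
move=> sw; elim: L => [|a L [w' [sw' hw']]].
  exists w; split=> // m t _; rewrite (_ : [forall a, _]); last by apply/forallP.
  by apply: eq_alt_rows => a; rewrite /diffn subn0.
exists (up a w'); split=> [|m t mk]; first exact: up_stable.
rewrite alt_up //; case: posnP => ma.
  by case: forallP => // /(_ a); rewrite /= eqxx ma.
rewrite hw'; last first.
  apply: succn_inj; rewrite -[RHS]mk.
  rewrite (bigD1 a) // [in RHS](bigD1 a) //= /decr eqxx subn1 -addSn prednK //.
  by congr (_ + _)%N; apply: eq_bigr => b /negPf ->; rewrite subn0.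
have -> : [forall b, count_mem b L <= decr m a b]%N =
    [forall b, count_mem b (a :: L) <= m b]%N.
  apply: eq_forallb => b; rewrite /decr /= [a == b]eq_sym.
  case: eqP => [->|_]; last by rewrite subn0 add0n.
  by rewrite subn1 add1n -ltnS prednK.
case: ifP => // _; apply: eq_alt_rows => b.
by rewrite /diffn /decr /= [a == b]eq_sym subnDA.
Qed.

Section PointIdentity.
Variables (T : lattice s -> A) (k : nat) (w : 'I_k.+1 -> 'I_s -> {poly K}).
Hypothesis sw : wave_stable w.
Hypothesis Tw : forall X : 'I_k.+1 -> Pt,
  peval (tpt X) (T (cnt X)) = alt x0 w (cntn X) (tpt X).

Lemma omega_alt (X : 'I_k.+1 -> Pt) :
  omega T X = \det (\matrix_(i, l) (w l (X i).1).[(X i).2]).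
Proof. by rewrite /omega Tw mulrC bialternant. Qed.

Lemma spans_drop j g : spans w g -> spans w (fun a => drop_poly (j * n a) (g a)).
Proof.
elim: j => [|j IH] hg.
  by case: hg => f hf; exists f => a; rewrite mul0n drop_poly0l.
have [f hf] := IH hg.
have [f' hf'] := spans_lin (index_enum 'I_k.+1) f sw; exists f' => a.
rewrite -hf' /=; transitivity (drop_poly (n a) (drop_poly (j * n a) (g a))).
  by apply/polyP => i; rewrite !coef_drop_poly mulSn addnA.
rewrite hf drop_poly_sum; apply: eq_bigr => l _; exact: drop_polyZ.
Qed.

(** Expansion of the determinant along the row of the inserted point: the minors do not depend on
    that point. *)
Lemma insert_poly_spans (X' : 'I_k -> Pt) : delta X' != 0 ->
  spans w (insert_poly T X').
Proof.
move=> d0; pose Cm : 'M[K]_(k, k.+1) := \matrix_(i, l) (w l (X' i).1).[(X' i).2].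
pose f (l : 'I_k.+1) := (-1) ^+ l * \det (col' l Cm) / delta X'.
exists f => a; apply: poly_eq_pts => x; apply: (mulIf d0).
rewrite -(insert_polyP T X' (a, x)) omega_alt (expand_det_row _ ord0) horner_sum mulr_suml.
apply: eq_bigr => l _; set Mx := \matrix_(i, l) _.
have -> : cofactor Mx ord0 l = f l * delta X'.
  rewrite /f divfK // /cofactor add0n; congr (_ * \det _).
  by apply/matrixP => i l'; rewrite !mxE pconsS.
rewrite mxE pcons0 hornerZ /=; ring.
Qed.

(** Expansion along the first column of determinants in which that column occurs twice. *)
Lemma plucker_spans g (X : 'I_k.+2 -> Pt) : spans w g ->
  \sum_(c < k.+2) (-1) ^+ c * omega T (prem c X) * (g (X c).1).[(X c).2] = 0.
Proof.
move=> [f hf]; pose B (l0 : 'I_k.+1) : 'M[K]_k.+2 := \matrix_(i, l)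
  (w (odflt l0 (unlift ord0 l)) (X i).1).[(X i).2].
have B0 l0 : \det (B l0) = 0.
  rewrite -det_tr; apply: (@determinant_alternate _ _ _ ord0 (lift ord0 l0)) => // i.
  by rewrite !mxE unlift_none liftK.
transitivity (\sum_l0 f l0 * \det (B l0)); last by rewrite big1 // => l _; rewrite B0 mulr0.
under [RHS]eq_bigr => l0 _ do rewrite (expand_det_col _ ord0) mulr_sumr.
rewrite exchange_big; apply: eq_bigr => c _ /=.
rewrite hf horner_sum mulr_sumr; apply: eq_bigr => l0 _.
rewrite hornerZ mxE unlift_none /= /cofactor addn0 omega_alt.
have -> : row' c (col' ord0 (B l0)) =
    \matrix_(i, l) (w l (prem c X i).1).[(prem c X i).2].
  by apply/matrixP => i l; rewrite !mxE liftK.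
by ring.
Qed.

Lemma bilin_val_points j (X : 'I_k.+2 -> Pt) (X' : 'I_k -> Pt) :
  delta X != 0 -> delta X' != 0 ->
  (forall a, (size (subst (shift_pt a (-1) (tpt X)) (T (cnt X - unitv a)%R))
     <= cntn X a)%N) ->
  bilin_val n T j (cnt X) (cnt X') (tpt X) (tpt X') = 0.
Proof.
move=> d0 d0' degT; rewrite bilin_val_residue //.
have := plucker_spans X (spans_drop j (insert_poly_spans d0')).
move=> /(congr1 (fun z => z / delta X)); rewrite mul0r mulr_suml => h.
by rewrite -[RHS]h; apply: eq_bigr => c _; rewrite mulrAC.
Qed.

End PointIdentity.

End Upshift.

(** * Every nonzero shifted determinant is a tau-function *)

Section Converse.
Variables (K : numClosedFieldType) (s : nat) (n : 'I_s -> nat) (x0 : 'I_s * nat).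
Hypothesis n_gt0 : forall a, (0 < n a)%N.
Local Notation V := (tvars s).
Local Notation A := (polyring K V).
Local Notation B := (polyring K (V + V)%type).
Local Notation Pt := ('I_s * K)%type.

(** One group of variables is specialised at a time, so that the test at points, which concerns
    K[t], can be used first for t and then for y. *)
Definition fix_y (y : V -> K) (Z : B) : A :=
  subst (fun v => match v with inl v => var K v | inr v => (y v)%:A end) Z.

Definition fix_t (t : V -> K) (Z : B) : A :=
  subst (fun v => match v with inl v => (t v)%:A | inr v => var K v end) Z.

Lemma peval_fix_y t y Z : peval t (fix_y y Z) = peval (join_pt t y) Z.
Proof.
apply: etrans (peval_subst _ t Z) _; apply: peval_ext => -[v|v] /=.
  exact: peval_var.
exact: pevalC.
Qed.

Lemma peval_fix_t t y Z : peval y (fix_t t Z) = peval (join_pt t y) Z.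
Proof.
apply: etrans (peval_subst _ y Z) _; apply: peval_ext => -[v|v] /=.
  exact: pevalC.
exact: peval_var.
Qed.

Lemma join_dep_bound (Z : B) : exists N, forall t t' y y' : V -> K,
  (forall v, (v.2 < N)%N -> t v = t' v) -> (forall v, (v.2 < N)%N -> y v = y' v) ->
  peval (join_pt t y) Z = peval (join_pt t' y') Z.
Proof.
have [d hd] := peval_dep Z.
pose ix (v : V + V) : nat := match v with inl v => v.2 | inr v => v.2 end.
exists (\max_(v <- d) ix v).+1 => t t' y y' ht hy; apply: hd => v vd.
have : (ix v < (\max_(v <- d) ix v).+1)%N.
  by rewrite ltnS; apply: (@leq_bigmax_seq _ _ xpredT ix v vd isT).
by case: v vd => v _ h; [apply: ht|apply: hy].
Qed.

Lemma uniform_labels D : exists L : seq 'I_s,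
  size L = (s * D)%N /\ forall a, count_mem a L = D.
Proof.
elim: D => [|D [L [szL cL]]]; first by exists [::]; rewrite muln0.
exists (enum 'I_s ++ L); rewrite size_cat szL size_enum_ord mulnS; split=> // a.
by rewrite count_cat cL count_uniq_mem ?enum_uniq // mem_enum.
Qed.

Lemma sum_const_lattice D : \sum_(a < s) D%:Z = (s * D)%N%:Z.
Proof. by rewrite sumr_const card_ord -mulr_natr natz mulrC. Qed.

Variables (r : nat) (M : 'I_r -> 'I_s -> nat) (b : 'I_r -> 'I_s -> K)
  (c : 'I_r -> 'I_s -> nat -> K).
Hypothesis M_gt0 : forall j a, (0 < M j a)%N.
Let N := tau_size n M.
Let w (l : 'I_N) : 'I_s -> {poly K} :=
  nth (fun=> 0) (chain_list n (hwave M b c) (kexp n M)) l.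

(** D sends each member of a chain to the next one, and the last to 0 because k_j + 1 steps exhaust
    every M_j^(a). *)
Lemma chain_list_stable : wave_stable n w.
Proof.
move=> l; have lN : (l < size (label_list n M))%N by rewrite size_label_list.
have [j0 _] : exists j0 : 'I_r, True.
  by move: lN; case: label_list => // x xs _; exists x.1.
have wE (l' : 'I_N) : w l' = fun a => drop_poly ((nth (j0, 0%N) (label_list n M) l').2 * n a)
    (hwave M b c (nth (j0, 0%N) (label_list n M) l').1 a).
  by rewrite /w chain_list_labels (nth_map (j0, 0%N)) // size_label_list.
rewrite wE; have : nth (j0, 0%N) (label_list n M) l \in label_list n M by rewrite mem_nth.
case: (nth _ _ l) => j e /flattenP[_ /mapP[j' _ ->] /mapP[e' he' [-> ->]]] /=.
rewrite mem_iota add0n ltnS /= in he'.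
have dd a : drop_poly (n a) (drop_poly (e' * n a) (hwave M b c j' a)) =
    drop_poly (e'.+1 * n a) (hwave M b c j' a).
  by apply/polyP => i; rewrite !coef_drop_poly mulSn addnA.
have [ek|ek] := ltnP e' (kexp n M j').
  have hin : (j', e'.+1) \in label_list n M.
    apply/flattenP; exists [seq (j', e) | e <- iota 0 (kexp n M j').+1].
      by apply: (map_f (fun j => [seq (j, e) | e <- iota 0 (kexp n M j).+1])); rewrite mem_enum.
    by apply: map_f; rewrite mem_iota.
  have iN : (index (j', e'.+1) (label_list n M) < N)%N.
    by have := hin; rewrite -index_mem size_label_list.
  have [f hf] := spans_mem w (Ordinal iN); exists f => a.
  by rewrite dd -hf wE /= nth_index.
exists (fun=> 0) => a; rewrite big1 => [|i _]; last by rewrite scale0r.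
rewrite dd drop_poly_eq0 //; apply: leq_trans (size_scale_leq _ _) _.
rewrite size_schur_poly; have := leq_bigmax (F := fun a => (M j' a).-1 %/ n a)%N a.
rewrite -kexpE // => /leq_trans/(_ ek); rewrite -ltnS ltn_divLR //.
by rewrite prednK.
Qed.

Lemma peval_kdv_shift D (L : seq 'I_s) k (w' : 'I_k -> 'I_s -> {poly K})
    (X : 'I_k -> Pt) t : (size L + N = k)%N -> (forall a, count_mem a L = D) ->
  size L = (s * D)%N ->
  (forall m t, (\sum_b m b)%N = k -> alt x0 w' m t =
     if [forall a, count_mem a L <= m a]%N
     then alt x0 w (diffn m (fun a => count_mem a L)) t else 0) ->
  peval t (kdv_tau n M b c)@_(cnt X - [ffun=> D%:Z]) = alt x0 w' (cntn X) t.
Proof.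
move=> szk cL szL ->; last exact: sum_cntn.
have XE a : (cnt X - [ffun=> D%:Z]) a = (cntn X a)%:Z - D%:Z.
  by rewrite latticeB cntE ffunE.
rewrite kdv_tauE.
have -> : [forall a, 0 <= (cnt X - [ffun=> D%:Z]) a] = [forall a, count_mem a L <= cntn X a]%N.
  by apply: eq_forallb => a; rewrite XE cL subr_ge0.
have sN : \sum_a (cnt X - [ffun=> D%:Z]) a = N%:Z.
  have -> : N%:Z = \sum_a cnt X a - (s * D)%N%:Z.
    by rewrite sum_cnt -szk szL PoszD [_ + N%:Z]addrC addrK.
  rewrite -sum_const_lattice -sumrB; apply: eq_bigr => a _.
  by rewrite latticeB ffunE.
rewrite sN eqxx andbT; case: ifP => [/forallP h|_]; last exact: rmorph0.
have DE a : nonneg_part (cnt X - [ffun=> D%:Z]) a = diffn (cntn X) (fun a => count_mem a L) a.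
  by rewrite /nonneg_part /diffn XE cL; have := h a; rewrite cL; lia.
rewrite (peval_tau_component x0) //; last first.
  apply/eqP; rewrite -eqz_nat -natz natr_sum -sN.
  apply/eqP/eq_bigr => a _; rewrite natz gez0_abs // XE -(cL a) subr_ge0.
  exact: h.
rewrite (alt_seqE x0 (k := N)); last by rewrite chain_list_labels size_map size_label_list.
exact: eq_alt_rows.
Qed.

(** The identity at points needs many points of each colour. Adding D constant waves of each colour
    shifts the lattice by D in every coordinate and preserves stability; the values at points then
    determine the polynomial in t and y. *)
Lemma kdv_bilinear j (m p : lattice s) t y : (0 < s)%N ->
  \sum_a m a = N%:Z + 1 -> \sum_a p a = N%:Z - 1 ->
  bilin_val n (fun mu => (kdv_tau n M b c)@_mu) j m p t y = 0.
Proof.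
move=> s0 sm sp; have [Z hZ] := bilin_val_poly n (fun mu => (kdv_tau n M b c)@_mu) j m p.
have [Mz hMz] := join_dep_bound Z.
have [supp_bd [C [var_bd hC]]] := support_bounds (kdv_tau n M b c).
(* After the shift the coordinates of m and p are positive and at least [Mz], the number of times in
   [Z], and those of m exceed the degree bound [C] of the components. *)
pose D := (\sum_a (`|m a| + `|p a|) + Mz + C + 1)%N.
have Dmp a : (`|m a| + `|p a| + Mz + C + 1 <= D)%N.
  by rewrite /D (bigD1 a) //= !leq_add2r leq_addr.
have [L [szL cL]] := uniform_labels D.
have [k hk] : exists k, (size L + N)%N = k.+1.
  exists (size L + N).-1; rewrite prednK // szL addn_gt0 muln_gt0 s0 /D.
  by rewrite addn1.
have [w' [sw' hw']] := up_iter x0 n_gt0 L chain_list_stable.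
move: w' sw' hw'; rewrite hk => w' sw' hw'.
pose dl : lattice s := [ffun=> D%:Z].
pose T (mu : lattice s) := (kdv_tau n M b c)@_(mu - dl).
have TE j' m' p' t' y' : bilin_val n T j' (m' + dl) (p' + dl) t' y' =
    bilin_val n (fun mu => (kdv_tau n M b c)@_mu) j' m' p' t' y'.
  by rewrite /T (bilin_val_shift n (fun mu => (kdv_tau n M b c)@_mu)) !addrK.
pose mn (a : 'I_s) := `|(m + dl)%R a|%N; pose pn (a : 'I_s) := `|(p + dl)%R a|%N.
have mE a : (mn a)%:Z = m a + D%:Z.
  by have := Dmp a; rewrite /mn latticeD ffunE; lia.
have pE a : (pn a)%:Z = p a + D%:Z.
  by have := Dmp a; rewrite /pn latticeD ffunE; lia.
have sumE (q : lattice s) (qn : 'I_s -> nat) : (forall a, (qn a)%:Z = q a + D%:Z) ->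
    (\sum_a qn a)%N%:Z = \sum_a q a + (s * D)%N%:Z.
  move=> qE; rewrite -sum_const_lattice -big_split -natz natr_sum.
  by apply: eq_bigr => a _; rewrite natz qE.
have smn : (\sum_a mn a)%N = k.+2.
  by apply/eqP; rewrite -eqz_nat (sumE m) // sm -hk szL; lia.
have spn : (\sum_a pn a)%N = k.
  by apply/eqP; rewrite -eqz_nat (sumE p) // sp; move: hk; rewrite szL; lia.
have Tw (X : 'I_k.+1 -> Pt) : peval (tpt X) (T (cnt X)) = alt x0 w' (cntn X) (tpt X).
  exact: (peval_kdv_shift X (tpt X) hk cL szL hw').
have cX k' (X : 'I_k' -> Pt) (q : lattice s) (qn : 'I_s -> nat) :
    (forall a, (qn a)%:Z = q a + D%:Z) -> cntn X =1 qn -> cnt X = q + dl.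
  by move=> qE h; apply/ffunP => a; rewrite cntE -/(cntn X a) h qE latticeD ffunE.
have pts0 (X : 'I_k.+2 -> Pt) (X' : 'I_k -> Pt) : cntn X =1 mn -> cntn X' =1 pn ->
    delta X != 0 -> delta X' != 0 -> peval (join_pt (tpt X) (tpt X')) Z = 0.
  move=> cm cp d0 d0'; rewrite hZ -TE -(cX _ X m mn) // -(cX _ X' p pn) //.
  apply: (bilin_val_points sw' Tw) => // a.
  have [_ hCm _] := hC (cnt X - unitv a - dl); apply: leq_trans (hCm a (-1) (tpt X)) _.
  by rewrite cm -lez_nat mE; have := Dmp a; lia.
have t0 (X' : 'I_k -> Pt) t' : cntn X' =1 pn -> delta X' != 0 ->
    peval (join_pt t' (tpt X')) Z = 0.
  move=> cp d0'; rewrite -peval_fix_y; move: t'.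
  apply: (peval_eq0_at_points x0 smn (M := Mz)) => [a|t1 t2 tt|X cm d0].
  - by rewrite -lez_nat mE; have := Dmp a; lia.
  - by rewrite !peval_fix_y; apply: hMz.
  by rewrite peval_fix_y; apply: pts0.
rewrite -hZ -peval_fix_t; move: y.
apply: (peval_eq0_at_points x0 spn (M := Mz)) => [a|y1 y2 yy|X' cp d0].
- by rewrite -lez_nat pE; have := Dmp a; lia.
- by rewrite !peval_fix_t; apply: hMz.
by rewrite peval_fix_t; apply: t0.
Qed.

Lemma kdv_polynomial_tau (d : lattice s) : (0 < s)%N ->
  lattice_shift d (kdv_tau n M b c) != 0 ->
  polynomial_tau n (lattice_shift d (kdv_tau n M b c)).
Proof.
move=> s0 tau0; split=> //; exists (N%:Z + \sum_a d a); split=> [m|j m p sm sp].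
  rewrite lattice_shiftE kdv_tauE; case: ifP => [/andP[_ /eqP h] _|_]; last by rewrite eqxx.
  rewrite -/N in h; rewrite -h -big_split; apply: eq_bigr => a _ /=.
  by rewrite latticeB subrK.
apply/bilinear_identityP => t y.
have -> : (fun mu => (lattice_shift d (kdv_tau n M b c))@_mu) =
    (fun mu => (kdv_tau n M b c)@_(mu - d)).
  by apply/funext => mu; apply: lattice_shiftE.
rewrite (bilin_val_shift n (fun mu => (kdv_tau n M b c)@_mu)).
have sB (q : lattice s) : \sum_a (q - d) a = \sum_a q a - \sum_a d a.
  by rewrite -sumrB; apply: eq_bigr => a _; apply: latticeB.
by apply: kdv_bilinear => //; rewrite sB ?sm ?sp; ring.
Qed.

End Converse.

Theorem theorem7 (R : realType) (s : nat) (n : 'I_s -> nat)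
  (s_gt0 : (0 < s)%N)
  (n_gt0 : forall a : 'I_s, (0 < n a)%N)
  (n_noninc : forall a a' : 'I_s, (a <= a')%N -> (n a' <= n a)%N)
  (n_ge2 : (2 <= \sum_(a < s) n a)%N) :
  (forall tau : tau_space R[i] s, polynomial_tau n tau ->
     exists (r : nat) (M : 'I_r -> 'I_s -> nat) (b : 'I_r -> 'I_s -> R[i])
            (c : 'I_r -> 'I_s -> nat -> R[i]) (d : lattice s),
       [/\ (1 <= r < \sum_(a < s) n a)%N,
           (forall j a, (0 < M j a)%N) &
           tau = lattice_shift d (kdv_tau n M b c)])
  /\
  (forall (r : nat) (M : 'I_r -> 'I_s -> nat) (b : 'I_r -> 'I_s -> R[i])
          (c : 'I_r -> 'I_s -> nat -> R[i]) (d : lattice s),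
     (1 <= r < \sum_(a < s) n a)%N ->
     (forall j a, (0 < M j a)%N) ->
     lattice_shift d (kdv_tau n M b c) != 0 ->
     polynomial_tau n (lattice_shift d (kdv_tau n M b c))).
Proof.
split=> [tau|r M b c d _ M_gt0 tau_neq0].
  exact: (polynomial_tau_kdv s_gt0 n_gt0 n_ge2).
exact: (kdv_polynomial_tau (Ordinal s_gt0, 0%N) n_gt0 M_gt0 s_gt0 tau_neq0).
Qed.
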